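(* Let $(Z_i^{(1)})_{i\ge1}$ and $(Z_i^{(2)})_{i\ge1}$ be two mutually independent sequences, each consisting of i.i.d. random vectors in $\mathbb{R}^2$ (the two laws may differ), with $\mathbb{E}[\|Z_1^{(k)}\|^2]<\infty$ for $k=1,2$. Assume that $\boldsymbol{0}\notin\{\boldsymbol{\mu}^{(1)},\boldsymbol{\mu}^{(2)},\boldsymbol{\mu}^{(1)}-\boldsymbol{\mu}^{(2)}\}$, that exactly one of the three numbers $\|\boldsymbol{\mu}^{(1)}\|,\|\boldsymbol{\mu}^{(2)}\|,\|\boldsymbol{\mu}^{(1)}-\boldsymbol{\mu}^{(2)}\|$ attains their maximum, and that $\sigma_D^2>0$. Then, for any $x\in\mathbb{R}$, $$\lim_{n\to\infty}\mathbb{P}\left[\frac{D_n-\mathbb{E}[D_n]}{\sqrt{\mathrm{Var}[D_n]}}\le x\right]=\lim_{n\to\infty}\mathbb{P}\left[\frac{D_n-\mathbb{E}[D_n]}{\sqrt{\sigma_D^2 n}}\le x\right]=\Phi(x),$$ where $\Phi$ is the cumulative distribution function of the standard normal distribution.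
   Context: $\boldsymbol{\mu}^{(k)}=\mathbb{E}[Z_1^{(k)}]$, $S_0^{(k)}=0$, $S_n^{(k)}=\sum_{i=1}^n Z_i^{(k)}$ for $k=1,2$. $D_n$ is the diameter of the convex hull of $\{S_j^{(k)}:0\le j\le n,\ k=1,2\}$. $\mathbf{e}_\theta=(\cos\theta,\sin\theta)$, and $\theta^{(k)}\in[0,2\pi)$ is given by $\boldsymbol{\mu}^{(k)}=\|\boldsymbol{\mu}^{(k)}\|\,\mathbf{e}_{\theta^{(k)}}$. The constant $\sigma_D^2$ is defined as follows: if the unique maximum is $\|\boldsymbol{\mu}^{(k)}\|$ with $k\in\{1,2\}$, then $\sigma_D^2=\mathbb{E}[((Z_1^{(k)}-\boldsymbol{\mu}^{(k)})\cdot\mathbf{e}_{\theta^{(k)}})^2]$; if the unique maximum is $\|\boldsymbol{\mu}^{(1)}-\boldsymbol{\mu}^{(2)}\|$, then $\sigma_D^2=\mathbb{E}[(((Z_1^{(1)}-\boldsymbol{\mu}^{(1)})-(Z_1^{(2)}-\boldsymbol{\mu}^{(2)}))\cdot\mathbf{e}_{\theta})^2]$, where $\mathbf{e}_\theta$ is the unit vector in the direction of $\boldsymbol{\mu}^{(1)}-\boldsymbol{\mu}^{(2)}$. Here $\cdot$ is the Euclidean scalar product and $\|\cdot\|$ the Euclidean norm. *)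

(* Defs.v *)
From HB Require Import structures.
From mathcomp Require Import all_boot all_order all_algebra.
From mathcomp Require Import all_classical all_reals all_analysis.

Set Implicit Arguments.
Unset Strict Implicit.
Unset Printing Implicit Defensive.

Import Order.TTheory GRing.Theory Num.Theory.
Import numFieldNormedType.Exports.

Local Open Scope classical_set_scope.
Local Open Scope ring_scope.

(* The library norm `|_| on R * R is the sup norm, so the Euclidean structure
   of the plane is set up here.  Plane R carries the product sigma-algebra of
   the Borel sets of R. *)
Notation Plane R := (R * R)%type (only parsing).

Section plane.
Context {R : realType}.
Implicit Types (u v : Plane R) (A : set (Plane R)).

Definition dot2 u v : R := u.1 * v.1 + u.2 * v.2.

Definition norm2 u : R := Num.sqrt (dot2 u u).

Definition dir (t : R) : Plane R := (cos t, sin t).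

(* The t in [0, 2pi[ with u = ||u|| (cos t, sin t), which is unique if u is not
   0; the default value 0 is never used. *)
Definition angle u : R :=
  xget 0 [set t | 0 <= t < 2 * pi /\ u = (norm2 u * (dir t).1, norm2 u * (dir t).2)].

Definition convex_hull A : set (Plane R) :=
  smallest (@convex_set R (R^o * R^o)%type) A.

Definition diameter A : R := sup [set norm2 (p.1 - p.2) | p in A `*` A].

End plane.

Section independence.
Context d (T : measurableType d) (R : realType) (P : probability T R).
Context d' (T' : measurableType d').

Definition mutually_independent (I : eqType) (X : I -> {RV P >-> T'}) :=
  forall (s : seq I) (A : I -> set T'),
    uniq s -> (forall i, measurable (A i)) ->
    (P (\bigcap_(i in [set` s]) (X i @^-1` A i)) =
     \prod_(i <- s) P (X i @^-1` A i))%E.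

(* Only measurable sets are compared: a measure is a function on all sets. *)
Definition identically_distributed (I : Type) (X : I -> {RV P >-> T'}) :=
  forall (i j : I) (A : set T'), measurable A ->
    distribution P (X i) A = distribution P (X j) A.

Definition iid (I : eqType) (X : I -> {RV P >-> T'}) :=
  mutually_independent X /\ identically_distributed X.

Definition sigma_family (I : Type) (X : I -> {RV P >-> T'}) : set (set T) :=
  <<s \bigcup_i preimage_set_system setT (X i) measurable >>.

Definition independent_families (I J : Type)
    (X : I -> {RV P >-> T'}) (Y : J -> {RV P >-> T'}) :=
  forall A B : set T, sigma_family X A -> sigma_family Y B ->
    P (A `&` B) = (P A * P B)%E.

End independence.

Section walks.
Context d (T : measurableType d) (R : realType) (P : probability T R).
Implicit Types (X : T -> Plane R) (Z : nat -> {RV P >-> Plane R}).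

Definition mean2 X : Plane R :=
  (fine 'E_P[fun w => (X w).1], fine 'E_P[fun w => (X w).2]).

(* Sequences are indexed from 0: Z i is the (i+1)-st increment. *)
Definition walk Z (n : nat) (w : T) : Plane R := \sum_(i < n) Z i w.

Definition walk_points Z1 Z2 (n : nat) (w : T) : set (Plane R) :=
  [set walk Z1 j w | j in [set j | (j <= n)%N]] `|`
  [set walk Z2 j w | j in [set j | (j <= n)%N]].

Definition hull_diameter Z1 Z2 (n : nat) (w : T) : R :=
  diameter (convex_hull (walk_points Z1 Z2 n w)).

Definition max_drift Z1 Z2 : R :=
  let mu1 := mean2 (Z1 0%N) in let mu2 := mean2 (Z2 0%N) in
  Num.max (norm2 mu1) (Num.max (norm2 mu2) (norm2 (mu1 - mu2))).

Definition unique_max_drift Z1 Z2 : Prop :=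
  let mu1 := mean2 (Z1 0%N) in let mu2 := mean2 (Z2 0%N) in
  count_mem (max_drift Z1 Z2)
    [:: norm2 mu1; norm2 mu2; norm2 (mu1 - mu2)] = 1%N.

(* Meaningful under unique_max_drift: the three branches are then the three
   exclusive possibilities for the maximum. *)
Definition sigmaD2 Z1 Z2 : R :=
  let mu1 := mean2 (Z1 0%N) in let mu2 := mean2 (Z2 0%N) in
  let m := max_drift Z1 Z2 in
  if norm2 mu1 == m then
    fine 'E_P[fun w => dot2 (Z1 0%N w - mu1) (dir (angle mu1)) ^+ 2]
  else if norm2 mu2 == m then
    fine 'E_P[fun w => dot2 (Z2 0%N w - mu2) (dir (angle mu2)) ^+ 2]
  else
    fine 'E_P[fun w => dot2 ((Z1 0%N w - mu1) - (Z2 0%N w - mu2))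
                            (dir (angle (mu1 - mu2))) ^+ 2].

End walks.

Definition std_normal_cdf {R : realType} (x : R) : \bar R :=
  normal_prob 0 1 `]-oo, x].

(* Main.v *)
(* Let rho be the maximal drift, e its direction, and x n the fluctuation at time
   n of the walk (or of the difference of the two walks) that has this drift.
   The two endpoints give D n >= n rho + x n . e.  Conversely, D n is attained by
   a pair of points of the trajectories.  Since the other two drifts are strictly
   smaller than rho, either the times of the pair are within m steps of those of
   the extremal pair, and then its distance is n rho + x n . e up to oscillations
   over at most m steps, or its mean is shorter by (rho - rho') m, which only
   fluctuations of that order can compensate.  With m a small multiple of n,
   Doob's inequality bounds the oscillations by a small multiple of sqrt n in L^2,
   and (max |x| - A sqrt n)^+ is negligible because the squares (x n)^2 / n are
   uniformly integrable.  So D n - n rho - x n . e is o(sqrt n) in L^2, and the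
   central limit theorem for the scalar walk x n . e carries over to D n, with
   either normalisation.

   The central limit theorem is proved by Lindeberg's replacement: the smoothed
   indicators Phi ((x - y) / sqrt s) of a half-line solve the heat equation, so
   one increment of the walk and a decrement of s compensate each other up to
   third-order terms. *)

Require Import Defs.
From HB Require Import structures.
From mathcomp Require Import all_boot all_order all_algebra.
From mathcomp Require Import all_classical all_reals all_analysis.
From mathcomp Require Import measurable_realfun.
From mathcomp Require Import zify ring lra.
Set Implicit Arguments.
Unset Strict Implicit.
Unset Printing Implicit Defensive.
Import Order.TTheory GRing.Theory Num.Theory.
Import numFieldNormedType.Exports.
Local Open Scope classical_set_scope.
Local Open Scope ring_scope.
(** * Expectations *)

(** Only second moments are available, and this shapes the estimates. Third-order Taylor errors are
    bounded by w^2 min(1, |w|), whose expectation at a vanishing scale tends to 0 by dominated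
    convergence. One and the same one-step expansion serves twice: with the normal distribution
    function it gives the central limit theorem, and with x^2/2 - 1 + cos x it gives the uniform
    integrability of the squared normalised walk. Excesses over A sqrt n appear because the norm of
    n rho e + x exceeds n rho + x . e by about |x|^2 / (2 n rho). This is bounded while |x| is of
    order sqrt n, but without fourth moments it is not controlled in L^2 beyond; there the triangle
    inequality takes over. All scalar walks in play are adapted to one filtration generated by both
    sequences. Conditional expectations are avoided: it suffices that a function of the past times a
    centred independent increment has mean zero. The expectation of D n is never computed: n rho is
    a provisional centre, and the mean is the best centre in L^2. *)

Section real_expectation.
Context d (T : measurableType d) (R : realType) (P : probability T R).
Implicit Types X Y : T -> R.

Local Notation Ex := (Rintegral P setT).
Local Notation L1 X := (P.-integrable setT (EFin \o X)).

Lemma L1_measurable X : L1 X -> measurable_fun setT X.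
Proof. by move=> /measurable_int /measurable_EFinP. Qed.

Lemma L1_le X Y : measurable_fun setT X -> (forall w, `|X w| <= Y w) ->
  L1 Y -> L1 X.
Proof.
move=> mX XY; apply: le_integrable => //; first exact/measurable_EFinP.
by move=> w _ /=; rewrite lee_fin (le_trans (XY w))// ler_norm.
Qed.

Lemma L1_cst (c : R) : L1 (fun=> c).
Proof. exact: finite_measure_integrable_cst. Qed.

Lemma L1_bounded X c : measurable_fun setT X -> (forall w, `|X w| <= c) -> L1 X.
Proof. by move=> mX Xc; exact: L1_le mX Xc (L1_cst c). Qed.

Lemma L1D X Y : L1 X -> L1 Y -> L1 (fun w => X w + Y w).
Proof. by move=> iX iY; apply: eq_integrable (integrableD _ iX iY). Qed.

Lemma L1B X Y : L1 X -> L1 Y -> L1 (fun w => X w - Y w).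
Proof. by move=> iX iY; apply: eq_integrable (integrableB _ iX iY). Qed.

Lemma L1Z c X : L1 X -> L1 (fun w => c * X w).
Proof. by move=> iX; apply: eq_integrable (integrableZl _ c iX). Qed.

Lemma L1_sum n (X : nat -> T -> R) : (forall i, (i < n)%N -> L1 (X i)) ->
  L1 (fun w => \sum_(i < n) X i w).
Proof.
elim: n => [|n IH] iX.
  by under eq_fun do rewrite big_ord0; exact: L1_cst.
under eq_fun do rewrite big_ord_recr/=.
by apply: L1D; [apply: IH => i ni; apply: iX; exact: ltnW|exact: iX].
Qed.

Lemma ExD X Y : L1 X -> L1 Y -> Ex (fun w => X w + Y w) = Ex X + Ex Y.
Proof. exact: RintegralD. Qed.

Lemma ExB X Y : L1 X -> L1 Y -> Ex (fun w => X w - Y w) = Ex X - Ex Y.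
Proof. exact: RintegralB. Qed.

Lemma ExZ c X : L1 X -> Ex (fun w => c * X w) = c * Ex X.
Proof. exact: RintegralZl. Qed.

Lemma Ex_cst c : Ex (fun=> c) = c.
Proof.
rewrite Rintegral_cst// (_ : fine _ = 1) ?mulr1//.
exact: (congr1 fine (probability_setT P)).
Qed.

Lemma Ex_sum n (X : nat -> T -> R) : (forall i, (i < n)%N -> L1 (X i)) ->
  Ex (fun w => \sum_(i < n) X i w) = \sum_(i < n) Ex (X i).
Proof.
elim: n => [|n IH] iX.
  by under eq_fun do rewrite big_ord0; rewrite big_ord0 Ex_cst.
under eq_fun do rewrite big_ord_recr/=.
have iX' i : (i < n)%N -> L1 (X i) by move=> ni; apply: iX; exact: ltnW.
by rewrite big_ord_recr/= ExD ?IH//; [exact: L1_sum|exact: iX].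
Qed.

Lemma Ex_le X Y : L1 X -> L1 Y -> (forall w, X w <= Y w) -> Ex X <= Ex Y.
Proof. by move=> iX iY XY; apply: le_Rintegral => // w _; exact: XY. Qed.

Lemma Ex_ge0 X : (forall w, 0 <= X w) -> 0 <= Ex X.
Proof. by move=> X0; apply: Rintegral_ge0 => w _; exact: X0. Qed.

Lemma normr_Ex X Y : L1 X -> L1 Y -> (forall w, `|X w| <= Y w) ->
  `|Ex X| <= Ex Y.
Proof.
move=> iX iY XY; apply: (le_trans (le_normr_Rintegral _ iX)) => //.
by apply: le_Rintegral => //; exact: integrable_norm.
Qed.

Definition sq_integrable X :=
  measurable_fun setT X /\ L1 (fun w => X w ^+ 2).
Local Notation L2 := sq_integrable.

Lemma L2_le X Y : measurable_fun setT X -> (forall w, `|X w| <= `|Y w|) ->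
  L2 Y -> L2 X.
Proof.
move=> mX XY [mY iY]; split=> //; apply: L1_le iY; first exact: measurable_funX.
by move=> w; rewrite normrX -(real_normK (num_real (Y w))) lerXn2r ?nnegrE.
Qed.

Lemma L2_cst (c : R) : L2 (fun=> c).
Proof. by split; [exact: measurable_cst|exact: L1_cst]. Qed.

Lemma L2_bounded X c : measurable_fun setT X -> (forall w, `|X w| <= c) -> L2 X.
Proof.
move=> mX Xc; apply: (L2_le mX _ (L2_cst c)) => w.
by rewrite (le_trans (Xc w))// ler_norm.
Qed.

Lemma L2M X Y : L2 X -> L2 Y -> L1 (fun w => X w * Y w).
Proof.
move=> [mX iX] [mY iY]; apply: L1_le (L1D iX iY); first exact: measurable_funM.
by move=> w; rewrite ler_norml; apply/andP; split; nra.
Qed.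

Lemma L2_L1 X : L2 X -> L1 X.
Proof.
move=> iX; have := L2M iX (L2_cst 1).
by under eq_fun do rewrite mulr1.
Qed.

Lemma L2D X Y : L2 X -> L2 Y -> L2 (fun w => X w + Y w).
Proof.
move=> iX iY; have [[mX X2] [mY Y2]] := (iX, iY); split.
  exact: measurable_funD.
under eq_fun do rewrite sqrrD.
apply: L1D => //; apply: L1D => //.
under eq_fun do rewrite -mulr_natl; apply: L1Z; exact: L2M.
Qed.

Lemma L2Z c X : L2 X -> L2 (fun w => c * X w).
Proof.
move=> [mX X2]; split; first exact: measurable_funM.
by under eq_fun do rewrite exprMn; exact: L1Z.
Qed.

Lemma L2B X Y : L2 X -> L2 Y -> L2 (fun w => X w - Y w).
Proof.
move=> iX iY; under eq_fun do rewrite -(mulN1r (Y _)).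
by apply: L2D => //; exact: L2Z.
Qed.

Lemma L2_norm X : L2 X -> L2 (fun w => `|X w|).
Proof.
move=> iX; apply: (L2_le _ _ iX); last by move=> w; rewrite normr_id.
by apply: measurableT_comp => //; case: iX.
Qed.

Lemma L2_sum n (X : nat -> T -> R) : (forall i, (i < n)%N -> L2 (X i)) ->
  L2 (fun w => \sum_(i < n) X i w).
Proof.
elim: n => [|n IH] iX.
  by under eq_fun do rewrite big_ord0; exact: L2_cst.
under eq_fun do rewrite big_ord_recr/=.
by apply: L2D; [apply: IH => i ni; apply: iX; exact: ltnW|exact: iX].
Qed.

Lemma L2_max X Y : L2 X -> L2 Y -> L2 (fun w => Num.max (X w) (Y w)).
Proof.
move=> iX iY; apply: (L2_le _ _ (L2D (L2_norm iX) (L2_norm iY))).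
  by apply: measurable_maxr; [case: iX|case: iY].
move=> w; rewrite [leRHS]ger0_norm ?addr_ge0//.
have := normr_ge0 (X w); have := normr_ge0 (Y w).
by rewrite /Num.max; case: ifP => _ ? ?; lra.
Qed.

(** Expand the expectation of [(X w - Ex X) ^+ 2], which is nonnegative. *)
Lemma Ex_sqr X : L2 X -> Ex X ^+ 2 <= Ex (fun w => X w ^+ 2).
Proof.
move=> iX; have [mX X2] := iX; have X1 := L2_L1 iX.
have : 0 <= Ex (fun w => (X w ^+ 2 + Ex X ^+ 2) - (2 * Ex X) * X w).
  apply: Ex_ge0 => w; rewrite (_ : _ - _ = (X w - Ex X) ^+ 2) ?sqr_ge0//.
  by ring.
have iE : L1 (fun=> Ex X ^+ 2) by exact: L1_cst.
by rewrite (ExB (L1D X2 iE) (L1Z _ X1)) (ExD X2 iE) ExZ// Ex_cst; nra.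
Qed.

End real_expectation.

(** * Independence, filtrations and centred increments *)

Section independence_expectation.
Context d (T : measurableType d) (R : realType) (P : probability T R).
Implicit Types X Y : T -> R.

Local Notation Ex := (Rintegral P setT).
Local Notation L1 X := (P.-integrable setT (EFin \o X)).

(** The joint law of [(X, Y)] and the product of the two laws agree on rectangles, hence everywhere,
    and Fubini splits the integral. The integrability of the product is carried over to the product
    measure for this purpose. *)
Lemma Ex_indep X Y :
  (forall A B, measurable A -> measurable B ->
     P (X @^-1` A `&` Y @^-1` B) = P (X @^-1` A) * P (Y @^-1` B))%E ->
  L1 X -> L1 Y -> L1 (fun w => X w * Y w) ->
  Ex (fun w => X w * Y w) = Ex X * Ex Y.
Proof.
move=> XY iX iY iXY.
have mX := L1_measurable iX; have mY := L1_measurable iY.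
have mfX : X \in mfun by rewrite inE.
have mfY : Y \in mfun by rewrite inE.
pose V w := (X w, Y w).
have mV : measurable_fun setT V by exact: measurable_fun_pair.
have mfV : V \in mfun by rewrite inE.
pose m1 := distribution P (mfun_Sub mfX).
pose m2 := distribution P (mfun_Sub mfY).
pose m := distribution P (mfun_Sub mfV).
have mE A : measurable A -> (m1 \x m2)%E A = m A.
  by move=> mA; apply: product_measure_unique => // B C mB mC; exact: XY.
pose f (z : R * R) : \bar R := (z.1 * z.2)%:E.
have mf : measurable_fun setT f.
  by apply/measurable_EFinP; apply: measurable_funM.
have if' : (m1 \x m2)%E.-integrable setT f.
  have /integrableP[_ fy] : m.-integrable setT f.
    exact: (integrable_pushforward mV mf).
  apply/integrableP; split => //.
  rewrite (eq_measure_integral m)// => A mA _; exact: mE.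
have -> : Ex (fun w => X w * Y w) = fine (\int[m1 \x m2]_z f z).
  rewrite (eq_measure_integral m)//; last by move=> A mA _; exact: mE.
  by rewrite (@integral_distribution _ _ _ _ _ P (mfun_Sub mfV)).
rewrite -integral12_prod_meas1//.
have iY' : m2.-integrable setT (fun y : R => y%:E).
  by apply: (integrable_pushforward mY) => //; exact: EFin_measurable.
have iX' : m1.-integrable setT (fun y : R => y%:E).
  by apply: (integrable_pushforward mX) => //; exact: EFin_measurable.
have EY : fine (\int[m2]_y y%:E) = Ex Y.
  by rewrite (@integral_distribution _ _ _ _ _ P (mfun_Sub mfY)).
have EX : fine (\int[m1]_y y%:E) = Ex X.
  by rewrite (@integral_distribution _ _ _ _ _ P (mfun_Sub mfX)).
rewrite /fubini_F -EX -EY -[fine (\int[m1]_y y%:E) * _]RintegralZr//.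
congr fine; apply: eq_integral => x _.
rewrite /f/=; under eq_integral do rewrite EFinM.
by rewrite integralZl// EFinM fineK// integrable_fin_num.
Qed.

End independence_expectation.

(** Taking the generated sigma-algebra as a measurable type makes the closure properties of
    [measurable_fun] available for functions of the past. *)
Definition past_measurable (T : pointedType) d' (T' : measurableType d')
    (G : set (set T)) (X : T -> T') :=
  measurable_fun (setT : set (g_sigma_algebraType G)) X.

Section past.
Context d (T : measurableType d) (R : realType).
Implicit Types (G H : set (set T)) (X Y : T -> R).

Lemma past_measurable_sub d' (T' : measurableType d') G H (X : T -> T') :
  G `<=` <<s H >> -> past_measurable G X -> past_measurable H X.
Proof.
move=> GH mX _ B mB; have := mX measurableT B mB.
by apply: smallest_sub => //; exact: smallest_sigma_algebra.
Qed.

Lemma past_measurableW d' (T' : measurableType d') G (X : T -> T') :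
  G `<=` measurable -> past_measurable G X -> measurable_fun setT X.
Proof.
move=> Gm mX _ B mB; have := mX measurableT B mB.
by apply: smallest_sub => //; exact: sigma_algebra_measurable.
Qed.

End past.

(* G i is a generating family of the sigma-algebra of the first i steps. *)
Record innovations d (T : measurableType d) (R : realType)
    (P : probability T R) (G : nat -> set (set T)) (W : nat -> T -> R) : Prop :=
  Innovations {
    inn_event : forall i, G i `<=` measurable;
    inn_mono : forall i, G i `<=` G i.+1;
    inn_adapted : forall i, past_measurable (G i.+1) (W i);
    inn_indep : forall i A B, <<s G i >> A -> measurable B ->
      (P (A `&` W i @^-1` B) = P A * P (W i @^-1` B))%E;
    inn_ident : forall i B, measurable B ->
      P (W i @^-1` B) = P (W 0%N @^-1` B);
    inn_sq : P.-integrable setT (EFin \o (fun w => W 0%N w ^+ 2));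
    inn_mean : Rintegral P setT (W 0%N) = 0 }.

Arguments inn_event {d T R P G W} _ _.
Arguments inn_mono {d T R P G W} _ _.
Arguments inn_adapted {d T R P G W} _ _.

Section innovations.
Context d (T : measurableType d) (R : realType) (P : probability T R).
Variables (G : nat -> set (set T)) (W : nat -> T -> R).
Hypothesis GW : innovations P G W.
Implicit Types X Y : T -> R.

Local Notation Ex := (Rintegral P setT).
Local Notation L1 X := (P.-integrable setT (EFin \o X)).
Local Notation L2 := (sq_integrable P).

Lemma inn_measurable i : measurable_fun setT (W i).
Proof. exact: past_measurableW (inn_event GW _) (inn_adapted GW i). Qed.
Local Hint Resolve inn_measurable : core.

Lemma inn_past_sub i j X : (i <= j)%N ->
  past_measurable (G i) X -> past_measurable (G j) X.
Proof.
move=> ij mX; rewrite -(subnK ij) addnC.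
elim: (j - i)%N => [|k IH]; first by rewrite addn0.
rewrite addnS; apply: past_measurable_sub IH => A GA.
by apply: sub_sigma_algebra; exact: (inn_mono GW).
Qed.

Lemma inn_adapted_le i j : (i < j)%N -> past_measurable (G j) (W i).
Proof. by move=> ij; exact: inn_past_sub ij (inn_adapted GW i). Qed.

Lemma inn_L1 (f : R -> R) i : measurable_fun setT f ->
  L1 (f \o W 0%N) -> L1 (f \o W i) /\ Ex (f \o W i) = Ex (f \o W 0%N).
Proof.
move=> mf if0.
have mfW j : W j \in mfun by rewrite inE; exact: inn_measurable.
pose m j := distribution P (mfun_Sub (mfW j)).
have mE (B : set R) : measurable B -> m i B = m 0%N B.
  by move=> mB; exact: (inn_ident GW).
have mf' : measurable_fun setT (EFin \o f) by exact/measurable_EFinP.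
have ifi : L1 (f \o W i).
  apply/integrableP; split.
    by apply/measurable_EFinP; exact: measurableT_comp.
  have mnf : measurable_fun setT (fun x : R => `|(f x)%:E|%E).
    exact: measurableT_comp.
  rewrite -(@ge0_integral_distribution _ _ _ _ _ P (mfun_Sub (mfW i))
    (fun x => `|(f x)%:E|%E))//.
  rewrite (eq_measure_integral (m 0%N)); last by move=> B mB _; exact: mE.
  rewrite (@ge0_integral_distribution _ _ _ _ _ P (mfun_Sub (mfW 0%N))
    (fun x => `|(f x)%:E|%E))//.
  by case/integrableP : if0.
split => //; congr fine.
rewrite -(@integral_distribution _ _ _ _ _ P (mfun_Sub (mfW i)) (EFin \o f))//.
rewrite (eq_measure_integral (m 0%N)); last by move=> B mB _; exact: mE.
by rewrite (@integral_distribution _ _ _ _ _ P (mfun_Sub (mfW 0%N)) (EFin \o f)).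
Qed.

Lemma inn_L2 i : L2 (W i).
Proof.
split => //.
by have [] := @inn_L1 (fun x => x ^+ 2) i (@exprn_measurable R setT 2) (inn_sq GW).
Qed.

Lemma inn_Ex_sq i : Ex (fun w => W i w ^+ 2) = Ex (fun w => W 0%N w ^+ 2).
Proof.
by have [] := @inn_L1 (fun x => x ^+ 2) i (@exprn_measurable R setT 2) (inn_sq GW).
Qed.

Lemma inn_Ex i : Ex (W i) = 0.
Proof.
rewrite -(inn_mean GW).
by have [] := @inn_L1 id i (@measurable_id _ _ setT) (L2_L1 (inn_L2 0%N)).
Qed.

Lemma inn_ExM (f : R -> R) i X : past_measurable (G i) X ->
  measurable_fun setT f -> L1 X -> L1 (f \o W 0%N) ->
  L1 (fun w => X w * f (W i w)) ->
  Ex (fun w => X w * f (W i w)) = Ex X * Ex (f \o W 0%N).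
Proof.
move=> mX mf iX if0 iXf; have [ifi <-] := inn_L1 i mf if0.
rewrite (Ex_indep _ iX ifi iXf) // => A B mA mB.
rewrite comp_preimage; apply: (inn_indep GW).
  by rewrite -[X in <<s _ >> X]setTI; exact: mX.
by rewrite -[X in measurable X]setTI; exact: mf.
Qed.

(** The martingale property in integrated form, which takes the place of conditional expectations: a
    weight known from the past is orthogonal to the next increment. *)
Lemma inn_ExM0 i X : past_measurable (G i) X -> L2 X ->
  Ex (fun w => X w * W i w) = 0.
Proof.
move=> mX iX; rewrite (@inn_ExM id)//.
- by rewrite (inn_mean GW) mulr0.
- exact: L2_L1.
- exact: L2_L1 (inn_L2 _).
- exact: L2M (inn_L2 _).
Qed.

Definition psum n w := \sum_(i < n) W i w.

Lemma psumS n w : psum n.+1 w = psum n w + W n w.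
Proof. by rewrite /psum big_ord_recr. Qed.

Lemma past_psum n : past_measurable (G n) (psum n).
Proof.
rewrite /psum /past_measurable; apply: measurable_sum => i.
exact: inn_adapted_le.
Qed.

Lemma psum_L2 n : L2 (psum n).
Proof. by apply: L2_sum => i _; exact: inn_L2. Qed.

Lemma psum_past_diff m n k : (m <= k)%N -> (n <= k)%N ->
  past_measurable (G k) (fun w => psum n w - psum m w).
Proof.
move=> mk nk; apply: measurable_funB.
  exact: inn_past_sub nk (@past_psum n).
exact: inn_past_sub mk (@past_psum m).
Qed.

(** Orthogonality of the increments: the cross term of each new step vanishes by [inn_ExM0]. *)
Lemma Ex_psum_sq_diff m n :
  Ex (fun w => (psum (m + n) w - psum m w) ^+ 2)
  = n%:R * Ex (fun w => W 0%N w ^+ 2).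
Proof.
elim: n => [|n IH].
  rewrite addn0 mul0r -[RHS](Ex_cst P); congr (Ex _); apply/funext => w.
  by rewrite subrr expr0n.
have iD : L2 (fun w => psum (m + n) w - psum m w) by exact: L2B (psum_L2 _) (psum_L2 _).
rewrite addnS.
under eq_fun do rewrite psumS addrAC sqrrD -mulr_natl.
have [[_ ?] [_ ?]] := (iD, inn_L2 (m + n)).
have iM := L2M iD (inn_L2 (m + n)).
rewrite (ExD (L1D _ (L1Z _ iM)))// (ExD _ (L1Z _ iM))// ExZ// IH inn_Ex_sq.
rewrite inn_ExM0//; first by rewrite mulr0 addr0 -natr1 mulrDl mul1r.
by apply: psum_past_diff => //; exact: leq_addr.
Qed.

Lemma Ex_psum_sq n : Ex (fun w => psum n w ^+ 2)
  = n%:R * Ex (fun w => W 0%N w ^+ 2).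
Proof.
rewrite -(Ex_psum_sq_diff 0 n); congr (Ex _); apply/funext => w.
by rewrite add0n {3}/psum big_ord0 subr0.
Qed.

End innovations.

(** * Taylor estimates and the Lindeberg condition *)

Section taylor.
Context (R : realType).
Implicit Types (f df : R -> R) (x w c : R).

(** Locating [c] by its distance to [x] treats both signs of [w] at once. *)
Lemma MVT_increment f df x w : (forall y : R, is_derive y 1 f (df y)) ->
  exists2 c, `|c - x| <= `|w| & f (x + w) - f x = df c * w.
Proof.
move=> fdf.
have cf y : {for y, continuous f}.
  by apply/differentiable_continuous/derivable1_diffP; have [] := fdf y.
have [w0|w0] := leP 0 w.
  have [||c] := @MVT_segment R f df x (x + w) _ (fun y _ => fdf y).
  - by rewrite lerDl.
  - by apply: continuous_subspaceT.
  rewrite in_itv/= => /andP[xc cw] ->; exists c; last by congr (_ * _); ring.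
  by rewrite !ger0_norm ?subr_ge0// lerBlDl.
have [||c] := @MVT_segment R f df (x + w) x _ (fun y _ => fdf y).
- by rewrite gerDl ltW.
- by apply: continuous_subspaceT.
rewrite in_itv/= => /andP[xc cw] h; exists c.
  by rewrite ler0_norm ?subr_le0// ltr0_norm// lerN2 lerBrDl.
by rewrite -opprB h; ring.
Qed.

(** Two applications of the mean value theorem write the remainder as [(f2 c' - f2 x) * c * w] with
    [c] no larger than [w]. The first factor is at most [2 * C] by boundedness and at most [C * |w|]
    by the Lipschitz condition; keeping the smaller of the two is what lets second moments
    suffice. *)
Lemma second_order_taylor f f1 f2 (C : R) x w :
  (forall y : R, is_derive y 1 f (f1 y)) -> (forall y : R, is_derive y 1 f1 (f2 y)) ->
  (forall y, `|f2 y| <= C) -> (forall y z, `|f2 y - f2 z| <= C * `|y - z|) ->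
  `|f (x + w) - f x - f1 x * w - f2 x * w ^+ 2 / 2|
    <= 2 * C * (w ^+ 2 * Num.min 1 `|w|).
Proof.
move=> df df1 f2C f2L.
pose g t := f (x + t) - f1 x * t - f2 x * t ^+ 2 / 2.
have dg (t : R) : is_derive t 1 g (f1 (x + t) - f1 x - f2 x * t).
  have dfx : is_derive t 1 (f \o (fun t => x + t)) (f1 (x + t) * 1).
    apply: is_derive1_comp.
    by apply: (is_derive_eq (is_deriveD (is_derive_cst x t 1) (is_derive_id t 1)));
       rewrite add0r.
  have dl : is_derive t 1 (fun t => f1 x * t) (f1 x).
    apply: (is_derive_eq (is_deriveZ (f1 x) (is_derive_id t 1))).
    by rewrite /GRing.scale/= mulr1.
  have dq : is_derive t 1 (fun t => f2 x * t ^+ 2 / 2) (f2 x * t).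
    rewrite (_ : (fun t => _) = (fun t => (f2 x / 2) *: (t * t))); last first.
      by apply/funext => r; rewrite /GRing.scale/=; ring.
    apply: (is_derive_eq (is_deriveZ (f2 x / 2) (is_deriveM (is_derive_id t 1) (is_derive_id t 1)))).
    by rewrite /GRing.scale/=; field.
  by apply: (is_derive_eq (is_deriveB (is_deriveB dfx dl) dq)); rewrite mulr1.
have [c] := @MVT_increment g _ 0 w dg.
rewrite subr0 add0r => cw.
have [c' c'x ->] := @MVT_increment f1 f2 x c df1.
rewrite {1}/g {1}/g addr0 mulr0 expr0n mulr0 mul0r !subr0 => gE.
have -> : f (x + w) - f x - f1 x * w - f2 x * w ^+ 2 / 2 = (f2 c' - f2 x) * c * w.
  by rewrite mulrBl -gE; ring.
rewrite !normrM; have C0 : 0 <= C by apply: le_trans (f2C 0).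
have h1 : `|f2 c' - f2 x| <= C * `|w|.
  by apply: (le_trans (f2L _ _)); apply: ler_wpM2l => //; apply: le_trans cw.
have h2 : `|f2 c' - f2 x| <= 2 * C.
  by apply: (le_trans (ler_normB _ _)); rewrite mulr_natl mulr2n lerD.
have h3 : `|c| * `|w| <= w ^+ 2.
  by rewrite -(real_normK (num_real w)) expr2 ler_wpM2r.
rewrite -mulrA; apply: (le_trans (ler_wpM2l _ h3)) => //.
rewrite mulrC mulrCA; apply: ler_wpM2l; first exact: sqr_ge0.
have := normr_ge0 w; rewrite /Num.min; case: ifP => _ ?; nra.
Qed.

Lemma cosB_le x w : `|cos (x + w) - cos x| <= `|w|.
Proof.
have [c _ ->] := @MVT_increment cos (fun x => - sin x) x w _.
by rewrite normrM ler_piMl// normrN ler_norml sin_geN1 sin_le1.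
Qed.

Lemma sin_norm_le x : `|sin x| <= `|x|.
Proof.
have [c _] := @MVT_increment sin cos 0 x _.
rewrite add0r sin0 subr0 => ->.
by rewrite normrM ler_piMl// ler_norml cos_geN1 cos_le1.
Qed.

(** From cos x = 1 - 2 sin^2 (x / 2) and |sin t| <= |t|. *)
Lemma cos_ge x : 1 - x ^+ 2 / 2 <= cos x.
Proof.
have -> : cos x = cos (x / 2 *+ 2) by rewrite -mulr_natr divfK.
rewrite cos_mulr2n cos2sin2 -(real_normK (num_real (sin _))).
have h := sin_norm_le (x / 2).
have : `|sin (x / 2)| ^+ 2 <= (x / 2) ^+ 2.
  by rewrite -[leRHS]real_normK ?num_real// lerXn2r ?nnegrE.
by rewrite -mulr_natr; nra.
Qed.

End taylor.

Section one_step.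
Context d (T : measurableType d) (R : realType) (P : probability T R).
Variables (G : nat -> set (set T)) (W : nat -> T -> R).
Hypothesis GW : innovations P G W.
Implicit Types X Y : T -> R.

Local Notation Ex := (Rintegral P setT).
Local Notation L1 X := (P.-integrable setT (EFin \o X)).
Local Notation L2 := (sq_integrable P).

Let var := Ex (fun w => W 0%N w ^+ 2).

(** Up to the factor [u ^+ 2], the expected Taylor error of one step scaled by [u]. It plays the
    role of Lindeberg's truncated second moment, with a continuous cutoff at size 1 / u. *)
Definition lindeberg (u : R) :=
  Ex (fun w => W 0%N w ^+ 2 * Num.min 1 `|u * W 0%N w|).

Let trunc (u x : R) := x ^+ 2 * Num.min 1 `|u * x|.

Let measurable_trunc u : measurable_fun setT (trunc u).
Proof.
apply: measurable_funM; first exact: measurable_funX.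
by apply: measurable_minr => //; apply: measurableT_comp => //.
Qed.

Let trunc_le u x : `|trunc u x| <= x ^+ 2.
Proof.
have m0 : 0 <= Num.min 1 `|u * x| by rewrite le_min ler01 normr_ge0.
rewrite /trunc ger0_norm; last by rewrite mulr_ge0 ?sqr_ge0.
by rewrite ler_piMr ?sqr_ge0// ge_min lexx.
Qed.

Let trunc_L1 u : L1 (trunc u \o W 0%N).
Proof.
apply: L1_le (inn_sq GW); last by move=> w; exact: trunc_le.
by apply: measurableT_comp => //; exact: (inn_measurable GW).
Qed.

Lemma lindeberg_cvg0 (u : nat -> R) :
  u n @[n --> \oo] --> (0 : R) -> lindeberg (u n) @[n --> \oo] --> (0 : R).
Proof.
move=> u0.
have W0 := inn_measurable GW 0.
have mt n : measurable_fun setT (EFin \o (trunc (u n) \o W 0%N)).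
  by apply/measurable_EFinP; exact: measurableT_comp (measurable_trunc _) W0.
have t0 w : trunc (u n) (W 0%N w) @[n --> \oo] --> (0 : R).
  apply: (@squeeze_cvgr _ _ _ _ (fun=> 0) (fun n => W 0%N w ^+ 2 * `|u n * W 0%N w|)).
  - apply: nearW => n; rewrite mulr_ge0 ?sqr_ge0 ?le_min ?ler01 ?normr_ge0//=.
    by rewrite ler_wpM2l ?sqr_ge0// ge_min lexx orbT.
  - exact: cvg_cst.
  - rewrite [X in _ --> X](_ : 0 = W 0%N w ^+ 2 * `|0 * W 0%N w|); last first.
      by rewrite mul0r normr0 mulr0.
    apply: cvgM; first exact: cvg_cst.
    by apply: cvg_norm; apply: cvgM => //; exact: cvg_cst.
have [] := @dominated_convergence _ _ _ P setT measurableT _ (cst 0%E)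
  (fun w => (W 0%N w ^+ 2)%:E) mt (measurable_cst _).
- by apply: aeW => w _; apply/cvg_EFin; [exact: nearW|exact: t0].
- exact: (inn_sq GW).
- by apply: aeW => w n _; rewrite lee_fin trunc_le.
move=> _ _; rewrite integral0 => h.
exact: (fine_cvg h).
Qed.

(** In the Taylor expansion at [X], the first-order term vanishes because [W i] is centred and
    independent of the past, and the second-order term factorises for the same reason. The
    conclusion also returns integrability, so that the lemma can be iterated for an unbounded
    [f]. *)
Lemma one_step i (f f1 f2 : R -> R) (C K u : R) X :
  measurable_fun setT f -> measurable_fun setT f1 -> measurable_fun setT f2 ->
  (forall x, `|f2 x| <= C) ->
  (forall x w, `|f (x + w) - f x - f1 x * w - f2 x * w ^+ 2 / 2|
    <= K * (w ^+ 2 * Num.min 1 `|w|)) ->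
  past_measurable (G i) X -> L1 (f \o X) -> L2 (f1 \o X) ->
  L1 (fun w => f (X w + u * W i w)) /\
  `|Ex (fun w => f (X w + u * W i w)) - Ex (f \o X)
    - u ^+ 2 * var / 2 * Ex (f2 \o X)| <= K * u ^+ 2 * lindeberg u.
Proof.
move=> mf mf1 mf2 f2C tay mX iX iX1.
have mX' : measurable_fun setT X := past_measurableW (inn_event GW _) mX.
have mW := inn_measurable GW i.
have [mW2 iW2] := inn_L2 GW i.
pose err w := f (X w + u * W i w) - f (X w) - u * (f1 (X w) * W i w)
  - u ^+ 2 / 2 * (f2 (X w) * W i w ^+ 2).
have mfXW : measurable_fun setT (fun w => f (X w + u * W i w)).
  by apply: measurableT_comp => //; apply: measurable_funD => //;
     apply: measurable_funM.
have i2 : L1 (fun w => f2 (X w) * W i w ^+ 2).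
  apply: L1_le (L1Z C iW2).
    apply: measurable_funM; last exact: measurable_funX.
    exact: measurableT_comp.
  by move=> w; rewrite normrM [`|_ ^+ 2|]ger0_norm ?ler_wpM2r ?sqr_ge0.
have i1 : L1 (fun w => f1 (X w) * W i w) := L2M iX1 (inn_L2 GW i).
have merr : measurable_fun setT err.
  apply: measurable_funB; [apply: measurable_funB;[apply: measurable_funB|]|] => //.
  - exact: L1_measurable iX.
  - exact: L1_measurable (L1Z u i1).
  - exact: L1_measurable (L1Z (u ^+ 2 / 2) i2).
have [it Et] := inn_L1 GW i (measurable_trunc u) (trunc_L1 u).
have err_le w : `|err w| <= K * u ^+ 2 * trunc u (W i w).
  have := tay (X w) (u * W i w).
  rewrite (_ : f1 (X w) * (u * W i w) = u * (f1 (X w) * W i w)); last by ring.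
  rewrite (_ : f2 (X w) * (u * W i w) ^+ 2 / 2
    = u ^+ 2 / 2 * (f2 (X w) * W i w ^+ 2)); last by ring.
  by rewrite exprMn /err /trunc -!mulrA.
have ie : L1 err := L1_le merr err_le (L1Z _ it).
have E1 : Ex (fun w => f1 (X w) * W i w) = 0.
  have mf1X : past_measurable (G i) (f1 \o X) by exact: measurableT_comp mX.
  exact: (inn_ExM0 GW mf1X).
have E2 : Ex (fun w => f2 (X w) * W i w ^+ 2) = Ex (f2 \o X) * var.
  have mf2X : past_measurable (G i) (f2 \o X) by exact: measurableT_comp mX.
  apply: (inn_ExM (f := fun x => x ^+ 2) GW mf2X _ _ (inn_sq GW) i2).
    exact: (@exprn_measurable R setT 2).
  have mf2X' : measurable_fun setT (f2 \o X) := measurableT_comp mf2 mX'.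
  exact: (L1_bounded _ mf2X' (fun w => f2C (X w))).
have fE w : f (X w + u * W i w) = err w + f (X w) + u * (f1 (X w) * W i w)
  + u ^+ 2 / 2 * (f2 (X w) * W i w ^+ 2) by rewrite /err; ring.
have iZ1 := L1Z u i1; have iZ2 := L1Z (u ^+ 2 / 2) i2.
under eq_fun do rewrite fE.
split; first exact: L1D (L1D (L1D ie iX) iZ1) iZ2.
rewrite (ExD (L1D (L1D ie iX) iZ1) iZ2) (ExD (L1D ie iX) iZ1) (ExD ie iX).
rewrite !ExZ// E1 E2 (_ : _ - _ = Ex err); last by ring.
rewrite (le_trans (normr_Ex ie (L1Z _ it) err_le))//.
by rewrite ExZ// Et.
Qed.

End one_step.

(** * Doob's maximal inequality *)

Section running_maximum.
Context (R : realDomainType).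
Implicit Types (s : nat -> R) (a y z : R).

Fixpoint runmax s n := if n is n'.+1 then Num.max (runmax s n') (s n) else s 0%N.

Lemma runmax_ge s i n : (i <= n)%N -> s i <= runmax s n.
Proof.
elim: n => [|n IH]; first by rewrite leqn0 => /eqP ->.
rewrite leq_eqVlt => /predU1P[->|]; first by rewrite /= le_max lexx orbT.
by rewrite ltnS => /IH h; rewrite /= le_max h.
Qed.

Lemma runmax_ge0 s n : (forall i, 0 <= s i) -> 0 <= runmax s n.
Proof. by move=> s0; rewrite (le_trans (s0 0%N))// runmax_ge. Qed.

End running_maximum.

Section doob.
Context (R : realFieldType).
Implicit Types (s : nat -> R) (a y z : R).

(* Summation by parts: the maximum only changes when it equals the current
   value of s. *)
Lemma doob_pathwise s n :
  runmax s n ^+ 2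
    <= 4 * s n ^+ 2 - 4 * \sum_(i < n) runmax s i * (s i.+1 - s i).
Proof.
suff : \sum_(i < n) runmax s i * (s i.+1 - s i)
    <= runmax s n * s n - runmax s n ^+ 2 / 2.
  have := sqr_ge0 (runmax s n - 2 * s n).
  by set m := runmax s n; set S := \sum_(i < n) _; nra.
elim: n => [|n IH]; first by rewrite big_ord0 /=; nra.
rewrite big_ord_recr/=; set S := \sum_(i < n) _ in IH *.
set m := runmax s n in IH *.
by have [sm|ms] := leP (s n.+1) m; nra.
Qed.

(** Convex in [y], so that it turns a martingale into a submartingale to which Doob's inequality
    applies; the level 0 gives the absolute value. *)
Definition excess a y := Num.max 0 (`|y| - a).

(* A subgradient of excess a. *)
Definition excess_sign a y : R := (a < y)%R%:R - (y < - a)%R%:R.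

Lemma excess_ge0 a y : 0 <= excess a y.
Proof. by rewrite le_max lexx. Qed.

Lemma excess_norm y : excess 0 y = `|y|.
Proof. by rewrite /excess subr0; apply/max_idPr. Qed.

Lemma excess_sign_le1 a y : 0 <= a -> `|excess_sign a y| <= 1.
Proof.
move=> a0; rewrite /excess_sign; case: ltP => h1; case: ltP => h2 /=.
- lra.
- by rewrite subr0 normr1.
- by rewrite sub0r normrN normr1.
- by rewrite subr0 normr0.
Qed.

Lemma excess_sub a y z : 0 <= a ->
  excess_sign a y * (z - y) <= excess a z - excess a y.
Proof.
move=> a0; have := ler_norm z; have := ler_norm (- z); rewrite normrN.
rewrite /excess_sign /excess; case: ltP => h1; case: ltP => h2 /=.
- lra.
- rewrite (ger0_norm (_ : 0 <= y)); last by lra.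
  by rewrite /Num.max; do 2 case: ifP => ?; lra.
- rewrite (ler0_norm (_ : y <= 0)); last by lra.
  by rewrite /Num.max; do 2 case: ifP => ?; lra.
- have : `|y| <= a by rewrite ler_norml h1 h2.
  by rewrite /Num.max; do 2 case: ifP => ?; lra.
Qed.

End doob.

Section maximal_inequality.
Context d (T : measurableType d) (R : realType) (P : probability T R).
Variables (G : nat -> set (set T)) (W : nat -> T -> R).
Hypothesis GW : innovations P G W.

Local Notation Ex := (Rintegral P setT).
Local Notation L1 X := (P.-integrable setT (EFin \o X)).
Local Notation L2 := (sq_integrable P).

Lemma measurable_runmax d' (T' : measurableType d') (X : nat -> T' -> R) n :
  (forall i, (i <= n)%N -> measurable_fun setT (X i)) ->
  measurable_fun setT (fun w => runmax (X ^~ w) n).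
Proof.
elim: n => [|n IH] mX /=; first exact: mX.
by apply: measurable_maxr; [apply: IH => i ni; apply: mX; exact: leqW|exact: mX].
Qed.

Lemma runmax_L2 (X : nat -> T -> R) n :
  (forall i, (i <= n)%N -> L2 (X i)) -> L2 (fun w => runmax (X ^~ w) n).
Proof.
elim: n => [|n IH] mX /=; first exact: mX.
by apply: L2_max; [apply: IH => i ni; apply: mX; exact: leqW|exact: mX].
Qed.

Lemma measurable_excess (a : R) : measurable_fun setT (excess a).
Proof. by apply: measurable_maxr => //; apply: measurable_funB. Qed.

Lemma measurable_excess_sign (a : R) : measurable_fun setT (excess_sign a).
Proof.
rewrite (_ : excess_sign a = \1_`]a, +oo[ \- \1_`]-oo, (- a)[).
  by apply: measurable_funB; exact: measurable_indic.
apply/funext => y; rewrite /excess_sign/= !indicE.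
by rewrite !mem_setE !in_itv/= andbT.
Qed.

Lemma excess_L2 (a : R) X : 0 <= a -> L2 X -> L2 (excess a \o X).
Proof.
move=> a0 iX; apply: (L2_le _ _ iX).
  by apply: measurableT_comp; [exact: measurable_excess|case: iX].
move=> w /=; rewrite ger0_norm ?excess_ge0// ge_max normr_ge0/=.
by rewrite lerBlDr lerDl.
Qed.

(** Integrate [doob_pathwise]. The running maximum is nonnegative, so by the subgradient inequality
    each increment of the excess may be replaced by [excess_sign] times the increment of the walk;
    the resulting sum is a martingale transform with mean zero. *)
Lemma doob_excess (a : R) m n : 0 <= a ->
  Ex (fun w => runmax (fun j => excess a (psum W (m + j) w - psum W m w)) n ^+ 2)
    <= 4 * Ex (fun w => excess a (psum W (m + n) w - psum W m w) ^+ 2).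
Proof.
move=> a0.
pose D j w := psum W (m + j) w - psum W m w.
pose M j w := runmax (fun j => excess a (D j w)) j.
have iD j : L2 (D j) by apply: L2B; exact: psum_L2 GW _.
have iE j : L2 (excess a \o D j) by exact: excess_L2.
have iM j : L2 (M j) by apply: runmax_L2 => i _; exact: iE.
pose H j w := M j w * excess_sign a (D j w).
have mD i j : (i <= j)%N -> past_measurable (G (m + j)) (D i).
  by move=> ij; apply: (psum_past_diff GW); rewrite ?leq_addr// leq_add2l.
have mH j : past_measurable (G (m + j)) (H j).
  apply: measurable_funM.
    apply: measurable_runmax => i ij.
    exact: measurableT_comp (measurable_excess a) (mD _ _ ij).
  exact: measurableT_comp (measurable_excess_sign a) (mD _ _ (leqnn j)).
have iH j : L2 (H j).
  apply: L2_le (iM j); first exact: past_measurableW (inn_event GW _) (mH j).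
  by move=> w; rewrite normrM ler_piMr ?excess_sign_le1.
have iHW j : L1 (fun w => H j w * W (m + j) w) := L2M (iH j) (inn_L2 GW _).
have [_ iE2] := iE n; have [_ iM2] := iM n.
have iS : L1 (fun w => \sum_(j < n) H j w * W (m + j) w).
  by apply: (@L1_sum _ _ _ _ n (fun j w => H j w * W (m + j) w)).
(* A zero is introduced on the right in order to be read as the expectation of the martingale
   transform. *)
rewrite -[leRHS]subr0 -(mulr0 4).
rewrite (_ : 0 = Ex (fun w => \sum_(j < n) H j w * W (m + j) w)).
  rewrite -!ExZ// -ExB; [|exact: L1Z..].
  apply: Ex_le => //; first by apply: L1B; exact: L1Z.
  move=> w; apply: (le_trans (doob_pathwise _ n)).
  rewrite lerD2l lerN2 ler_pM2l//; apply: ler_sum => j _.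
  rewrite /H -mulrA; apply: ler_wpM2l.
    by apply: runmax_ge0 => i; exact: excess_ge0.
  rewrite (_ : W (m + j) w = D j.+1 w - D j w); first exact: excess_sub.
  by rewrite /D addnS psumS; ring.
rewrite (@Ex_sum _ _ _ _ n (fun j w => H j w * W (m + j) w))//.
by rewrite big1// => j _; exact: (inn_ExM0 GW).
Qed.

Lemma doob_norm m n :
  Ex (fun w => runmax (fun j => `|psum W (m + j) w - psum W m w|) n ^+ 2)
    <= 4 * (n%:R * Ex (fun w => W 0%N w ^+ 2)).
Proof.
have := doob_excess m n (lexx 0); rewrite -(Ex_psum_sq_diff GW m n).
under eq_fun do under eq_fun do rewrite excess_norm.
under [X in _ <= 4 * Rintegral _ _ X -> _]eq_fun do rewrite excess_norm real_normK ?num_real//.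
by [].
Qed.

End maximal_inequality.

(** * Uniform integrability of the squared normalised walk *)

Lemma invsqrtn_cvg0 (R : realType) (c : R) :
  c / Num.sqrt n%:R @[n --> \oo] --> (0 : R).
Proof.
apply/cvgrPdist_le => e e0; near=> n.
have n0 : 0 < Num.sqrt n%:R :> R.
  by rewrite sqrtr_gt0 ltr0n; near: n; exact: nbhs_infty_gt.
rewrite sub0r normrN normrM [`|_^-1|]ger0_norm ?invr_ge0 ?(ltW n0)//.
rewrite ler_pdivrMr// [_ * Num.sqrt _]mulrC -(ler_pdivrMr _ _ e0).
have : Num.sqrt ((c / e) ^+ 2) <= Num.sqrt n%:R.
  by apply: ler_wsqrtr; near: n; exact: nbhs_infty_ger.
by rewrite sqrtr_sqr normrM [`|e^-1|]ger0_norm // invr_ge0 ltW.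
Unshelve. all: by end_near. Qed.

Section uniform_integrability.
Context d (T : measurableType d) (R : realType) (P : probability T R).
Variables (G : nat -> set (set T)) (W : nat -> T -> R).
Hypothesis GW : innovations P G W.

Local Notation Ex := (Rintegral P setT).
Local Notation L1 X := (P.-integrable setT (EFin \o X)).
Local Notation L2 := (sq_integrable P).

Let var := Ex (fun w => W 0%N w ^+ 2).

(* Nonnegative, at most quadratic, and equivalent to x^2/2 at infinity, but
   with a second derivative 1 - cos x which is small near 0. *)
Let k (x : R) := x ^+ 2 / 2 - 1 + cos x.
Let k1 (x : R) := x - sin x.
Let k2 (x : R) := 1 - cos x.

Let is_derive_k (x : R) : is_derive x 1 k (k1 x).
Proof.
have dq : is_derive x 1 (fun t : R => t ^+ 2 / 2) x.
  rewrite (_ : (fun t => _) = (fun t => 2^-1 *: (t * t))); last first.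
    by apply/funext => r; rewrite /GRing.scale/=; ring.
  apply: (is_derive_eq (is_deriveZ _ (is_deriveM (is_derive_id x 1) (is_derive_id x 1)))).
  by rewrite /GRing.scale/=; field.
rewrite /k; apply: (is_derive_eq (is_deriveD (is_deriveB dq (is_derive_cst (1 : R) x 1)) (is_derive_cos x))).
by rewrite subr0.
Qed.

Let is_derive_k1 (x : R) : is_derive x 1 k1 (k2 x).
Proof. by rewrite /k1; apply: (is_deriveB (is_derive_id x 1) (is_derive_sin x)). Qed.

Let k_taylor x w : `|k (x + w) - k x - k1 x * w - k2 x * w ^+ 2 / 2|
  <= 4 * (w ^+ 2 * Num.min 1 `|w|).
Proof.
have := @second_order_taylor R k k1 k2 2 x w is_derive_k is_derive_k1.
rewrite (_ : 2 * 2 = 4); last by ring.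
apply => [y|y z].
  rewrite /k2 ger0_norm ?subr_ge0 ?cos_le1//.
  by have := cos_geN1 y; lra.
rewrite /k2 (_ : _ - _ = - (cos y - cos z)); last by ring.
have := cosB_le z (y - z); rewrite [z + _]addrC subrK normrN => /le_trans; apply.
by rewrite mulr_natl mulr2n lerDl.
Qed.

(** For |y| >= 2 one has (|y| - 2)^2 <= y^2 - 4, and cos y >= -1 gives y^2 - 4 <= 2 k y. Below 2 the
    left side is 0, and [cos_ge] gives k y >= 0. *)
Let k_ge (y : R) : excess 2 y ^+ 2 <= 2 * k y.
Proof.
have := cos_ge y; have := cos_geN1 y; have := real_normK (num_real y).
rewrite /k /excess /Num.max; have := normr_ge0 y; case: ifP => h; nra.
Qed.

(** The expectations of [k (u * psum W j w)] are followed in [j] by [one_step]: a step adds at most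
    [u ^+ 2 * var / 2] times the mean of [k2], where k2 y <= y^2 / 2, plus a Lindeberg error. Then
    [k_ge] at scale [u] converts the bound into one for the excess over [2 / u]. *)
Lemma Ex_excess_psum (u : R) n : 0 < u ->
  Ex (fun w => excess (2 / u) (psum W n w) ^+ 2)
    <= n%:R * (u ^+ 2 * n%:R * var ^+ 2 / 2 + 8 * lindeberg P W u).
Proof.
move=> u0.
have iS j : L2 (fun w => u * psum W j w) by apply: L2Z; exact: psum_L2 GW _.
have v0 : 0 <= var by apply: Ex_ge0 => w; exact: sqr_ge0.
have mk : measurable_fun setT k.
  apply: measurable_funD; last exact: (continuous_measurable_fun (@continuous_cos R)).
  apply: measurable_funB => //; apply: measurable_funM => //.
have mk1 : measurable_fun setT k1.
  by apply: measurable_funB => //; exact: (continuous_measurable_fun (@continuous_sin R)).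
have mk2 : measurable_fun setT k2.
  by apply: measurable_funB => //; exact: (continuous_measurable_fun (@continuous_cos R)).
have k2_le2 x : `|k2 x| <= 2.
  rewrite /k2 ger0_norm ?subr_ge0 ?cos_le1//.
  by have := cos_geN1 x; lra.
have iS1 j : L2 (k1 \o (fun w => u * psum W j w)).
  apply: (L2_le _ _ (L2Z 2 (iS j))).
    by apply: measurableT_comp => //; case: (iS j).
  move=> w /=; rewrite /k1 (le_trans (ler_normB _ _))// [`|2 * _|]normrM.
  by rewrite (ger0_norm (ler0n R 2)) mulr_natl mulr2n lerD2l sin_norm_le.
have iS2 j : L1 (k2 \o (fun w => u * psum W j w)).
  apply: (L1_bounded _ _ (fun w => k2_le2 (u * psum W j w))).
  by apply: measurableT_comp => //; case: (iS j).
have step : forall j, L1 (k \o (fun w => u * psum W j w)) ->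
  L1 (k \o (fun w => u * psum W j.+1 w)) /\
  Ex (k \o (fun w => u * psum W j.+1 w)) <= Ex (k \o (fun w => u * psum W j w))
    + (u ^+ 4 * j%:R * var ^+ 2 / 4 + 4 * u ^+ 2 * lindeberg P W u).
  move=> j ik; have mS : past_measurable (G j) (fun w => u * psum W j w).
    by apply: measurable_funM => //; exact: (past_psum GW).
  have [] := one_step GW u mk mk1 mk2 k2_le2 k_taylor mS ik (iS1 j).
  rewrite (_ : (fun w => k (_ + _)) = k \o (fun w => u * psum W j.+1 w)); last first.
    by apply/funext => w /=; rewrite psumS mulrDr.
  move=> ik' h; split => //.
  have E2 : Ex (k2 \o (fun w => u * psum W j w)) <= u ^+ 2 * (j%:R * var) / 2.
    rewrite -(Ex_psum_sq GW) mulrAC -ExZ; last by case: (psum_L2 GW j).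
    apply: Ex_le => //; first by apply: L1Z; case: (psum_L2 GW j).
    by move=> w /=; have := cos_ge (u * psum W j w); rewrite /k2 exprMn; lra.
  move: h; rewrite ler_norml => /andP[_].
  rewrite -/var; set E := Ex (k2 \o _) in E2 *.
  have : u ^+ 2 * var / 2 * E <= u ^+ 2 * var / 2 * (u ^+ 2 * (j%:R * var) / 2).
    by apply: ler_wpM2l => //; rewrite divr_ge0 ?mulr_ge0 ?(ltW u0).
  move=> h1 h2.
  rewrite (_ : u ^+ 4 * j%:R * var ^+ 2 / 4
    = u ^+ 2 * var / 2 * (u ^+ 2 * (j%:R * var) / 2)); last by field.
  lra.
have L0 : 0 <= lindeberg P W u.
  by apply: Ex_ge0 => w; rewrite mulr_ge0 ?sqr_ge0// le_min ler01 normr_ge0.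
have [ik Ek] : L1 (k \o (fun w => u * psum W n w)) /\
  Ex (k \o (fun w => u * psum W n w))
    <= n%:R * (u ^+ 4 * n%:R * var ^+ 2 / 4 + 4 * u ^+ 2 * lindeberg P W u).
  (* Every step is charged the same bound, with [n] in place of its own index. *)
  suff : forall j, (j <= n)%N -> L1 (k \o (fun w => u * psum W j w)) /\
      Ex (k \o (fun w => u * psum W j w))
    <= j%:R * (u ^+ 4 * n%:R * var ^+ 2 / 4 + 4 * u ^+ 2 * lindeberg P W u).
    by apply.
  elim => [_|j IH jn].
    have -> : k \o (fun w => u * psum W 0 w) = fun=> 0.
      apply/funext => w; rewrite /= /psum big_ord0 mulr0 /k cos0 expr0n/=.
      by rewrite mul0r sub0r addNr.
    by rewrite Ex_cst mul0r; split => //; exact: L1_cst.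
  have [ij Ej] := IH (ltnW jn); have [ij1 Ej1] := step j ij; split => //.
  apply: (le_trans Ej1); rewrite -[j.+1%:R]natr1 [(_ + 1) * _]mulrDl mul1r.
  apply: lerD => //.
  rewrite lerD2r ler_pM2r// ler_wpM2r ?sqr_ge0//.
  by rewrite ler_wpM2l ?exprn_ge0 ?(ltW u0)// ler_nat ltnW.
have iE : L2 (excess (2 / u) \o psum W n).
  by apply: (excess_L2 _ (psum_L2 GW n)); rewrite divr_ge0// ltW.
apply: (@le_trans _ _ (2 / u ^+ 2 * Ex (k \o (fun w => u * psum W n w)))).
  rewrite -ExZ//; apply: Ex_le; [by case: iE|exact: L1Z|move=> w /=].
  have h : u * excess (2 / u) (psum W n w) = excess 2 (u * psum W n w).
    rewrite /excess normrM (gtr0_norm u0) maxr_pMr ?(ltW u0)// mulr0.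
    by congr Num.max; field; rewrite gt_eqF.
  rewrite mulrAC ler_pdivlMr ?exprn_gt0// -exprMn mulrC h.
  exact: k_ge.
apply: (le_trans (ler_wpM2l _ Ek)); first by rewrite divr_ge0 ?sqr_ge0.
rewrite le_eqVlt; apply/orP; left; apply/eqP; field.
by rewrite gt_eqF.
Qed.

Lemma Ex_excess_small (e : R) : 0 < e ->
  exists2 A : R, 0 < A & \forall n \near \oo,
    Ex (fun w => excess (A * Num.sqrt n%:R) (psum W n w) ^+ 2) <= e * n%:R.
Proof.
move=> e0.
(* With [u = 2 / (A sqrt n)] the threshold [2 / u] is [A sqrt n] and the first term of
   [Ex_excess_psum] becomes [n * (2 * var ^+ 2 / A ^+ 2)]. This [A] makes it at most [e * n / 2]; a
   Lindeberg term below [e / 16] yields the other half. *)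
pose A := 2 * (1 + var ^+ 2 / e); have A0 : 0 < A.
  by rewrite mulr_gt0// ltr_wpDr// divr_ge0 ?sqr_ge0// ltW.
exists A => //.
pose u n := 2 / (A * Num.sqrt n%:R) : R.
have u_cvg : u n @[n --> \oo] --> (0 : R).
  rewrite (_ : u = fun n => 2 / A / Num.sqrt n%:R); first exact: invsqrtn_cvg0.
  by apply/funext => n; rewrite /u invfM mulrA.
have := lindeberg_cvg0 GW u_cvg => /cvgrPdist_lt /(_ (e / 16)) h.
have e16 : 0 < e / 16 by rewrite divr_gt0.
have {}h := h e16.
near=> n.
have n0 : (0 < n)%N by near: n; exists 1%N.
have sn0 : 0 < Num.sqrt (n%:R : R) by rewrite sqrtr_gt0 ltr0n.
have un0 : 0 < u n by rewrite divr_gt0// mulr_gt0.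
have := Ex_excess_psum n un0.
rewrite (_ : 2 / u n = A * Num.sqrt n%:R); last first.
  by rewrite /u; field; rewrite !gt_eqF.
move=> /le_trans; apply; rewrite mulrC ler_pM2r ?ltr0n//.
have : `|0 - lindeberg P W (u n)| < e / 16 by near: n.
rewrite sub0r normrN => /ltW /(le_trans (ler_norm _)) hL.
have -> : u n ^+ 2 * n%:R * var ^+ 2 / 2 = 2 * var ^+ 2 / A ^+ 2.
  rewrite /u -[X in _ * X * _ ^+ 2](@sqr_sqrtr _ n%:R)// ?ler0n//.
  by field; rewrite !gt_eqF.
suff : 2 * var ^+ 2 / A ^+ 2 <= e / 2 by lra.
rewrite ler_pdivrMr ?exprn_gt0// /A.
set q := var ^+ 2; have q0 : 0 <= q by exact: sqr_ge0.
have -> : e / 2 * (2 * (1 + q / e)) ^+ 2 = 2 * e + 4 * q + 2 * (q ^+ 2 / e).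
  by field; rewrite gt_eqF.
have : 0 <= q ^+ 2 / e by rewrite divr_ge0 ?sqr_ge0// ltW.
by lra.
Unshelve. all: by end_near. Qed.

End uniform_integrability.

(** * The normal distribution and the central limit theorem *)

Section gaussian.
Context (R : realType).
Implicit Types (x y z s h t : R).

Local Notation mu := (@lebesgue_measure R).

Definition normal_cdf x : R := fine (std_normal_cdf x).
Local Notation Phi := normal_cdf.
Local Notation phi := (normal_pdf (0 : R) 1).
Local Notation c0 := (normal_peak (1 : R)).

Definition dpdf x := - x * phi x.
Definition ddpdf x := (x ^+ 2 - 1) * phi x.

Lemma std_normal_cdfE x : std_normal_cdf x = (Phi x)%:E.
Proof. by rewrite /normal_cdf fineK// /std_normal_cdf fin_num_measure. Qed.

Lemma normal_cdf_ge0 x : 0 <= Phi x.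
Proof. by rewrite fine_ge0// /std_normal_cdf measure_ge0. Qed.

Lemma normal_cdf_le1 x : Phi x <= 1.
Proof. by rewrite -lee_fin -std_normal_cdfE; exact: probability_le1. Qed.

Lemma pdfE x : phi x = c0 * expR (- (x ^+ 2 / 2)).
Proof.
rewrite normal_pdfE ?oner_neq0// /normal_fun subr0 expr1n.
by congr (_ * expR _); rewrite mulNr.
Qed.

Lemma peak_gt0 : 0 < c0.
Proof. by apply: normal_peak_gt0; exact: oner_neq0. Qed.

(** With y = x^2 / 2, the first bounds follow from e^y >= 1 + y and the last one from e^y >= (1 + y
    / 2)^2. The constants are not sharp. *)
Lemma pdf_moments x :
  [/\ 0 <= phi x, phi x <= c0, x ^+ 2 * phi x <= 2 * c0
    & x ^+ 4 * phi x <= 16 * c0].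
Proof.
rewrite pdfE; have c := peak_gt0.
pose y := x ^+ 2 / 2; have y0 : 0 <= y by rewrite divr_ge0 ?sqr_ge0.
rewrite -/y; have eN : expR (- y) * expR y = 1 by rewrite -expRD addNr expR0.
have e0 := expR_gt0 (- y).
have h1 : 1 + y <= expR y := expR_ge1Dx y.
have h2 : (1 + y / 2) ^+ 2 <= expR y.
  rewrite [in leRHS](splitr y) expRD -expr2 lerXn2r ?nnegrE ?expR_ge0//.
    by rewrite addr_ge0// divr_ge0.
  exact: expR_ge1Dx.
have -> : x ^+ 4 = 4 * y ^+ 2 by rewrite /y; field.
have -> : x ^+ 2 = 2 * y by rewrite /y; field.
have k1 : y * expR (- y) <= 1 by rewrite -eN mulrC ler_wpM2l ?ltW//; lra.
have k2 : y ^+ 2 * expR (- y) <= 4.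
  have : expR (- y) * (y ^+ 2 / 4) <= expR (- y) * expR y.
    by apply: ler_wpM2l; [exact: ltW|nra].
  by rewrite eN; lra.
have k0 : expR (- y) <= 1 by rewrite expR_le1 oppr_le0.
split; first exact: mulr_ge0 (ltW c) (ltW e0).
all: nra.
Qed.

Lemma is_derive_cdf x : is_derive x 1 Phi (phi x).
Proof.
have pint : mu.-integrable [set` Interval -oo%O (BRight (x + 1))] (EFin \o phi).
  by apply: integrableS (integrable_normal_pdf 0 1).
have x1 : x < x + 1 by rewrite ltrDl.
case: (continuous_FTC1 x1 pint _ (@continuous_normal_pdf R 0 1 (oner_neq0 R) x)).
  exact: ltNyr.
move=> dF F'; by have := DeriveDef dF; apply; rewrite -derive1E.
Qed.

Lemma is_derive_pdf x : is_derive x 1 phi (dpdf x).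
Proof.
rewrite (_ : normal_pdf 0 1 = fun t => c0 *: expR ((- 2^-1) *: (t * t))); last first.
  by apply/funext => t; rewrite pdfE /GRing.scale/=; congr (_ * expR _); ring.
have dq := is_deriveZ (- 2^-1) (is_deriveM (is_derive_id x 1) (is_derive_id x 1)).
have de := is_derive1_comp (is_derive_expR _) dq.
apply: (is_derive_eq (is_deriveZ c0 de)).
rewrite /dpdf pdfE /GRing.scale/=.
rewrite (_ : - 2^-1 *: _ = - (x ^+ 2 / 2)); last first.
  by rewrite /GRing.scale/= -[X in _ * X]/(x * x); ring.
by field.
Qed.

Lemma is_derive_dpdf x : is_derive x 1 dpdf (ddpdf x).
Proof.
apply: (is_derive_eq (is_deriveM (is_deriveN (is_derive_id x 1)) (is_derive_pdf x))).
by rewrite /GRing.scale/= /ddpdf /dpdf -[(- id) x]/(- x); ring.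
Qed.

(** The constant 22 is shared by several bounds: [xddpdf_le] needs 16 + 2 * 2 + 1 = 21, and
    [second_order_taylor] asks for a single constant for the size and the Lipschitz bound. *)
Lemma dpdf_le x : `|dpdf x| <= 22 * c0.
Proof.
have [h0 h1 h2 h4] := pdf_moments x; rewrite /dpdf ler_norml.
by apply/andP; split; nra.
Qed.

Lemma ddpdf_le x : `|ddpdf x| <= 22 * c0.
Proof.
have [h0 h1 h2 h4] := pdf_moments x; have := peak_gt0; rewrite /ddpdf ler_norml.
have h3 : 0 <= x ^+ 2 * phi x by rewrite mulr_ge0 ?sqr_ge0.
by move=> ?; apply/andP; split; rewrite mulrBl mul1r; lra.
Qed.

Lemma xddpdf_le x : `|x * ddpdf x| <= 22 * c0.
Proof.
have [h0 h1 h2 h4] := pdf_moments x; have c := peak_gt0.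
have : `|x| <= x ^+ 2 + 1.
  by rewrite ler_norml; apply/andP; split; nra.
rewrite normrM /ddpdf normrM (ger0_norm h0) => hx.
have : `|x ^+ 2 - 1| <= x ^+ 2 + 1.
  by have := sqr_ge0 x; rewrite ler_norml => ?; apply/andP; split; lra.
move=> hx2; rewrite mulrA.
apply: (@le_trans _ _ ((x ^+ 2 + 1) * (x ^+ 2 + 1) * phi x)).
  by apply: ler_wpM2r => //; exact: ler_pM.
rewrite (_ : _ * _ = x ^+ 4 * phi x + 2 * (x ^+ 2 * phi x) + phi x); last by ring.
lra.
Qed.

Lemma dpdf_lipschitz y z : `|dpdf y - dpdf z| <= 22 * c0 * `|y - z|.
Proof.
have [c _] := @MVT_increment R dpdf ddpdf z (y - z) is_derive_dpdf.
rewrite [z + _]addrC subrK => ->; rewrite normrM.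
by apply: ler_wpM2r => //; exact: ddpdf_le.
Qed.

Lemma cdf_lipschitz y z : `|Phi y - Phi z| <= c0 * `|y - z|.
Proof.
have [c _] := @MVT_increment R Phi phi z (y - z) is_derive_cdf.
rewrite [z + _]addrC subrK => ->; rewrite normrM.
apply: ler_wpM2r => //; have [h0 h1 _ _] := pdf_moments c.
by rewrite ger0_norm.
Qed.

Lemma cdf_taylor x w :
  `|Phi (x + w) - Phi x - phi x * w - dpdf x * w ^+ 2 / 2|
    <= 44 * c0 * (w ^+ 2 * Num.min 1 `|w|).
Proof.
have := second_order_taylor x w is_derive_cdf is_derive_pdf dpdf_le dpdf_lipschitz.
by rewrite (_ : 2 * (22 * c0) = 44 * c0)//; ring.
Qed.

Lemma cdf_nondecreasing y z : y <= z -> Phi y <= Phi z.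
Proof.
move=> yz; have [c _] := @MVT_increment R Phi phi y (z - y) is_derive_cdf.
rewrite [y + _]addrC subrK => h; have [h0 _ _ _] := pdf_moments c.
by rewrite -subr_ge0 h mulr_ge0// subr_ge0.
Qed.

Lemma cdf_tails (e : R) : 0 < e ->
  exists2 t, 0 < t & 1 - e <= Phi t /\ Phi (- t) <= e.
Proof.
move=> e0.
have mid : (@id R : measurableTypeR R -> R) \in mfun by rewrite inE; exact: measurable_id.
(* [Phi] is the distribution function of the identity under the normal law, which provides its
   limits at both infinities. *)
pose X : {RV (normal_prob (0 : R) 1) >-> R} := mfun_Sub mid.
have PhiE x : cdf X x = (Phi x)%:E by rewrite -std_normal_cdfE.
have := cvg_cdfy1 X; have := cvg_cdfNy0 X.
have -> : cdf X = EFin \o Phi by apply/funext => x; exact: PhiE.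
move=> /fine_cvgP[_ /cvgrPdist_le /(_ e e0)] [a [_ ha]].
move=> /fine_cvgP[_ /cvgrPdist_le /(_ e e0)] [b [_ hb]].
exists (Num.max 1 (Num.max (b + 1) (1 - a))).
  by rewrite lt_max ltr01.
set t := Num.max _ _.
have tb : b < t by rewrite !lt_max ltrDl ltr01 orbT.
have ta : - t < a.
  by rewrite ltrNl !lt_max; apply/orP; right; apply/orP; right; lra.
have := hb _ tb; have := ha _ ta => /=.
rewrite !ler_norml => /andP[h1 h2] /andP[h3 h4]; lra.
Qed.

(* With psi(s) = Phi (z / sqrt s) one has psi'(s) = dpdf (z / sqrt s) / (2 s):
   the normal distribution functions solve the heat equation. *)
Lemma cdf_heat z s0 s h : 0 < s0 -> s0 <= s -> 0 <= h ->
  `|Phi (z / Num.sqrt (s + h)) - Phi (z / Num.sqrt s)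
    - h * (dpdf (z / Num.sqrt s) / (2 * s))| <= 22 * c0 / s0 ^+ 2 * h ^+ 2.
Proof.
move=> s00 s0s h0.
have c := peak_gt0.
pose t r := z / Num.sqrt r.
have dt (r : R) : 0 < r -> is_derive r 1 t (- (t r / (2 * r))).
  move=> r0; have sr : Num.sqrt r != 0 by rewrite gt_eqF// sqrtr_gt0.
  have dV := is_deriveV sr (is_derive1_sqrt r0).
  apply: (is_derive_eq (is_deriveZ z dV)); rewrite /GRing.scale/= /t.
  rewrite -[X in _ = - (_ / (2 * X))](sqr_sqrtr (ltW r0)).
  by field.
have dG (r : R) : 0 < r -> is_derive r 1 (Phi \o t) (dpdf (t r) / (2 * r)).
  move=> r0; apply: (is_derive_eq (is_derive1_comp (is_derive_cdf _) (dt _ r0))).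
  by rewrite /dpdf; field; rewrite gt_eqF.
(* Twice the derivative of [Phi \o t]. The mean value theorem for [Phi \o t] and then for [p] leaves
   an error of order [h ^+ 2], uniform for variances above [s0]. *)
pose p r := dpdf (t r) * r^-1.
have dp (r : R) : 0 < r -> is_derive r 1 p
    (- (dpdf (t r) + t r * ddpdf (t r) / 2) / r ^+ 2).
  move=> r0; have r0' : r != 0 by rewrite gt_eqF.
  have d1 := is_derive1_comp (is_derive_dpdf _) (dt _ r0).
  have d2 := @is_deriveV R id r 1 1 r0' (is_derive_id r 1).
  apply: (is_derive_eq (is_deriveM d1 d2)).
  by rewrite /GRing.scale/=; field.
have mvt (f df : R -> R) r : (forall r : R, 0 < r -> is_derive r 1 f (df r)) -> s <= r ->
    exists2 q, s <= q <= r & f r - f s = df q * (r - s).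
  move=> fdf sr.
  have fdf' y : y \in `]s, r[ -> is_derive y 1 f (df y).
    rewrite in_itv/= => /andP[sy _]; apply: fdf.
    exact: lt_le_trans s00 (le_trans s0s (ltW sy)).
  have [|q] := MVT_segment sr fdf'; last by rewrite in_itv/= => ? ?; exists q.
  apply: derivable_within_continuous => y; rewrite in_itv/= => /andP[sy _].
  by have [] := fdf y (lt_le_trans s00 (le_trans s0s sy)).
have [|q /andP[sq qh]] := mvt _ _ (s + h) dG; first by rewrite lerDl.
rewrite /= -/(t (s + h)) -/(t s) => ->.
have [r /andP[sr rq] pE] := mvt _ _ q dp sq.
have sp : 0 < s := lt_le_trans s00 s0s.
have qp : 0 < q := lt_le_trans sp sq.
have rp : 0 < r := lt_le_trans sp sr.
have -> : dpdf (t q) / (2 * q) * (s + h - s) - h * (dpdf (t s) / (2 * s))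
    = h / 2 * (p q - p s).
  by rewrite /p; field; rewrite !gt_eqF.
rewrite pE !normrM normrN (ger0_norm (_ : 0 <= q - s)) ?subr_ge0//.
rewrite (ger0_norm h0) [`|2^-1|]ger0_norm//.
have -> : `|(r ^+ 2)^-1| = (r ^+ 2)^-1 by rewrite ger0_norm ?invr_ge0 ?sqr_ge0.
have hN : `|dpdf (t r) + t r * ddpdf (t r) / 2| <= 44 * c0.
  have h1 := dpdf_le (t r); have h2 := xddpdf_le (t r).
  apply: (le_trans (ler_normD _ _)).
  by rewrite [`|_ / 2|]normrM [`|2^-1|]ger0_norm//; lra.
have hr : (r ^+ 2)^-1 <= (s0 ^+ 2)^-1.
  rewrite lef_pV2 ?posrE ?exprn_gt0// lerXn2r ?nnegrE ?(ltW s00) ?(ltW rp)//.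
  exact: le_trans s0s sr.
have hq : q - s <= h by lra.
rewrite (_ : 22 * c0 / s0 ^+ 2 * h ^+ 2 = h / 2 * (44 * c0 / s0 ^+ 2 * h)); last first.
  by field; rewrite gt_eqF.
apply: ler_wpM2l; first by rewrite divr_ge0.
apply: ler_pM => //; rewrite ?subr_ge0//; first by rewrite mulr_ge0 ?invr_ge0 ?sqr_ge0.
by apply: ler_pM => //; rewrite invr_ge0 sqr_ge0.
Qed.

End gaussian.

(** * Lindeberg's replacement *)

Lemma ler_dist2D (R : realDomainType) (a b c e p q : R) :
  `|a - c - e| <= p -> `|b - c - e| <= q -> `|a - b| <= p + q.
Proof.
move=> hp hq; rewrite (_ : a - b = (a - c - e) - (b - c - e)); last by ring.
by rewrite (le_trans (ler_normB _ _))// lerD.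
Qed.

Lemma ler_dist_iter (R : realDomainType) (a : nat -> R) b n :
  (forall j, (j < n)%N -> `|a j.+1 - a j| <= b) -> `|a n - a 0%N| <= n%:R * b.
Proof.
elim: n => [|n IH] h; first by rewrite subrr normr0 mul0r.
rewrite (_ : _ - _ = (a n.+1 - a n) + (a n - a 0%N)); last by ring.
rewrite -[n.+1%:R]natr1 mulrDl mul1r addrC (le_trans (ler_normD _ _))//.
by rewrite lerD ?h// IH// => j jn; apply: h; exact: leqW.
Qed.

Lemma sum_rate (R : comPzRingType) (k k' l m i j : R) : m * i = 1 ->
  m * (k * (i * j) * l + k' * i ^+ 2) = k * j * l + k' * i.
Proof.
by move=> mi; rewrite -[RHS]mul1r -mi expr2 !mulrDr !mulrA; congr (_ + _);
  [rewrite -!mulrA [k * (i * _)]mulrCA|rewrite -!mulrA [k' * (i * _)]mulrCA].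
Qed.

(** The harmonic sequence is indexed as 1 / (n + 1), whereas the replacement error is of order 1 /
    n. *)
Lemma invn_le (R : realFieldType) n : (0 < n)%N ->
  n%:R^-1 <= 2 / n.+1%:R :> R.
Proof.
move=> n0; rewrite ler_pdivlMr ?ltr0n// mulrC ler_pdivrMr ?ltr0n//.
by rewrite -natrM ler_nat mul2n -addnn -addn1 leq_add.
Qed.

Lemma ler_half (R : realFieldType) (p q r e : R) :
  0 <= p -> r <= 2 * q -> p + q <= e / 2 -> p + r <= e.
Proof. by move=> *; lra. Qed.

Section central_limit_theorem.
Context d (T : measurableType d) (R : realType) (P : probability T R).
Variables (G : nat -> set (set T)) (W : nat -> T -> R).
Hypothesis GW : innovations P G W.

Local Notation Ex := (Rintegral P setT).
Local Notation L1 X := (P.-integrable setT (EFin \o X)).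
Local Notation L2 := (sq_integrable P).
Local Notation Phi := (@normal_cdf R).
Local Notation c0 := (normal_peak (1 : R)).

Let var := Ex (fun w => W 0%N w ^+ 2).

Lemma measurable_cdf : measurable_fun setT Phi.
Proof.
by apply: nondecreasing_measurable => // x y *; exact: cdf_nondecreasing.
Qed.

Lemma measurable_dpdf : measurable_fun setT (@dpdf R).
Proof. by apply: measurable_funM => //; exact: measurable_normal_pdf. Qed.

Lemma cdf_L1 (X : T -> R) : measurable_fun setT X -> L1 (Phi \o X).
Proof.
move=> mX; have mPX := measurableT_comp measurable_cdf mX.
apply: (L1_bounded _ mPX (c := 1)) => w /=.
by rewrite ger0_norm ?normal_cdf_ge0 ?normal_cdf_le1.
Qed.

(** Both expectations equal [Ex (f \o X) + h / 2 * Ex (f2 \o X)] up to their error terms: the first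
    by [one_step], as [u ^+ 2 * var = h], the second by [cdf_heat], as [f2] is [dpdf] divided by
    [s]. *)
Lemma clt_step (x u s0 s h : R) j : 0 < s0 -> s0 <= s -> 0 <= h ->
  u ^+ 2 * var = h ->
  `|Ex (fun w => Phi ((x - u * psum W j.+1 w) / Num.sqrt s))
    - Ex (fun w => Phi ((x - u * psum W j w) / Num.sqrt (s + h)))|
  <= 44 * c0 * (s0^-1 * (1 + (Num.sqrt s0)^-1)) * u ^+ 2 * lindeberg P W u
     + 22 * c0 / s0 ^+ 2 * h ^+ 2.
Proof.
move=> s00 s0s h0 uh; have c := peak_gt0 R.
have sp : 0 < s := lt_le_trans s00 s0s.
pose r : R := (Num.sqrt s)^-1; pose r0 : R := (Num.sqrt s0)^-1.
have rp : 0 < r by rewrite invr_gt0 sqrtr_gt0.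
have r0p : 0 < r0 by rewrite invr_gt0 sqrtr_gt0.
have rr0 : r <= r0 by rewrite lef_pV2 ?posrE ?sqrtr_gt0// ler_wsqrtr.
have r2 : r ^+ 2 = s^-1 by rewrite exprVn sqr_sqrtr// ltW.
have r02 : r0 ^+ 2 = s0^-1 by rewrite exprVn sqr_sqrtr// ltW.
pose f y := Phi ((x - y) / Num.sqrt s).
pose f1 y : R := - r * normal_pdf 0 1 ((x - y) / Num.sqrt s).
pose f2 y : R := r ^+ 2 * dpdf ((x - y) / Num.sqrt s).
have ml : measurable_fun setT (fun y : R => (x - y) / Num.sqrt s).
  by apply: measurable_funM => //; apply: measurable_funB.
have mf : measurable_fun setT f by exact: measurableT_comp measurable_cdf ml.
have mf1 : measurable_fun setT f1.
  apply: measurable_funM => //.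
  exact: measurableT_comp (measurable_normal_pdf _ _) ml.
have mf2 : measurable_fun setT f2.
  by apply: measurable_funM => //; exact: measurableT_comp measurable_dpdf ml.
have f2C y : `|f2 y| <= r ^+ 2 * (22 * c0).
  by rewrite normrM ger0_norm ?sqr_ge0// ler_wpM2l ?sqr_ge0// dpdf_le.
have f1C y : `|f1 y| <= r * c0.
  have [p0 p1 _ _] := pdf_moments ((x - y) / Num.sqrt s).
  by rewrite normrM normrN (ger0_norm (ltW rp)) (ger0_norm p0) ler_wpM2l ?(ltW rp).
have tay y w : `|f (y + w) - f y - f1 y * w - f2 y * w ^+ 2 / 2|
    <= 44 * c0 * (s0^-1 * (1 + r0)) * (w ^+ 2 * Num.min 1 `|w|).
  have := cdf_taylor ((x - y) / Num.sqrt s) (- w / Num.sqrt s).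
  rewrite -mulrDl (_ : x - y + - w = x - (y + w)); last by ring.
  rewrite -/(f (y + w)) -/(f y).
  rewrite (_ : normal_pdf 0 1 _ * _ = f1 y * w); last by rewrite /f1 /r; ring.
  rewrite (_ : dpdf _ * _ = f2 y * w ^+ 2); last by rewrite /f2 /r; ring.
  move=> /le_trans; apply; rewrite -/r -[leRHS]mulrA.
  apply: ler_wpM2l; first by rewrite mulr_ge0 ?(ltW c).
  rewrite exprMn sqrrN normrM normrN (ger0_norm (ltW rp)) -r02.
  have w2 := sqr_ge0 w; have wn := normr_ge0 w.
  (* Rescaling inside the truncation by [r <= r0] costs the factor [1 + r0], the origin of
     [1 + (Num.sqrt s0)^-1] in the bound. *)
  have hm : Num.min 1 (`|w| * r) <= (1 + r0) * Num.min 1 `|w|.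
    by rewrite /Num.min; do 2 case: ifP => ?; nra.
  have m0 : 0 <= Num.min 1 (`|w| * r).
    by rewrite le_min ler01 mulr_ge0// ltW.
  rewrite [leRHS](_ : _ = r0 ^+ 2 * w ^+ 2 * ((1 + r0) * Num.min 1 `|w|)); last by ring.
  apply: ler_pM => //; first by rewrite mulr_ge0 ?sqr_ge0.
  by rewrite mulrC ler_wpM2r// lerXn2r ?nnegrE ?(ltW rp) ?(ltW r0p).
have mS : measurable_fun setT (psum W j) by case: (psum_L2 GW j).
pose X w := u * psum W j w.
have mX : measurable_fun setT X by exact: measurable_funM.
have pX : past_measurable (G j) X.
  by apply: measurable_funM => //; exact: (past_psum GW).
have if0 : L1 (f \o X).
  exact: (cdf_L1 (measurableT_comp ml mX)).
have if1 : L2 (f1 \o X).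
  exact: (L2_bounded _ (measurableT_comp mf1 mX) (fun w => f1C (X w))).
have if2 : L1 (f2 \o X).
  exact: (L1_bounded _ (measurableT_comp mf2 mX) (fun w => f2C (X w))).
have [] := one_step GW u mf mf1 mf2 f2C tay pX if0 if1.
have -> : (fun w => f (X w + u * W j w))
    = (fun w => Phi ((x - u * psum W j.+1 w) / Num.sqrt s)).
  by apply/funext => w; rewrite /f /X psumS mulrDr.
move=> iA; rewrite -/var uh.
have iB : L1 (fun w => Phi ((x - X w) / Num.sqrt (s + h))).
  apply: (@cdf_L1 (fun w => (x - X w) / Num.sqrt (s + h))).
  by apply: measurable_funM => //; apply: measurable_funB.
have if2h := L1Z (h / 2) if2.
have : `|Ex (fun w => Phi ((x - X w) / Num.sqrt (s + h)) - (f \o X) w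
    - h / 2 * (f2 \o X) w)| <= 22 * c0 / s0 ^+ 2 * h ^+ 2.
  rewrite -[leRHS](Ex_cst P); apply: normr_Ex.
  - by apply: L1B => //; exact: L1B.
  - exact: L1_cst.
  move=> w /=; have := cdf_heat (x - X w) s00 s0s h0.
  rewrite (_ : h * (_ / _) = h / 2 * f2 (X w)) //.
  by rewrite /f2 r2; field; rewrite gt_eqF.
rewrite (ExB (L1B iB if0) if2h) (ExB iB if0) ExZ//.
move=> hB hA.
exact: ler_dist2D hA hB.
Qed.

Hypothesis var0 : 0 < var.

(** The smoothing keeps all variances at least [s ^+ 2], so that the errors of [clt_step] are
    uniform. Summed over [n] steps they amount to a multiple of the Lindeberg term plus a multiple
    of 1 / n. *)
Lemma clt_smooth (x s r : R) : 0 < s -> 0 < r -> r ^+ 2 = s ^+ 2 + 1 ->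
  Ex (fun w => Phi ((x - psum W n w / Num.sqrt (var * n%:R)) / s))
    @[n --> \oo] --> Phi (x / r).
Proof.
move=> sp rp rs; pose s0 := s ^+ 2.
have s00 : 0 < s0 by rewrite exprn_gt0.
have -> : r = Num.sqrt (s0 + 1) by rewrite -rs sqrtr_sqr gtr0_norm.
have -> : s = Num.sqrt s0 by rewrite sqrtr_sqr gtr0_norm.
move: s0 s00 => {sp rp rs s r} s0 s00.
have [u uE] : exists u : nat -> R, forall n, u n = (Num.sqrt (var * n%:R))^-1.
  by exists (fun n => (Num.sqrt (var * n%:R))^-1).
have [K [K' [K0 K'0 clt_stepK]]] : exists K K', [/\ 0 <= K, 0 <= K' &
    forall u s h j, s0 <= s -> 0 <= h -> u ^+ 2 * var = h ->
  `|Ex (fun w => Phi ((x - u * psum W j.+1 w) / Num.sqrt s))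
    - Ex (fun w => Phi ((x - u * psum W j w) / Num.sqrt (s + h)))|
  <= K * u ^+ 2 * lindeberg P W u + K' * h ^+ 2].
  have c := ltW (peak_gt0 R).
  exists (44 * c0 * (s0^-1 * (1 + (Num.sqrt s0)^-1))), (22 * c0 / s0 ^+ 2).
  split; last by move=> u' s h j ? ? ?; exact: clt_step.
    apply: mulr_ge0; first exact: mulr_ge0.
    apply: mulr_ge0; first by rewrite invr_ge0 ltW.
    by apply: addr_ge0 => //; rewrite invr_ge0 sqrtr_ge0.
  by rewrite divr_ge0 ?sqr_ge0// mulr_ge0.
have u_cvg : u n @[n --> \oo] --> (0 : R).
  rewrite (_ : u = fun n => (Num.sqrt var)^-1 / Num.sqrt n%:R); first exact: invsqrtn_cvg0.
  by apply/funext => n; rewrite uE sqrtrM ?(ltW var0)// invfM.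
have B_cvg : K / var * lindeberg P W (u n) + K' * n.+1%:R^-1 @[n --> \oo] --> (0 : R).
  rewrite [X in _ --> X](_ : 0 = K / var * 0 + K' * 0); last by ring.
  apply: cvgD; apply: cvgM; [exact: cvg_cst| |exact: cvg_cst|exact: cvg_harmonic].
  exact: (lindeberg_cvg0 GW).
apply/cvgrPdist_le => e e0.
have := B_cvg => /cvgrPdist_le /(_ _ (divr_gt0 e0 (ltr0n R 2))) hB.
near=> n.
have n0 : (0 < n)%N by near: n; exists 1%N.
have nR : 0 < n%:R :> R by rewrite ltr0n.
have hun : u n ^+ 2 * var = n%:R^-1.
  rewrite uE exprVn sqr_sqrtr ?mulr_ge0 ?(ltW var0)//.
  by field; rewrite !gt_eqF.
(* The smoothing variance plus that of the [n - j] normalised increments not yet added. At [j = 0]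
   all randomness is Gaussian and [a 0%N] is the limit; at [j = n] only the smoothing is left. *)
pose s j : R := s0 + (n - j)%:R / n%:R.
pose a j := Ex (fun w => Phi ((x - u n * psum W j w) / Num.sqrt (s j))).
have step j : (j < n)%N -> `|a j.+1 - a j|
    <= K * u n ^+ 2 * lindeberg P W (u n) + K' * n%:R^-1 ^+ 2.
  move=> jn; have := clt_stepK (u n) (s j.+1) n%:R^-1 j _ _ hun.
  rewrite (_ : s j.+1 + n%:R^-1 = s j).
    by apply; [rewrite /s lerDl divr_ge0|rewrite invr_ge0].
  by rewrite /s -(subnSK jn) -natr1; ring.
have tele : `|a n - a 0%N| <= n%:R * (K * u n ^+ 2 * lindeberg P W (u n) + K' * n%:R^-1 ^+ 2).
  exact: ler_dist_iter.
have a0E : a 0%N = Phi (x / Num.sqrt (s0 + 1)).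
  rewrite /a /s subn0 divff ?gt_eqF// -[RHS](Ex_cst P); congr (Ex _).
  by apply/funext => w; rewrite /psum big_ord0 mulr0 subr0.
have anE : a n = Ex (fun w => Phi ((x - psum W n w / Num.sqrt (var * n%:R)) / Num.sqrt s0)).
  rewrite /a /s subnn mul0r addr0; congr (Ex _); apply/funext => w.
  by rewrite uE [_^-1 * _]mulrC.
rewrite -a0E -anE distrC; apply: (le_trans tele).
have hBn : `|0 - (K / var * lindeberg P W (u n) + K' * n.+1%:R^-1)| <= e / 2.
  by near: n.
have u2 : u n ^+ 2 = n%:R^-1 / var by exact: canRL (mulfK (lt0r_neq0 var0)) hun.
rewrite u2.
rewrite (sum_rate K K' (lindeberg P W (u n)) var^-1 (divff (lt0r_neq0 nR))).
have L0 : 0 <= K / var * lindeberg P W (u n).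
  apply: mulr_ge0; last first.
    by apply: Ex_ge0 => w; rewrite mulr_ge0 ?sqr_ge0// le_min ler01 normr_ge0.
  by rewrite divr_ge0 ?(ltW var0).
have hn : K' * n%:R^-1 <= 2 * (K' * n.+1%:R^-1).
  rewrite [leRHS]mulrCA; exact: (ler_wpM2l K'0 (invn_le R n0)).
move: hBn; rewrite sub0r normrN => /(le_trans (ler_norm _)).
exact: ler_half L0 hn.
Unshelve. all: by end_near. Qed.

End central_limit_theorem.

(** * From smoothed distribution functions to the limit law *)

Lemma ler_dist_half (R : realFieldType) (a b c e : R) :
  `|a - b| <= e / 2 -> `|c - b| <= e / 2 -> `|a - c| <= e.
Proof.
by move=> h1 h2; rewrite (splitr e) (le_trans (ler_distD b _ _))// lerD// distrC.
Qed.

Lemma ler_dist_quadratic (R : realFieldType) (v m r e : R) :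
  0 <= r -> (1 + (e / 2)^-1) * r <= e / 2 * v ->
  `|m| <= e / 2 * v + (e / 2)^-1 * r -> `|v - (v + m + r)| <= e * v.
Proof.
move=> r0; rewrite mulrDl mul1r !ler_norml => hr /andP[h1 h2].
by apply/andP; split; lra.
Qed.

(* The sandwich P <= E+ + d, E- <= P + d, where E+ and E- are within 2d of l. *)
Lemma ler_dist_sandwich (R : realFieldType) (l p ep em lp lm e : R) :
  p <= ep + e / 4 -> em <= p + e / 4 -> `|lp - ep| <= e / 4 ->
  `|lm - em| <= e / 4 -> `|lp - l| <= e / 4 -> `|lm - l| <= e / 4 ->
  `|l - p| <= e.
Proof.
move=> h1 h2; rewrite !ler_norml => /andP[? ?] /andP[? ?] /andP[? ?] /andP[? ?].
by apply/andP; split; lra.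
Qed.

Section smoothed_convergence.
Context d (T : measurableType d) (R : realType) (P : probability T R).
Implicit Types (Y V : nat -> T -> R).

Local Notation Ex := (Rintegral P setT).
Local Notation L1 X := (P.-integrable setT (EFin \o X)).
Local Notation L2 := (sq_integrable P).
Local Notation Phi := (@normal_cdf R).
Local Notation c0 := (normal_peak (1 : R)).

(* P (Y n + s * N <= x) --> P (r * N <= x) for an independent standard normal
   variable N, with r = sqrt (s^2 + 1). *)
Definition smoothly_normal Y := forall x s r : R, 0 < s -> 0 < r ->
  r ^+ 2 = s ^+ 2 + 1 ->
  Ex (fun w => Phi ((x - Y n w) / s)) @[n --> \oo] --> Phi (x / r).

(** [Phi] is Lipschitz, so the expectations differ by at most [c0 / s] times the mean of |V - Y|,
    which the mean square controls. Indicators would not allow this, which is why the limit law is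
    carried in smoothed form. *)
Lemma smoothly_normal_perturb Y V :
  (forall n, L2 (Y n)) -> (forall n, L2 (V n)) ->
  Ex (fun w => (V n w - Y n w) ^+ 2) @[n --> \oo] --> (0 : R) ->
  smoothly_normal Y -> smoothly_normal V.
Proof.
move=> iY iV VY sY x s r s0 r0 sr; have c := peak_gt0 R.
apply/cvgrPdist_le => e e0.
have s0V : 0 < s^-1 by rewrite invr_gt0.
pose K := c0 / s; have K0 : 0 < K by rewrite mulr_gt0.
pose eta := e / 4 / K; have eta0 : 0 < eta.
  by rewrite divr_gt0// divr_gt0.
have := sY x s r s0 r0 sr => /cvgrPdist_le /(_ _ (divr_gt0 e0 (ltr0n R 2))) h1.
have := VY => /cvgrPdist_le /(_ _ (exprn_gt0 2 eta0)) h2.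
near=> n.
have : `|Phi (x / r) - Ex (fun w => Phi ((x - Y n w) / s))| <= e / 2.
  by near: n.
have : `|0 - Ex (fun w => (V n w - Y n w) ^+ 2)| <= eta ^+ 2 by near: n.
rewrite sub0r normrN => /(le_trans (ler_norm _)) h3 h4.
have iD : L2 (fun w => V n w - Y n w) by exact: L2B.
have iPhi Z : L2 Z -> L1 (fun w => Phi ((x - Z w) / s)).
  move=> [mZ _]; apply: (@cdf_L1 _ _ _ _ (fun w => (x - Z w) / s)).
  by apply: measurable_funM => //; apply: measurable_funB.
have hV : `|Ex (fun w => Phi ((x - V n w) / s)
    - Phi ((x - Y n w) / s))| <= K * (2 * eta).
  have iN := L2_norm iD; have [_ iD2] := iD.
  apply: (@le_trans _ _ (K * Ex (fun w => `|V n w - Y n w|))).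
    rewrite -ExZ; last exact: L2_L1.
    apply: normr_Ex; [by apply: L1B; exact: iPhi|exact: L1Z (L2_L1 iN)|move=> w].
    apply: (le_trans (cdf_lipschitz _ _)); rewrite /K -mulrA.
    apply: ler_wpM2l; first exact: ltW.
    rewrite -mulrBl normrM mulrC [`|_^-1|]ger0_norm ?(ltW s0V)//.
    rewrite (_ : x - V n w - (x - Y n w) = - (V n w - Y n w)) ?normrN//.
    by ring.
  apply: ler_wpM2l; first exact: ltW.
  have E0 : 0 <= Ex (fun w => `|V n w - Y n w|) by apply: Ex_ge0.
  have := Ex_sqr iN.
  under [X in _ <= Rintegral _ _ X]eq_fun do rewrite real_normK ?num_real//.
  by move=> /le_trans /(_ h3); nra.
have KE : K * (2 * eta) = e / 2 by rewrite /eta; field; rewrite gt_eqF.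
move: hV; rewrite (ExB (iPhi _ (iV n)) (iPhi _ (iY n))) KE.
exact: ler_dist_half h4.
Unshelve. all: by end_near. Qed.

(** If Y <= x then (x + t s - Y) / s >= t, and if Y > x then (x - t s - Y) / s <= - t. The indicator
    thus lies between two smoothed indicators, up to the tails of [Phi] beyond [t]. *)
Lemma smoothly_normal_cdf Y x : (forall n, measurable_fun setT (Y n)) ->
  smoothly_normal Y ->
  P [set w | Y n w <= x] @[n --> \oo] --> std_normal_cdf x.
Proof.
move=> mY sY; have c := peak_gt0 R.
have mA n : measurable [set w | Y n w <= x].
  rewrite -[X in measurable X]setTI; exact: measurable_fun_ler.
rewrite std_normal_cdfE.
rewrite (_ : (fun n => _) = (fun n => (fine (P [set w | Y n w <= x]))%:E)); last first.
  by apply/funext => n; rewrite fineK// fin_num_measure.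
apply/cvg_EFin; first exact: nearW.
apply/cvgrPdist_le => e e0.
have e4 : 0 < e / 4 by rewrite divr_gt0.
have [t t0 [t1 t2]] := cdf_tails e4.
have q0 : 0 <= c0 * (t + `|x|) by rewrite mulr_ge0 ?(ltW c)// addr_ge0 ?(ltW t0).
(* [t] is fixed by the tails; a small [s] then makes both the shift [t * s] and the change of scale
   [r - 1 <= s] harmless, since together they move the argument by at most [s * (t + |x|)]. *)
have [s s0 ss] : exists2 s, 0 < s & s * (c0 * (t + `|x|)) <= e / 4.
  exists ((e / 4) / (c0 * (t + `|x|) + 1)); first by rewrite divr_gt0// ltr_wpDl.
  rewrite mulrAC ler_pdivrMr ?ltr_wpDl//.
  by apply: ler_wpM2l; [exact: ltW|rewrite lerDl].
have [r [r1 rs rE]] : exists r, [/\ 1 <= r, r <= 1 + s & r ^+ 2 = s ^+ 2 + 1].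
  exists (Num.sqrt (s ^+ 2 + 1)); split.
  - by rewrite -[leLHS]sqrtr1; apply: ler_wsqrtr; rewrite lerDr sqr_ge0.
  - rewrite -[leRHS]ger0_norm; last by rewrite addr_ge0// ltW.
    by rewrite -sqrtr_sqr; apply: ler_wsqrtr; nra.
  - by rewrite sqr_sqrtr// addr_ge0 ?sqr_ge0.
have r0 : 0 < r by exact: lt_le_trans ltr01 r1.
have near_x (y : R) : `|y - x| <= t * s -> `|Phi (y / r) - Phi x| <= e / 4.
  move=> yx; apply: (le_trans (cdf_lipschitz _ _)); apply: le_trans ss.
  rewrite mulrCA; apply: ler_wpM2l; first exact: ltW.
  have rp : 0 < r by lra.
  have -> : y / r - x = ((y - x) - x * (r - 1)) / r by field; rewrite gt_eqF.
  rewrite normrM [`|r^-1|]ger0_norm ?invr_ge0 ?(ltW rp)// ler_pdivrMr//.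
  apply: (le_trans (ler_normB _ _)); rewrite normrM [`|r - 1|]ger0_norm ?subr_ge0//.
  have x0 := normr_ge0 x.
  have h1 : `|x| * (r - 1) <= `|x| * s by apply: ler_wpM2l => //; lra.
  have h2 : 0 <= s * (t + `|x|) * (r - 1).
    apply: mulr_ge0; last by rewrite subr_ge0.
    apply: mulr_ge0; first exact: ltW.
    by apply: addr_ge0 => //; exact: ltW.
  by clear -h1 h2 yx; nra.
have ts0 : 0 <= t * s by apply: mulr_ge0; exact: ltW.
have k1 : `|Phi ((x - t * s) / r) - Phi x| <= e / 4.
  apply: near_x; rewrite (_ : _ - x = - (t * s)); last by ring.
  by rewrite normrN ger0_norm.
have k2 : `|Phi ((x + t * s) / r) - Phi x| <= e / 4.
  apply: near_x; rewrite (_ : _ - x = t * s); last by ring.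
  by rewrite ger0_norm.
have := sY (x + t * s) s r s0 r0 rE => /cvgrPdist_le /(_ _ e4) h1.
have := sY (x - t * s) s r s0 r0 rE => /cvgrPdist_le /(_ _ e4) h2.
apply: filterS2 h1 h2 => n k4 k3.
have PE : fine (P [set w | Y n w <= x]) = Ex (fun w => \1_[set w | Y n w <= x] w).
  by rewrite /Rintegral integral_indic// setIT.
have iI : L1 (fun w => \1_[set w | Y n w <= x] w : R).
  exact/integrable_indic.
have iPhi y : L1 (fun w => Phi ((y - Y n w) / s)).
  apply: (@cdf_L1 _ _ _ _ (fun w => (y - Y n w) / s)).
  by apply: measurable_funM => //; apply: measurable_funB.
have up : Ex (fun w => \1_[set w | Y n w <= x] w)
    <= Ex (fun w => Phi ((x + t * s - Y n w) / s)) + e / 4.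
  rewrite -[X in _ <= _ + X](Ex_cst P) -ExD//; last exact: L1_cst.
  apply: Ex_le => //; first by apply: L1D => //; exact: L1_cst.
  move=> w; rewrite indicE; case: (boolP (w \in _)); last first.
    by rewrite addr_ge0 ?normal_cdf_ge0// ltW.
  rewrite inE/= => Yx.
  have : Phi t <= Phi ((x + t * s - Y n w) / s).
    apply: cdf_nondecreasing; rewrite ler_pdivlMr// -subr_ge0.
    by rewrite (_ : _ - _ = x - Y n w) ?subr_ge0//; ring.
  by move=> /(le_trans t1); rewrite lerBlDr.
have dn : Ex (fun w => Phi ((x - t * s - Y n w) / s))
    <= Ex (fun w => \1_[set w | Y n w <= x] w) + e / 4.
  rewrite -[X in _ <= _ + X](Ex_cst P) -ExD//; last exact: L1_cst.
  apply: Ex_le => //; first by apply: L1D => //; exact: L1_cst.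
  move=> w; rewrite indicE; case: (boolP (w \in _)).
    by rewrite (le_trans (normal_cdf_le1 _))// lerDl ltW.
  rewrite notin_setE/= => /negP; rewrite -ltNge => Yx.
  rewrite /= add0r; apply: le_trans t2; apply: cdf_nondecreasing.
  rewrite ler_pdivrMr// -subr_ge0 (_ : _ - _ = Y n w - x); last by ring.
  by rewrite subr_ge0 ltW.
by have := ler_dist_sandwich up dn k4 k3 k2 k1; rewrite -PE.
Qed.

Variables (G : nat -> set (set T)) (W : nat -> T -> R).
Hypothesis GW : innovations P G W.
Let var := Ex (fun w => W 0%N w ^+ 2).
Hypothesis var0 : 0 < var.

(** The centre [c] may be replaced by the mean, the variance is then equivalent to [var * n], and
    both normalised variables are reached from the normalised walk by perturbations small in L^2. *)
Theorem clt_perturbed (D : nat -> T -> R) (c : nat -> R) (x : R) :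
  (forall n, L2 (D n)) ->
  (forall e, 0 < e -> \forall n \near \oo,
    Ex (fun w => (D n w - c n - psum W n w) ^+ 2) <= e * n%:R) ->
  (P [set w | (D n w - fine 'E_P[D n]) / Num.sqrt (fine 'V_P[D n]) <= x]
     @[n --> \oo] --> std_normal_cdf x) /\
  (P [set w | (D n w - fine 'E_P[D n]) / Num.sqrt (var * n%:R) <= x]
     @[n --> \oo] --> std_normal_cdf x).
Proof.
move=> iD small.
pose m n := Ex (D n); pose v n := Ex (fun w => (D n w - m n) ^+ 2).
have mE n : fine 'E_P[D n] = m n by rewrite unlock.
have iC n : L2 (fun w => D n w - m n) by apply: L2B => //; exact: L2_cst.
have vE n : fine 'V_P[D n] = v n.
  rewrite /variance unlock; rewrite unlock /v /Rintegral.
  by congr fine; apply: eq_integral => w _; rewrite expr2.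
under eq_fun do under eq_fun do rewrite mE vE.
under [X in _ /\ (X @ _ --> _)]eq_fun do under eq_fun do rewrite mE.
pose rho n w := D n w - m n - psum W n w.
have iS n : L2 (psum W n) := psum_L2 GW n.
have irho n : L2 (rho n) by exact: L2B.
have ES n : Ex (psum W n) = 0.
  rewrite (@Ex_sum _ _ _ _ n W); last by move=> i _; exact: L2_L1 (inn_L2 GW i).
  by rewrite big1// => i _; exact: (inn_Ex GW).
(* Since [psum W n] is centred, passing from [c n] to the mean lowers the expected square by exactly
   [(m n - c n) ^+ 2]. *)
have rho_le n : Ex (fun w => rho n w ^+ 2)
    <= Ex (fun w => (D n w - c n - psum W n w) ^+ 2).
  have i1 : L2 (fun w => D n w - c n - psum W n w).
    by apply: L2B => //; apply: L2B => //; exact: L2_cst.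
  have [_ i2] := i1.
  have E1 : Ex (fun w => D n w - c n - psum W n w) = m n - c n.
    rewrite ExB ?ExB ?Ex_cst ?ES ?subr0//; try exact: L2_L1.
      exact: L1_cst.
    by apply: L1B; [exact: L2_L1|exact: L1_cst].
  have -> : Ex (fun w => rho n w ^+ 2)
      = Ex (fun w => (D n w - c n - psum W n w) ^+ 2) - (m n - c n) ^+ 2.
    transitivity (Ex (fun w => (D n w - c n - psum W n w) ^+ 2
      - (2 * (m n - c n)) * (D n w - c n - psum W n w) + (m n - c n) ^+ 2)).
      by congr (Ex _); apply/funext => w; rewrite /rho; ring.
    have i3 := L1Z (2 * (m n - c n)) (L2_L1 i1).
    rewrite (ExD (L1B i2 i3) (L1_cst _ _)) (ExB i2 i3) ExZ ?Ex_cst ?E1//.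
      by ring.
    exact: L2_L1.
  by rewrite gerBl sqr_ge0.
have rho_small e : 0 < e -> \forall n \near \oo, Ex (fun w => rho n w ^+ 2) <= e * n%:R.
  move=> /small; apply: filterS => n; exact: le_trans (rho_le n).
have rho_cvg : Ex (fun w => rho n w ^+ 2) / (var * n%:R) @[n --> \oo] --> (0 : R).
  apply/cvgrPdist_le => e e0; near=> n.
  have n0 : 0 < n%:R :> R by rewrite ltr0n; near: n; exact: nbhs_infty_gt.
  rewrite sub0r normrN ger0_norm; last first.
    by rewrite divr_ge0 ?mulr_ge0 ?(ltW var0)//; apply: Ex_ge0 => w; exact: sqr_ge0.
  rewrite ler_pdivrMr ?mulr_gt0// mulrA; near: n; apply: rho_small.
  by rewrite mulr_gt0.
have v_cvg : v n / (var * n%:R) @[n --> \oo] --> (1 : R).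
  apply/cvgrPdist_le => e e0.
  pose eta := e / 2; have eta0 : 0 < eta by rewrite divr_gt0.
  (* The coefficient of the mean of [rho n w ^+ 2]: 1 from the square itself, and [eta^-1] from the
     cross term via 2 |A B| <= eta A^2 + B^2 / eta. *)
  pose K := 1 + eta^-1; have K0 : 0 < K by rewrite ltr_wpDr// invr_ge0 ltW.
  have := rho_cvg => /cvgrPdist_le /(_ _ (divr_gt0 eta0 K0)) h.
  near=> n.
  have n0 : 0 < n%:R :> R by rewrite ltr0n; near: n; exact: nbhs_infty_gt.
  have vn : 0 < var * n%:R by rewrite mulr_gt0.
  have : `|0 - Ex (fun w => rho n w ^+ 2) / (var * n%:R)| <= eta / K by near: n.
  rewrite sub0r normrN => /(le_trans (ler_norm _)).
  rewrite ler_pdivrMr// => hr.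
  have iM := L2M (iS n) (irho n).
  have [[_ iS2] [_ ir2]] := (iS n, irho n).
  have vE' : v n = n%:R * var + 2 * Ex (fun w => psum W n w * rho n w)
      + Ex (fun w => rho n w ^+ 2).
    rewrite -(Ex_psum_sq GW) -ExZ// -ExD//; last exact: L1Z.
    rewrite -ExD//; last by apply: L1D => //; exact: L1Z.
    by congr (Ex _); apply/funext => w; rewrite /rho; ring.
  have hM : `|2 * Ex (fun w => psum W n w * rho n w)|
      <= eta * (n%:R * var) + eta^-1 * Ex (fun w => rho n w ^+ 2).
    have i1 := L1Z eta iS2; have i2 := L1Z eta^-1 ir2.
    rewrite -(Ex_psum_sq GW) -ExZ// -ExZ// -ExZ// -ExD//.
    apply: normr_Ex; [exact: L1Z|exact: L1D|move=> w].
    set A := psum W n w; set B := rho n w.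
    have hA : 0 <= eta^-1 * (eta * A - B) ^+ 2 by rewrite mulr_ge0 ?sqr_ge0 ?invr_ge0 ?ltW.
    have hB : 0 <= eta^-1 * (eta * A + B) ^+ 2 by rewrite mulr_ge0 ?sqr_ge0 ?invr_ge0 ?ltW.
    have eN : eta != 0 by rewrite gt_eqF.
    have eA : eta^-1 * (eta * A - B) ^+ 2 = eta * A ^+ 2 - 2 * (A * B) + eta^-1 * B ^+ 2.
      by field.
    have eB : eta^-1 * (eta * A + B) ^+ 2 = eta * A ^+ 2 + 2 * (A * B) + eta^-1 * B ^+ 2.
      by field.
    by rewrite ler_norml; apply/andP; split; lra.
  rewrite -[X in `|X - _|](divff (_ : var * n%:R != 0)) ?gt_eqF// -mulrBl.
  rewrite normrM [`|_^-1|]ger0_norm ?invr_ge0 ?(ltW vn)// ler_pdivrMr//.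
  have r0 : 0 <= Ex (fun w => rho n w ^+ 2) by apply: Ex_ge0 => w; exact: sqr_ge0.
  have hK : K * Ex (fun w => rho n w ^+ 2) <= eta * (var * n%:R).
    rewrite mulrC -ler_pdivlMr// (le_trans hr)//.
    by rewrite mulrAC.
  rewrite vE' (mulrC _ var); rewrite (mulrC _ var) in hM.
  exact: ler_dist_quadratic r0 hK hM.
pose Y n w := psum W n w / Num.sqrt (var * n%:R).
have iY n : L2 (Y n).
  by rewrite /Y; under eq_fun do rewrite mulrC; exact: L2Z.
pose V2 n w := (D n w - m n) / Num.sqrt (var * n%:R).
have iV2 n : L2 (V2 n).
  by rewrite /V2; under eq_fun do rewrite mulrC; exact: L2Z.
pose V1 n w := (D n w - m n) / Num.sqrt (v n).
have iV1 n : L2 (V1 n).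
  by rewrite /V1; under eq_fun do rewrite mulrC; exact: L2Z.
have sY : smoothly_normal Y.
  by move=> y s r s0 r0 sr; exact: (clt_smooth GW var0 s0 r0 sr).
have sV2 : smoothly_normal V2.
  apply: smoothly_normal_perturb sY => //.
  rewrite (_ : (fun n => _) = (fun n => Ex (fun w => rho n w ^+ 2) / (var * n%:R)))//.
  apply/funext => n; rewrite mulrC -ExZ; last by case: (irho n).
  congr (Ex _); apply/funext => w; rewrite /V2 /Y -mulrBl -/(rho n w) exprMn mulrC.
  by rewrite exprVn sqr_sqrtr// mulr_ge0// ltW.
have sV1 : smoothly_normal V1.
  apply: smoothly_normal_perturb sV2 => //.
  apply/cvgrPdist_le => e e0.
  (* The bound 1/2 keeps [v n] positive, so that the division by its root is genuine, and makes the
     square of the difference at most its absolute value. *)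
  have e1 : 0 < Num.min 2^-1 e by rewrite lt_min e0 invr_gt0 ltr0n.
  have := v_cvg => /cvgrPdist_le /(_ _ e1) h.
  near=> n.
  have n0 : 0 < n%:R :> R by rewrite ltr0n; near: n; exact: nbhs_infty_gt.
  have vn : 0 < var * n%:R by rewrite mulr_gt0.
  have : `|1 - v n / (var * n%:R)| <= Num.min 2^-1 e by near: n.
  set q := v n / _; rewrite le_min => /andP[q1 q2].
  have qp : 0 < q by move: q1; rewrite ler_norml => /andP[_]; lra.
  have vp : 0 < v n by move: qp; rewrite pmulr_lgt0// invr_gt0.
  rewrite sub0r normrN ger0_norm; last by apply: Ex_ge0 => w; exact: sqr_ge0.
  have -> : Ex (fun w => (V1 n w - V2 n w) ^+ 2) = (1 - Num.sqrt q) ^+ 2.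
    have [_ iC2] := iC n.
    transitivity (((Num.sqrt (v n))^-1 - (Num.sqrt (var * n%:R))^-1) ^+ 2 * v n).
      rewrite -ExZ//; congr (Ex _); apply/funext => w.
      by rewrite /V1 /V2 -mulrBr exprMn mulrC.
    rewrite -[X in _ * X](sqr_sqrtr (ltW vp)) -exprMn mulrBl mulVf ?gt_eqF ?sqrtr_gt0//.
    by rewrite /q [Num.sqrt (v n / _)]sqrtrM ?(ltW vp)// sqrtrV ?(ltW vn)// [_^-1 * _]mulrC.
  have sq0 := sqrtr_ge0 q.
  have sqq : Num.sqrt q ^+ 2 = q := sqr_sqrtr (ltW qp).
  have h1 : `|1 - Num.sqrt q| <= `|1 - q|.
    rewrite -{2}sqq (_ : 1 - _ ^+ 2 = (1 - Num.sqrt q) * (1 + Num.sqrt q)); last by ring.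
    by rewrite normrM ler_peMr// ger0_norm ?addr_ge0// lerDl.
  rewrite -(real_normK (num_real _)); apply: le_trans (le_trans h1 q2).
  rewrite expr2 ler_piMr// (le_trans h1)// (le_trans q1)//.
  by rewrite invf_le1 ?ler1n.
split; first exact: (smoothly_normal_cdf (fun n => proj1 (iV1 n)) sV1).
exact: (smoothly_normal_cdf (fun n => proj1 (iV2 n)) sV2).
Unshelve. all: by end_near. Qed.

End smoothed_convergence.

(** * Geometry of the convex hull *)

Section euclidean_plane.
Context {R : realType}.
Implicit Types (u v w p q : Plane R) (c : R) (A : set (Plane R)).

Definition scale2 c u : Plane R := (c * u.1, c * u.2).

Lemma norm2_ge0 u : 0 <= norm2 u. Proof. exact: sqrtr_ge0. Qed.

Lemma dot2_ge0 u : 0 <= dot2 u u.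
Proof. by rewrite /dot2 -!expr2 addr_ge0 ?sqr_ge0. Qed.

Lemma norm2_sqr u : norm2 u ^+ 2 = u.1 ^+ 2 + u.2 ^+ 2.
Proof. by rewrite sqr_sqrtr ?dot2_ge0// /dot2 !expr2. Qed.

Lemma norm2_le u c : 0 <= c -> u.1 ^+ 2 + u.2 ^+ 2 <= c ^+ 2 -> norm2 u <= c.
Proof.
move=> c0 uc; rewrite -(ler_pXn2r (ltn0Sn 1)) ?nnegrE ?norm2_ge0//.
by rewrite norm2_sqr.
Qed.

(** Cauchy-Schwarz, from Lagrange's identity. *)
Lemma dot2_le u v : dot2 u v <= norm2 u * norm2 v.
Proof.
have nn : 0 <= norm2 u * norm2 v by rewrite mulr_ge0 ?norm2_ge0.
have [h|h] := leP (dot2 u v) 0; first exact: le_trans nn.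
rewrite -(ler_pXn2r (ltn0Sn 1)) ?nnegrE ?(ltW h)// exprMn !norm2_sqr /dot2.
move: u.1 u.2 v.1 v.2 => a b c d {h nn}; have := sqr_ge0 (a * d - b * c).
by move=> h; lra.
Qed.

Lemma norm2D u v : norm2 (u + v) <= norm2 u + norm2 v.
Proof.
apply: norm2_le; first by rewrite addr_ge0 ?norm2_ge0.
have := dot2_le u v; have := norm2_sqr u; have := norm2_sqr v; rewrite /dot2/=.
by move: (norm2 u) (norm2 v) u.1 u.2 v.1 v.2 => *; lra.
Qed.

Lemma norm2N u : norm2 (- u) = norm2 u.
Proof. by rewrite /norm2 /dot2/= !mulrNN. Qed.

Lemma norm2B u v : norm2 (u - v) <= norm2 u + norm2 v.
Proof. by rewrite -(norm2N v) norm2D. Qed.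

Lemma norm2_distC u v : norm2 (u - v) = norm2 (v - u).
Proof. by rewrite -norm2N opprB. Qed.

Lemma norm2_scale c u : norm2 (scale2 c u) = `|c| * norm2 u.
Proof.
rewrite -sqrtr_sqr /norm2 -sqrtrM ?sqr_ge0//; congr Num.sqrt.
by rewrite /dot2 /scale2/=; ring.
Qed.

Lemma norm2_eq0 u : norm2 u = 0 -> u = 0.
Proof.
move=> u0; have := norm2_sqr u; rewrite u0 expr0n/= => /esym/eqP.
rewrite paddr_eq0 ?sqr_ge0// !sqrf_eq0 => /andP[/eqP h1 /eqP h2].
by case: u h1 h2 {u0} => a b /= -> ->.
Qed.

Lemma norm2_sum u : norm2 u <= `|u.1| + `|u.2|.
Proof.
apply: norm2_le; first exact: addr_ge0.
rewrite -(real_normK (num_real u.1)) -(real_normK (num_real u.2)).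
have := normr_ge0 u.1; have := normr_ge0 u.2.
by move: `|u.1| `|u.2| => a b ? ?; nra.
Qed.

Lemma dir_norm2 (t : R) : norm2 (dir t) = 1.
Proof. by rewrite /norm2 /dot2/= -!expr2 cos2Dsin2 sqrtr1. Qed.

(** Some angle in the prescribed interval has to be exhibited, since [xget] returns its default on
    an empty set. *)
Lemma angleP u : u <> 0 -> u = scale2 (norm2 u) (dir (angle u)).
Proof.
move=> u0; have n0 : 0 < norm2 u.
  by rewrite lt_neqAle norm2_ge0 andbT eq_sym; apply/eqP => /norm2_eq0.
suff [t ht] : exists t : R, 0 <= t < 2 * pi /\
    u = (norm2 u * (dir t).1, norm2 u * (dir t).2).
  by rewrite /angle /scale2; case: xgetP => [y _ []//|/(_ t)].
pose c := u.1 / norm2 u; pose s := u.2 / norm2 u.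
have cs : c ^+ 2 + s ^+ 2 = 1.
  by rewrite /c /s !exprMn -mulrDl -norm2_sqr -exprMn divff ?gt_eqF// expr1n.
have c1 : -1 <= c <= 1.
  have := sqr_ge0 s; have := sqr_ge0 (c + 1); have := sqr_ge0 (c - 1).
  by move: cs; clear; move: c s => c s *; apply/andP; split; nra.
have uE (t : R) : cos t = c -> sin t = s ->
    u = (norm2 u * (dir t).1, norm2 u * (dir t).2).
  move=> tc ts; rewrite /dir/= tc ts /c /s.
  by rewrite mulrC divfK ?gt_eqF// mulrC divfK ?gt_eqF//; case: (u).
have p0 := pi_gt0 R.
have /andP[a0 api] : 0 <= acos c <= pi by rewrite acos_ge0 ?acos_lepi.
have [s0|s0] := leP 0 s.
  exists (acos c); split; first by apply/andP; split => //; lra.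
  apply: uE; first by rewrite acosK.
  by rewrite sin_acos// (_ : 1 - _ = s ^+ 2) ?sqrtr_sqr ?ger0_norm//; lra.
exists (2 * pi - acos c); split.
  apply/andP; split; first lra.
  (* Here [s < 0] excludes [c = 1], which keeps the angle strictly below [2 * pi]. *)
  have : acos c != 0.
    apply/eqP => a; have := acosK c1; rewrite a cos0 => c1'.
    by move: cs; rewrite -c1'; nra.
  by move=> h; rewrite gtrBl lt_neqAle eq_sym h.
apply: uE.
  by rewrite mulr_natl addrC cosD2pi cosN acosK.
rewrite mulr_natl addrC sinD2pi sinN sin_acos// (_ : 1 - _ = s ^+ 2); last by lra.
by rewrite sqrtr_sqr ltr0_norm// opprK.
Qed.

Lemma ball_convex q c : convex_set (M := (R^o * R^o)%type)
  [set p : R^o * R^o | norm2 ((p : Plane R) - q) <= c].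
Proof.
move=> x y l; rewrite !inE/= => xc yc.
set z := conv _ _ _.
have -> : (z : Plane R) - q = scale2 l%:num (x - q) + scale2 (1 - l%:num) (y - q).
  by apply/pair_equal_spec; split; rewrite /z/conv/= /unstable.onem /GRing.scale/=; ring.
have l0 : 0 <= l%:num by [].
have l1 : 0 <= 1 - l%:num by rewrite subr_ge0.
apply: (le_trans (norm2D _ _)); rewrite !norm2_scale (ger0_norm l0) (ger0_norm l1).
apply: (@le_trans _ _ (l%:num * c + (1 - l%:num) * c)).
  by apply: lerD; apply: ler_wpM2l.
by rewrite -mulrDl addrC subrK mul1r.
Qed.

(** Balls are convex: a ball about a point of [A] contains the hull. Hence a ball about any point of
    the hull contains [A], and so the hull. *)
Lemma hull_dist_le A c : (forall p q, A p -> A q -> norm2 (p - q) <= c) ->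
  forall p q, convex_hull A p -> convex_hull A q -> norm2 (p - q) <= c.
Proof.
move=> Ac.
have h1 p q : A q -> convex_hull A p -> norm2 (p - q) <= c.
  move=> Aq hp; apply: (hp [set p : Plane R | norm2 (p - q) <= c]).
  by split; [exact: ball_convex|move=> r /= Ar; exact: Ac].
move=> p q hp hq; apply: (hp [set p : Plane R | norm2 (p - q) <= c]).
split; first exact: ball_convex.
by move=> r /= Ar; rewrite norm2_distC; exact: h1.
Qed.

Lemma diameter_hull A c : (forall p q, A p -> A q -> norm2 (p - q) <= c) ->
  (exists p q, [/\ A p, A q & norm2 (p - q) = c]) ->
  diameter (convex_hull A) = c.
Proof.
move=> Ac [p [q [Ap Aq pqc]]].
have sub : A `<=` convex_hull A by exact: sub_smallest.
have ub r : [set norm2 (p.1 - p.2) | p in convex_hull A `*` convex_hull A] r -> r <= c.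
  by move=> [[x y] [/= hx hy] <-]; exact: (hull_dist_le Ac hx hy).
have cin : [set norm2 (p.1 - p.2) | p in convex_hull A `*` convex_hull A] c.
  by exists (p, q) => //; split; exact: sub.
apply/eqP; rewrite eq_le; apply/andP; split.
  by apply: ge_sup => //; exists c.
by apply: ub_le_sup => //; exists c.
Qed.

End euclidean_plane.

(** * Deterministic bounds for pairs of trajectory points *)

Section pair_bound.
Context {R : realType}.
Implicit Types (e u v w x y : Plane R).

Lemma dot2_unit_ge x e : norm2 e = 1 -> - norm2 x <= dot2 x e.
Proof.
move=> e1; rewrite lerNl; have := dot2_le (- x) e.
by rewrite e1 mulr1 norm2N /dot2/= !mulNr -opprD.
Qed.

(** The squared norm is A^2 + 2 A t, at most (A + t)^2, where t is the correction to A. The sum A +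
    t is nonnegative because 2 A (A + t) is A^2 plus the squared norm. *)
Lemma norm2_shift (A : R) e x : norm2 e = 1 -> 0 < A ->
  norm2 (scale2 A e + x) <= A + dot2 x e + norm2 x ^+ 2 / (2 * A).
Proof.
move=> e1 A0; set t := dot2 x e + norm2 x ^+ 2 / (2 * A).
have tE : A ^+ 2 + 2 * A * t = (A * e.1 + x.1) ^+ 2 + (A * e.2 + x.2) ^+ 2.
  have := norm2_sqr e; rewrite e1 expr1n => he.
  rewrite /t mulrDr (_ : 2 * A * (_ / _) = norm2 x ^+ 2); last first.
    by rewrite mulrC divfK// mulf_neq0 ?gt_eqF.
  rewrite norm2_sqr /dot2 -[A ^+ 2]mulr1 {1}he.
  by move: x.1 x.2 e.1 e.2 => a b c d; ring.
rewrite -addrA -/t; apply: norm2_le; last first.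
  rewrite /= -tE (_ : (A + t) ^+ 2 = A ^+ 2 + 2 * A * t + t ^+ 2); last by ring.
  by rewrite lerDl sqr_ge0.
rewrite -(pmulr_rge0 _ A0); have := sqr_ge0 (A * e.1 + x.1).
have := sqr_ge0 (A * e.2 + x.2); have := sqr_ge0 A.
move: tE; clearbody t; move: (A * e.1 + x.1) (A * e.2 + x.2) => b c *; lra.
Qed.

(* If v is far from the extremal mean n * rho * e (that is, m < n - p), then it
   is shorter by (rho - rho') * m; otherwise it is a small perturbation of the
   extremal vector. *)
Lemma pair_bound e x y w v (n m p rho rho' O M a : R) :
  v = scale2 (p * rho) e + w + y -> norm2 e = 1 -> 0 <= rho' -> rho' < rho ->
  0 <= p -> p <= n -> 0 < n -> 0 <= m -> 2 * m <= n ->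
  norm2 w <= (n - p) * rho' -> norm2 x <= M -> norm2 y <= M ->
  0 <= O -> (n - p <= m -> norm2 (y - x) <= O) ->
  0 <= a -> 2 * a <= (rho - rho') * m ->
  norm2 v <= n * rho + dot2 x e + (O + 4 * a ^+ 2 / (n * rho) + 4 * excess a M).
Proof.
move=> -> e1 rho'0 rr p0 pn n0 m0 mn wn xM yM O0 near a0 am.
have rho0 : 0 < rho by exact: le_lt_trans rr.
have M0 : 0 <= M := le_trans (norm2_ge0 _) xM.
have xe := dot2_unit_ge x e1.
have exE : excess a M = Num.max 0 (M - a) by rewrite /excess ger0_norm.
have ex0 : 0 <= excess a M := excess_ge0 a M.
have exM : M - a <= excess a M by rewrite exE le_max lexx orbT.
have q0 : 0 <= 4 * a ^+ 2 / (n * rho).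
  by rewrite divr_ge0 ?mulr_ge0 ?sqr_ge0 ?(ltW n0) ?(ltW rho0).
have pe : norm2 (scale2 (p * rho) e) = p * rho.
  by rewrite norm2_scale e1 mulr1 ger0_norm// mulr_ge0// ltW.
have [npm|npm] := leP (n - p) m; last first.
  (* Far pair: the mean loses at least [2 * a], while [norm2 y] and [- dot2 x e] cost at most
     [2 * M] together; at most [2 * (M - a)] remains. *)
  have := norm2D (scale2 (p * rho) e + w) y.
  have := norm2D (scale2 (p * rho) e) w; rewrite pe.
  have : (rho - rho') * m <= (rho - rho') * (n - p).
    by apply: ler_wpM2l; [rewrite subr_ge0 ltW|exact: ltW].
  move: wn xM yM xe exM am ex0 q0 O0.
  move: (norm2 (_ + y)) (norm2 (_ + w)) (norm2 w) (norm2 x) (norm2 y) (dot2 x e).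
  by move: (excess a M) (4 * a ^+ 2 / _) => *; nra.
have np2 : n <= 2 * p by lra.
have pp : 0 < p by lra.
have pr : 0 < p * rho by rewrite mulr_gt0.
have h : norm2 (scale2 (p * rho) e + w + y)
    <= norm2 (scale2 (p * rho) e + x) + norm2 w + norm2 (y - x).
  rewrite (_ : _ + y = (scale2 (p * rho) e + x) + w + (y - x)); last first.
    by rewrite [_ + x + w]addrAC -[RHS]addrA [x + _]addrC subrK.
  by apply: (le_trans (norm2D _ _)); rewrite lerD2r norm2D.
apply: (le_trans h); have {h} := near npm.
have : norm2 (scale2 (p * rho) e + x)
    <= p * rho + dot2 x e + (4 * a ^+ 2 / (n * rho) + 4 * excess a M).
  (* For [M <= 2 * a] the quadratic term of [norm2_shift] is at most (2 a)^2 / (n rho), as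
     [n <= 2 * p]. Otherwise the triangle inequality loses at most [2 * M], which is below
     [4 * (M - a)]. *)
  have [Ma|aM] := leP M (2 * a).
    have h1 := norm2_shift x e1 pr.
    have h2 : norm2 x ^+ 2 / (2 * (p * rho)) <= 4 * a ^+ 2 / (n * rho).
      apply: ler_pM; rewrite ?sqr_ge0 ?invr_ge0 ?mulr_ge0 ?(ltW rho0)//.
        by have := norm2_ge0 x; have := le_trans xM Ma; nra.
      by rewrite lef_pV2 ?posrE ?mulr_gt0// mulrA ler_wpM2r// ltW.
    by apply: (le_trans h1); rewrite lerD2l (le_trans h2)// lerDl mulr_ge0.
  have := norm2D (scale2 (p * rho) e) x; rewrite pe.
  move: xM xe exM aM q0.
  move: (norm2 (_ + x)) (norm2 x) (dot2 x e) (excess a M) (4 * a ^+ 2 / _) => *; lra.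
have : (n - p) * rho' <= (n - p) * rho.
  by apply: ler_wpM2l; [rewrite subr_ge0|exact: ltW].
move: wn; move: (norm2 (_ + x)) (norm2 w) (norm2 (y - x)) (dot2 x e).
by move: (4 * a ^+ 2 / _) (excess a M) => *; lra.
Qed.

End pair_bound.

Lemma near_end i j m n : (i <= n)%N -> (j <= i)%N -> (n <= j + m)%N ->
  (n - m <= i <= n)%N /\ (n - m <= j <= n)%N.
Proof. by lia. Qed.

Lemma near_gap i j m n : (i <= n)%N -> (j <= i)%N -> (n <= i - j + m)%N ->
  (n - m <= i <= n)%N /\ (j <= m)%N.
Proof. by lia. Qed.

Lemma leq_sub_gap i j n : (i <= n)%N -> (j <= i)%N -> (j <= n - (i - j))%N.
Proof. by lia. Qed.

Lemma no_gap m n : (2 * m <= n)%N -> (n <= m)%N -> n = 0%N.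
Proof. by lia. Qed.

Section walk_bound.
Context {R : realType}.
Variables (s1 s2 x1 x2 : nat -> Plane R) (mu1 mu2 e : Plane R).
Variables (n m : nat) (rho rho' O M a : R).
Hypotheses (sE1 : forall j, s1 j = scale2 j%:R mu1 + x1 j)
           (sE2 : forall j, s2 j = scale2 j%:R mu2 + x2 j).
Hypotheses (e1 : norm2 e = 1) (rho'0 : 0 <= rho') (rho'rho : rho' < rho).
Hypotheses (n0 : (0 < n)%N) (mn : (2 * m <= n)%N).
Hypotheses (M1 : forall j, (j <= n)%N -> norm2 (x1 j) <= M)
           (M2 : forall j, (j <= n)%N -> norm2 (x2 j) <= M).
Hypotheses (O1 : forall j, (j <= m)%N -> norm2 (x1 j) <= O)
           (O2 : forall j, (j <= m)%N -> norm2 (x2 j) <= O).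
Hypotheses (E1 : forall j, (n - m <= j <= n)%N -> norm2 (x1 j - x1 n) <= O)
           (E2 : forall j, (n - m <= j <= n)%N -> norm2 (x2 j - x2 n) <= O).
Hypotheses (a0 : 0 <= a) (am : 2 * a <= (rho - rho') * m%:R).

(* The terms stem from the oscillation of the fluctuations near the times 0 and
   n, from their second-order contribution, and from the event that they
   exceed a. *)
Definition walk_error : R :=
  2 * O + 4 * a ^+ 2 / (n%:R * rho) + 4 * excess a (2 * M).

Let O0 : 0 <= O. Proof. exact: le_trans (norm2_ge0 _) (O1 (leq0n m)). Qed.
Let M0 : 0 <= M. Proof. exact: le_trans (norm2_ge0 _) (M1 (leq0n n)). Qed.
Let nR : 0 < n%:R :> R. Proof. by rewrite ltr0n. Qed.
Let mR : 0 <= m%:R :> R. Proof. by []. Qed.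
Let mnR : 2 * m%:R <= n%:R :> R. Proof. by rewrite -natrM ler_nat. Qed.

(** [p] counts the steps that contribute the extremal drift. The factors 2 arise because [y] and [x]
    may be differences of two fluctuations. *)
Let pair y (p : nat) w v x : v = scale2 (p%:R * rho) e + w + y -> (p <= n)%N ->
  norm2 w <= (n - p)%:R * rho' -> norm2 x <= 2 * M -> norm2 y <= 2 * M ->
  ((n <= p + m)%N -> norm2 (y - x) <= 2 * O) ->
  norm2 v <= n%:R * rho + dot2 x e + walk_error.
Proof.
move=> vE pn wn xM yM yx.
apply: (pair_bound vE e1 rho'0 rho'rho _ _ nR mR mnR _ xM yM _ _ a0 am) => //.
- by rewrite ler_nat.
- by rewrite -natrB.
- by rewrite mulr_ge0.
- by rewrite lerBlDl -natrD ler_nat.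
Qed.

(** The case [p = 0], of pairs that never gain the extremal drift; they cannot be near the extremal
    pair because [2 * m <= n] and [n] is positive. *)
Let pair0 y w v x : v = w + y ->
  norm2 w <= n%:R * rho' -> norm2 x <= 2 * M -> norm2 y <= 2 * M ->
  norm2 v <= n%:R * rho + dot2 x e + walk_error.
Proof.
move=> vE wn xM yM; apply: (pair (y := y) (p := 0) (w := w)) => //.
- rewrite vE mul0r; congr (_ + _); rewrite -[LHS]add0r; congr (_ + _).
  by apply/pair_equal_spec; rewrite !mul0r.
- by rewrite subn0.
- by rewrite add0n => /(no_gap mn) n00; move: n0; rewrite n00.
Qed.

Let dist2M y z : norm2 y <= M -> norm2 z <= M -> norm2 (y - z) <= 2 * M.
Proof.
move=> yM zM; apply: (le_trans (norm2B _ _)).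
by rewrite mulr_natl mulr2n lerD.
Qed.

Let same mu i j : norm2 mu <= rho' -> (i <= n)%N -> (j <= n)%N ->
  norm2 (scale2 (i%:R - j%:R) mu) <= n%:R * rho'.
Proof.
move=> mur ni nj; rewrite norm2_scale; apply: ler_pM => //; first exact: norm2_ge0.
have : i%:R <= n%:R :> R by rewrite ler_nat.
have : j%:R <= n%:R :> R by rewrite ler_nat.
have : 0 <= i%:R :> R by []. have : 0 <= j%:R :> R by [].
by rewrite ler_norml => *; apply/andP; split; lra.
Qed.

Let osc2 y z y' z' : norm2 (y - y') <= O -> norm2 (z - z') <= O ->
  norm2 (y - z - (y' - z')) <= 2 * O.
Proof.
move=> h1 h2; rewrite (_ : _ - _ = (y - y') - (z - z')); last first.
  by rewrite !opprD !opprK addrACA.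
by apply: (le_trans (norm2B _ _)); rewrite mulr_natl mulr2n lerD.
Qed.

(** For points on different walks, [p] is the smaller of the two times; the surplus time moves with
    the drift of one walk, at most [rho'] per step. A near pair has both times within [m] of [n]. *)
Lemma walk_bound_difference i j : mu1 - mu2 = scale2 rho e ->
  norm2 mu1 <= rho' -> norm2 mu2 <= rho' -> (i <= n)%N -> (j <= n)%N ->
  let b := n%:R * rho + dot2 (x1 n - x2 n) e + walk_error in
  [/\ norm2 (s1 i - s1 j) <= b, norm2 (s1 i - s2 j) <= b
    & norm2 (s2 i - s2 j) <= b].
Proof.
move=> mue m1 m2 ni nj b.
have xn : norm2 (x1 n - x2 n) <= 2 * M by apply: dist2M; [exact: M1|exact: M2].
have mE : mu2 = mu1 - scale2 rho e by rewrite -mue opprB addrC subrK.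
split.
- apply: (pair0 (y := x1 i - x1 j) (w := scale2 (i%:R - j%:R) mu1)) => //.
  + by rewrite !sE1; apply/pair_equal_spec; split; rewrite /=; ring.
  + exact: same.
  + by apply: dist2M; exact: M1.
- have yM : norm2 (x1 i - x2 j) <= 2 * M by apply: dist2M; [exact: M1|exact: M2].
  have [ji|ij] := leqP j i.
    apply: (pair (y := x1 i - x2 j) (p := j) (w := scale2 (i - j)%:R mu1)) => //.
    + by rewrite sE1 sE2 mE natrB//; apply/pair_equal_spec; split; rewrite /=; ring.
    + rewrite norm2_scale ger0_norm//; apply: ler_pM => //; first exact: norm2_ge0.
      by rewrite ler_nat leq_sub2r.
    + by move=> /(near_end ni ji)[? ?]; apply: osc2; [exact: E1|exact: E2].
  apply: (pair (y := x1 i - x2 j) (p := i) (w := scale2 (- (j - i)%:R) mu2)) => //.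
  + rewrite sE1 sE2 (_ : mu1 = mu2 + scale2 rho e); last by rewrite mE subrK.
    rewrite natrB ?(ltnW ij)//.
    by apply/pair_equal_spec; split; rewrite /=; ring.
  + rewrite norm2_scale normrN ger0_norm//; apply: ler_pM => //; first exact: norm2_ge0.
    by rewrite ler_nat leq_sub2r.
  + by move=> /(near_end nj (ltnW ij))[? ?]; apply: osc2; [exact: E1|exact: E2].
- apply: (pair0 (y := x2 i - x2 j) (w := scale2 (i%:R - j%:R) mu2)) => //.
  + by rewrite !sE2; apply/pair_equal_spec; split; rewrite /=; ring.
  + exact: same.
  + by apply: dist2M; exact: M2.
Qed.

(** As i mu1 - j mu2 = (i - j) mu1 + j (mu1 - mu2), here [p = i - j] when [j <= i]. A near pair has
    [i] close to [n] and [j] close to 0, so the oscillations at the start matter too. For i < j the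
    mean is i (mu1 - mu2) - (j - i) mu2, no longer than [j * rho'], and [p = 0]. *)
Lemma walk_bound_single i j : mu1 = scale2 rho e ->
  norm2 mu2 <= rho' -> norm2 (mu1 - mu2) <= rho' -> (i <= n)%N -> (j <= n)%N ->
  let b := n%:R * rho + dot2 (x1 n) e + walk_error in
  [/\ norm2 (s1 i - s1 j) <= b, norm2 (s1 i - s2 j) <= b
    & norm2 (s2 i - s2 j) <= b].
Proof.
move=> mue m2 m12 ni nj b.
have xn : norm2 (x1 n) <= 2 * M.
  by apply: (le_trans (M1 (leqnn n))); rewrite mulr_natl mulr2n lerDl.
have osc y z : norm2 (y - x1 n) <= O -> norm2 z <= O -> norm2 (y - z - x1 n) <= 2 * O.
  move=> h1 h2; rewrite addrAC; apply: (le_trans (norm2B _ _)).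
  by rewrite mulr_natl mulr2n lerD.
have s11 k l : (k <= n)%N -> (l <= k)%N -> norm2 (s1 k - s1 l) <= b.
  move=> nk lk; have nl := leq_trans lk nk.
  apply: (pair (y := x1 k - x1 l) (p := (k - l)%N) (w := scale2 0 mu1)) => //.
  + rewrite !sE1 natrB// mue.
    by apply/pair_equal_spec; split; rewrite /=; ring.
  + by rewrite (leq_trans (leq_subr _ _)).
  + by rewrite norm2_scale normr0 mul0r mulr_ge0.
  + by apply: dist2M; exact: M1.
  + by move=> /(near_gap nk lk)[? ?]; apply: osc; [exact: E1|exact: O1].
split.
- have [ji|ij] := leqP j i; first exact: s11.
  by rewrite norm2_distC; apply: s11 => //; exact: ltnW.
- have yM : norm2 (x1 i - x2 j) <= 2 * M by apply: dist2M; [exact: M1|exact: M2].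
  have [ji|ij] := leqP j i.
    apply: (pair (y := x1 i - x2 j) (p := (i - j)%N) (w := scale2 j%:R (mu1 - mu2))) => //.
    + rewrite sE1 sE2 mue natrB//.
      by apply/pair_equal_spec; split; rewrite /=; ring.
    + by rewrite (leq_trans (leq_subr _ _)).
    + rewrite norm2_scale ger0_norm//; apply: ler_pM => //; first exact: norm2_ge0.
      by rewrite ler_nat; exact: leq_sub_gap.
    + by move=> /(near_gap ni ji)[? ?]; apply: osc; [exact: E1|exact: O2].
  apply: (pair0 (y := x1 i - x2 j)
    (w := scale2 i%:R (mu1 - mu2) + scale2 (- (j - i)%:R) mu2)) => //.
  + rewrite sE1 sE2 natrB ?(ltnW ij)//.
    by apply/pair_equal_spec; split; rewrite /=; ring.
  + apply: (le_trans (norm2D _ _)); rewrite !norm2_scale normrN !ger0_norm//.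
    apply: (@le_trans _ _ (j%:R * rho')); last by rewrite ler_wpM2r// ler_nat.
    rewrite -[in leRHS](subnKC (ltnW ij)) natrD mulrDl.
    by apply: lerD; apply: ler_wpM2l.
- apply: (pair0 (y := x2 i - x2 j) (w := scale2 (i%:R - j%:R) mu2)) => //.
  + by rewrite !sE2; apply/pair_equal_spec; split; rewrite /=; ring.
  + exact: same.
  + by apply: dist2M; exact: M2.
Qed.

End walk_bound.

(** * Fluctuations of the two walks *)

Section oscillation.
Context d (T : measurableType d) (R : realType) (P : probability T R).
Variables (G : nat -> set (set T)) (W : nat -> T -> R).
Hypothesis GW : innovations P G W.

Local Notation Ex := (Rintegral P setT).
Local Notation L1 X := (P.-integrable setT (EFin \o X)).
Local Notation L2 := (sq_integrable P).

Let var := Ex (fun w => W 0%N w ^+ 2).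

Definition osc_start m w := runmax (fun j => `|psum W j w|) m.
Definition osc_end n m w :=
  runmax (fun j => `|psum W (n - m + j) w - psum W (n - m) w|) m.
Definition osc_excess (b : R) n w := runmax (fun j => excess b (psum W j w)) n.
(** The weights come from [walk_error]: [O] has factor 2 and will contain [osc_start] once and
    [osc_end] twice; the excess has factor 4 and is taken at [2 * M], where [M] contains
    [osc_excess] once. *)
Definition osc n m (b : R) w :=
  2 * osc_start m w + 4 * osc_end n m w + 8 * osc_excess b n w.

Lemma osc_startP m j w : (j <= m)%N -> `|psum W j w| <= osc_start m w.
Proof. exact: (@runmax_ge _ (fun j => `|psum W j w|)). Qed.

(** Doob's inequality measures from the time [n - m]; comparing with time [n] through it costs the
    factor 2. *)
Lemma osc_endP n m j w : (m <= n)%N -> (n - m <= j <= n)%N ->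
  `|psum W j w - psum W n w| <= 2 * osc_end n m w.
Proof.
move=> mn /andP[nj jn].
have h k : (k <= m)%N -> `|psum W (n - m + k) w - psum W (n - m) w| <= osc_end n m w.
  exact: (@runmax_ge _ (fun k => `|psum W (n - m + k) w - psum W (n - m) w|)).
have := h (j - (n - m))%N; rewrite subnKC// leq_subLR subnK// => /(_ jn) h1.
have := h m (leqnn m); rewrite subnK// => h2.
rewrite (_ : _ - _ = (psum W j w - psum W (n - m) w)
  - (psum W n w - psum W (n - m) w)); last by ring.
by apply: (le_trans (ler_normB _ _)); rewrite mulr_natl mulr2n lerD.
Qed.

Lemma osc_excessP (b : R) n j w : (j <= n)%N -> `|psum W j w| <= b + osc_excess b n w.
Proof.
move=> jn; rewrite -lerBlDl.
apply: le_trans (@runmax_ge _ (fun j => excess b (psum W j w)) _ _ jn).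
by rewrite /excess le_max lexx orbT.
Qed.

Lemma osc_start_ge0 m w : 0 <= osc_start m w.
Proof. by apply: runmax_ge0 => j; exact: normr_ge0. Qed.

Lemma osc_end_ge0 n m w : 0 <= osc_end n m w.
Proof. by apply: runmax_ge0 => j; exact: normr_ge0. Qed.

Lemma osc_excess_ge0 b n w : 0 <= osc_excess b n w.
Proof. by apply: runmax_ge0 => j; exact: excess_ge0. Qed.

Let start_L2 m : L2 (osc_start m).
Proof.
by apply: (runmax_L2 (X := fun j w => `|psum W j w|)) => j _;
  exact: L2_norm (psum_L2 GW j).
Qed.

Let end_L2 n m : L2 (osc_end n m).
Proof.
apply: (runmax_L2 (X := fun j w => `|psum W (n - m + j) w - psum W (n - m) w|)) => j _.
exact: L2_norm (L2B (psum_L2 GW _) (psum_L2 GW _)).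
Qed.

Let excess_L2' (b : R) n : 0 <= b -> L2 (osc_excess b n).
Proof.
move=> b0; apply: (runmax_L2 (X := fun j w => excess b (psum W j w))) => j _.
exact: excess_L2 b0 (psum_L2 GW j).
Qed.

Lemma osc_L2 n m (b : R) : 0 <= b -> L2 (osc n m b).
Proof. by move=> b0; apply: L2D (L2Z _ (excess_L2' _ b0)); apply: L2D; exact: L2Z. Qed.

Lemma sqr_sum3 (x y z : R) :
  (2 * x + 4 * y + 8 * z) ^+ 2 <= 12 * x ^+ 2 + 48 * y ^+ 2 + 192 * z ^+ 2.
Proof.
have h1 := sqr_ge0 (2 * x - 4 * y); have h2 := sqr_ge0 (2 * x - 8 * z).
by have h3 := sqr_ge0 (4 * y - 8 * z); lra.
Qed.

Lemma Ex_osc n m (b : R) : 0 <= b -> Ex (fun w => osc n m b w ^+ 2)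
  <= 240 * (m%:R * var) + 768 * Ex (fun w => excess b (psum W n w) ^+ 2).
Proof.
move=> b0.
have [_ i1] := start_L2 m; have [_ i2] := end_L2 n m; have [_ i3] := excess_L2' n b0.
have [_ i] := osc_L2 n m b0.
have p0 w : psum W 0 w = 0 by rewrite /psum big_ord0.
have e1 : Ex (fun w => osc_start m w ^+ 2) <= 4 * (m%:R * var).
  have := doob_norm GW 0 m.
  rewrite (_ : (fun w => _) = (fun w => osc_start m w ^+ 2)) //.
  apply/funext => w; congr (_ ^+ 2); congr (runmax _ _); apply/funext => j.
  by rewrite add0n p0 subr0.
have e2 : Ex (fun w => osc_end n m w ^+ 2) <= 4 * (m%:R * var).
  exact: (doob_norm GW (n - m)%N m).
have e3 : Ex (fun w => osc_excess b n w ^+ 2)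
    <= 4 * Ex (fun w => excess b (psum W n w) ^+ 2).
  have := doob_excess GW 0 n b0.
  rewrite (_ : (fun w => runmax _ _ ^+ 2) = (fun w => osc_excess b n w ^+ 2)).
    rewrite (_ : (fun w => excess _ _ ^+ 2) = (fun w => excess b (psum W n w) ^+ 2))//.
    by apply/funext => w; rewrite add0n p0 subr0.
  apply/funext => w; congr (_ ^+ 2); congr (runmax _ _); apply/funext => j.
  by rewrite add0n p0 subr0.
(* With Doob's factor 4 the constants are 4 * (12 + 48) = 240 and 4 * 192 = 768. *)
have := Ex_le i (L1D (L1D (L1Z 12 i1) (L1Z 48 i2)) (L1Z 192 i3))
  (fun w => sqr_sum3 _ _ _).
rewrite (ExD (L1D (L1Z 12 i1) (L1Z 48 i2)) (L1Z 192 i3)).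
rewrite (ExD (L1Z 12 i1) (L1Z 48 i2)) !ExZ//.
move: e1 e2 e3.
move: (Ex (fun w => osc_start m w ^+ 2)) (Ex (fun w => osc_end n m w ^+ 2)).
move: (Ex (fun w => osc_excess b n w ^+ 2)) (m%:R * var).
move: (Ex (fun w => excess b (psum W n w) ^+ 2)) (Ex (fun w => osc n m b w ^+ 2)).
by clear; move=> *; lra.
Qed.

Lemma le_excess (a b y : R) : a <= b -> excess b y <= excess a y.
Proof.
move=> ab; rewrite /excess ge_max !le_max lexx/=.
by apply/orP; right; rewrite lerD2l lerN2.
Qed.

Lemma osc_arith (e p q r : R) : p <= e / 1536 * r -> 480 * q <= e * r ->
  240 * q + 768 * p <= e * r.
Proof. by move=> *; lra. Qed.

(** Each term of [Ex_osc] receives half of [e]: 768 * e / 1536 = e / 2, and blocks of length at most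
    n / k with k >= 480 var / e give the other half. Larger [A'] and [k] are allowed so that four
    coordinates can share them. *)
Lemma osc_small (e : R) : 0 < e -> exists A k0, [/\ 0 < A, (0 < k0)%N &
  forall A' k, A <= A' -> (k0 <= k)%N -> \forall n \near \oo,
    Ex (fun w => osc n (n %/ k) (A' * Num.sqrt n%:R) w ^+ 2) <= e * n%:R].
Proof.
move=> e0; have v0 : 0 <= var by apply: Ex_ge0 => w; exact: sqr_ge0.
have e'0 : 0 < e / 1536 := divr_gt0 e0 (ltr0n R 1536).
have [A A0 hA] := Ex_excess_small GW e'0.
have x0 : 0 <= 480 * var / e.
  by apply: divr_ge0; [apply: mulr_ge0; [exact: ler0n|exact: v0]|exact: ltW].
pose k0 := Num.bound (480 * var / e).
have hk0 : 480 * var / e < k0%:R by exact: archi_boundP.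
have k00 : (0 < k0)%N by rewrite -(ltr0n R); exact: le_lt_trans hk0.
exists A, k0; split => // A' k AA' k0k.
move: hA; apply: filterS => n hn.
have b0 : 0 <= A' * Num.sqrt n%:R.
  by apply: mulr_ge0; [exact: le_trans (ltW A0) AA'|exact: sqrtr_ge0].
have bb : A * Num.sqrt n%:R <= A' * Num.sqrt n%:R.
  by apply: ler_wpM2r => //; exact: sqrtr_ge0.
have b0' : 0 <= A * Num.sqrt n%:R by rewrite mulr_ge0 ?sqrtr_ge0// ltW.
apply: (le_trans (Ex_osc n (n %/ k) b0)).
have h1 : Ex (fun w => excess (A' * Num.sqrt n%:R) (psum W n w) ^+ 2)
    <= e / 1536 * n%:R.
  apply: le_trans hn; apply: Ex_le.
  - by have [_] := excess_L2 b0 (psum_L2 GW n).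
  - by have [_] := excess_L2 b0' (psum_L2 GW n).
  by move=> w; rewrite lerXn2r ?nnegrE ?excess_ge0//; exact: le_excess.
have h2 : (n %/ k)%:R * k%:R <= n%:R :> R by rewrite -natrM ler_nat leq_divM.
have h3 : 480 * var <= e * k%:R.
  rewrite [leRHS]mulrC -ler_pdivrMr//; apply: (le_trans (ltW hk0)).
  by rewrite ler_nat.
have h4 : 480 * ((n %/ k)%:R * var) <= e * n%:R.
  rewrite mulrCA; apply: (@le_trans _ _ ((n %/ k)%:R * (e * k%:R))).
    exact: ler_wpM2l.
  by rewrite mulrCA; apply: ler_wpM2l => //; exact: ltW.
exact: osc_arith h1 h4.
Qed.

End oscillation.

(** * Independence of an increment from the joint past *)

Section independence.
Context d (T : measurableType d) (R : realType) (P : probability T R).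

(* Dynkin: two finite measures that agree on a pi-system agree on the
   sigma-algebra it generates. *)
Lemma indep_generated (H : set (set T)) (A : set T) :
  measurable A -> H `<=` measurable -> setI_closed H -> H setT ->
  (forall B, H B -> P (A `&` B) = P A * P B)%E ->
  forall B, <<s H >> B -> (P (A `&` B) = P A * P B)%E.
Proof.
move=> mA Hm HI HT HP B HB.
pose r : {nonneg R} := NngNum (fine_ge0 (measure_ge0 P A)).
have rE : (r%:num%:E = P A)%E by rewrite fineK// fin_num_measure.
have cover : \bigcup_(k : nat) (setT : set T) = setT.
  by apply/seteqP; split => // w _; exists 0%N.
have agree C : H C -> mrestr P mA C = mscale r P C.
  by move=> HC; rewrite /mrestr /mscale setIC rE; exact: HP.
have fin (k : nat) : (mrestr P mA setT < +oo)%E.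
  by rewrite /mrestr setTI ltey_eq fin_num_measure.
have : mrestr P mA B = mscale r P B.
  exact: (g_sigma_algebra_measure_unique H Hm (fun=> setT) (fun=> HT) cover
    (mrestr P mA) (mscale r P) HI agree fin B HB).
by rewrite /mrestr /mscale rE setIC.
Qed.

Variables (Z1 Z2 : nat -> {RV P >-> (R * R)%type}).
Hypotheses (iid1 : iid Z1) (iid2 : iid Z2) (indep12 : independent_families Z1 Z2).

Local Notation plane := (R * R)%type.

(** Generated by both sequences, since the increments of interest may combine [Z1 i] and [Z2 i]; the
    strict inequality leaves step [i] itself out. *)
Definition past i : set (set T) := [set C | exists j, (j < i)%N /\
  exists2 A, measurable A & C = Z1 j @^-1` A \/ C = Z2 j @^-1` A].

Let rect i (A B : nat -> set plane) : set T :=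
  (\bigcap_(j in [set` iota 0 i]) (Z1 j @^-1` A j)) `&`
  (\bigcap_(j in [set` iota 0 i]) (Z2 j @^-1` B j)).

(** A pi-system containing the generators in [past i], which need not be stable under
    intersection. *)
Let rects i : set (set T) := [set C | exists A B,
  [/\ forall j, measurable (A j), forall j, measurable (B j) & C = rect i A B]].

Let mZ1 j A : measurable A -> measurable (Z1 j @^-1` A).
Proof. by move=> mA; rewrite -[X in measurable X]setTI; exact: measurable_funP. Qed.

Let mZ2 j A : measurable A -> measurable (Z2 j @^-1` A).
Proof. by move=> mA; rewrite -[X in measurable X]setTI; exact: measurable_funP. Qed.

Let P_rect i A B : (forall j, measurable (A j)) -> (forall j, measurable (B j)) ->
  P (rect i A B) = (\prod_(j <- iota 0 i) P (Z1 j @^-1` A j) *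
                    \prod_(j <- iota 0 i) P (Z2 j @^-1` B j))%E.
Proof.
move=> mA mB; rewrite /rect indep12; first last.
- pose V : measurableType _ := g_sigma_algebraType
    (\bigcup_j preimage_set_system setT (Z2 j) measurable).
  suff : measurable (\bigcap_(j in [set` iota 0 i]) (Z2 j @^-1` B j) : set V) by [].
  apply: bigcap_measurableType => j _; apply: sub_sigma_algebra; exists j => //.
  by exists (B j) => //; rewrite setTI.
- pose V : measurableType _ := g_sigma_algebraType
    (\bigcup_j preimage_set_system setT (Z1 j) measurable).
  suff : measurable (\bigcap_(j in [set` iota 0 i]) (Z1 j @^-1` A j) : set V) by [].
  apply: bigcap_measurableType => j _; apply: sub_sigma_algebra; exists j => //.
  by exists (A j) => //; rewrite setTI.
by rewrite (iid1.1 _ _ (iota_uniq 0 i) mA) (iid2.1 _ _ (iota_uniq 0 i) mB).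
Qed.

Let P_one i A B : measurable A -> measurable B ->
  P (Z1 i @^-1` A `&` Z2 i @^-1` B) = (P (Z1 i @^-1` A) * P (Z2 i @^-1` B))%E.
Proof.
move=> mA mB; apply: indep12.
- by apply: sub_sigma_algebra; exists i => //; exists A => //; rewrite setTI.
- by apply: sub_sigma_algebra; exists i => //; exists B => //; rewrite setTI.
Qed.

Let rectS i A B : rect i.+1 A B =
  rect i A B `&` (Z1 i @^-1` A i `&` Z2 i @^-1` B i).
Proof.
rewrite /rect -addn1 iotaD/= add0n.
have bE (F : nat -> set T) : \bigcap_(j in [set` iota 0 i ++ [:: i]]) F j
    = (\bigcap_(j in [set` iota 0 i]) F j) `&` F i.
  apply/seteqP; split => [w Fw|w [Fw Fi] j /=].
    split; first by move=> j ij; apply: Fw; rewrite /= mem_cat ij.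
    by apply: Fw; rewrite /= mem_cat mem_head orbT.
  by rewrite mem_cat inE => /orP[/Fw//|/eqP ->].
by rewrite !bE setIACA.
Qed.

Let rect_eq i A B A' B' : (forall j, (j < i)%N -> A j = A' j) ->
  (forall j, (j < i)%N -> B j = B' j) -> rect i A B = rect i A' B'.
Proof.
move=> AA BB; congr (_ `&` _); apply: eq_bigcapr => j /=;
  by rewrite mem_iota add0n => /= ji; rewrite ?AA ?BB.
Qed.

Let rects_measurable i : rects i `<=` measurable.
Proof.
move=> _ [A [B [mA mB ->]]]; apply: measurableI; apply: bigcap_measurableType => j _.
- exact: mZ1.
- exact: mZ2.
Qed.

Let rects_setI i : setI_closed (rects i).
Proof.
move=> _ _ [A [B [mA mB ->]]] [A' [B' [mA' mB' ->]]].
exists (fun j => A j `&` A' j), (fun j => B j `&` B' j); split.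
- by move=> j; exact: measurableI.
- by move=> j; exact: measurableI.
- by rewrite /rect setIACA -!bigcapI.
Qed.

Let rectsT i : rects i setT.
Proof.
exists (fun=> setT), (fun=> setT); split => //.
by apply/seteqP; split => // w _; split.
Qed.

Let pairs i : set (set T) := [set C | exists A B,
  [/\ measurable A, measurable B & C = Z1 i @^-1` A `&` Z2 i @^-1` B]].

Let pairs_measurable i : pairs i `<=` measurable.
Proof. by move=> _ [A [B [mA mB ->]]]; apply: measurableI; [exact: mZ1|exact: mZ2]. Qed.

Let pairs_setI i : setI_closed (pairs i).
Proof.
move=> _ _ [A [B [mA mB ->]]] [A' [B' [mA' mB' ->]]].
exists (A `&` A'), (B `&` B'); split; [exact: measurableI|exact: measurableI|].
by rewrite setIACA !preimage_setI.
Qed.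

Let pairsT i : pairs i setT.
Proof. by exists setT, setT; split => //; rewrite !preimage_setT setTI. Qed.

Let rects_pairs i C D : rects i C -> pairs i D -> P (C `&` D) = (P C * P D)%E.
Proof.
move=> [A [B [mA mB ->]]] [A' [B' [mA' mB' ->]]].
(* Placing the event of step [i] at index [i] turns the intersection into a rectangle over [i.+1]
   steps, whose probability is a product. *)
pose A1 j := if j == i then A' else A j.
pose B1 j := if j == i then B' else B j.
have mA1 j : measurable (A1 j) by rewrite /A1; case: ifP.
have mB1 j : measurable (B1 j) by rewrite /B1; case: ifP.
have E j : (j < i)%N -> (j == i) = false by move=> ji; rewrite ltn_eqF.
have rE : rect i A B = rect i A1 B1.
  by apply: rect_eq => j ji; rewrite /A1 /B1 E.
have -> : A' = A1 i by rewrite /A1 eqxx.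
have -> : B' = B1 i by rewrite /B1 eqxx.
rewrite rE -rectS P_rect// P_rect// P_one// -addn1 iotaD/= add0n.
by rewrite !big_cat/= !big_seq1 muleACA.
Qed.

Let U i w : plane * plane := (Z1 i w, Z2 i w).

Let mU i : measurable_fun setT (U i).
Proof. exact: measurable_fun_pair. Qed.

Let pairs_U i E : measurable E -> <<s pairs i >> (U i @^-1` E).
Proof.
move=> mE; pose V : measurableType _ := g_sigma_algebraType (pairs i).
suff mUV : measurable_fun (setT : set V) (U i).
  by have := mUV measurableT E mE; rewrite setTI.
apply: measurable_fun_pair => _ A mA; rewrite setTI; apply: sub_sigma_algebra.
- by exists A, setT; split => //; rewrite preimage_setT setIT.
- by exists setT, A; split => //; rewrite preimage_setT setTI.
Qed.

Let past_rects i : past i `<=` rects i.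
Proof.
move=> C [j [ji [A mA CE]]].
pose F k := if k == j then A else setT.
have mF k : measurable (F k) by rewrite /F; case: ifP.
have FE (Z : nat -> {RV P >-> plane}) :
    \bigcap_(k in [set` iota 0 i]) (Z k @^-1` F k) = Z j @^-1` A.
  apply/seteqP; split => [w Fw|w Zw k _]; last by rewrite /F /=; case: eqP => [->|].
  by have := Fw j; rewrite /= /F eqxx mem_iota; apply.
have TE (Z : nat -> {RV P >-> plane}) :
    \bigcap_(k in [set` iota 0 i]) (Z k @^-1` setT) = setT.
  by apply/seteqP; split.
case: CE => ->.
- by exists F, (fun=> setT); split => //; rewrite /rect FE TE setIT.
- by exists (fun=> setT), F; split => //; rewrite /rect FE TE setTI.
Qed.

(** [indep_generated] is used twice: for a fixed rectangle it passes from [pairs i] to all events of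
    the pair, then for a fixed such event from [rects i] to the whole past. *)
Let U_indep i C E : <<s past i >> C -> measurable E ->
  P (C `&` U i @^-1` E) = (P C * P (U i @^-1` E))%E.
Proof.
move=> pC mE.
have rC : <<s rects i >> C.
  move: C pC; apply: smallest_sub; first exact: smallest_sigma_algebra.
  by move=> D pD; apply: sub_sigma_algebra; exact: past_rects.
have mUE : measurable (U i @^-1` E).
  by rewrite -[X in measurable X]setTI; exact: mU.
rewrite setIC muleC; apply: (indep_generated mUE (@rects_measurable i)
  (@rects_setI i) (rectsT i) _ rC) => D rD.
rewrite setIC muleC. have HP F : pairs i F -> P (D `&` F) = (P D * P F)%E by exact: rects_pairs.
exact: (indep_generated (rects_measurable rD) (@pairs_measurable i)
  (@pairs_setI i) (pairsT i) HP (pairs_U mE)).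
Qed.

(** [iid] compares the marginals; by independence of the two sequences the joint laws agree on
    products of sets, which form a generating pi-system. *)
Let U_ident i E : measurable E -> P (U i @^-1` E) = P (U 0%N @^-1` E).
Proof.
move=> mE.
have mfU j : U j \in mfun by rewrite inE; exact: mU.
pose m j := distribution P (mfun_Sub (mfU j)).
rewrite -[LHS]/(m i E) -[RHS]/(m 0%N E).
pose C : set (set (plane * plane)) :=
  [set A `*` B | A in measurable & B in measurable].
have cover : \bigcup_(k : nat) (setT : set (plane * plane)) = setT.
  by apply/seteqP; split => // w _; exists 0%N.
apply: (measure_unique C (fun=> setT) _ _ _ cover) => //.
- exact: measurable_prod_measurableType.
- move=> _ _ [A mA [B mB <-]] [A' mA' [B' mB' <-]].
  exists (A `&` A'); first exact: measurableI.
  by exists (B `&` B'); [exact: measurableI|rewrite setXI].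
- by move=> k; exists setT => //; exists setT => //; rewrite setXTT.
- move=> _ [A mA [B mB <-]].
  transitivity (P (Z1 i @^-1` A `&` Z2 i @^-1` B)); first by [].
  transitivity (P (Z1 0%N @^-1` A `&` Z2 0%N @^-1` B)); last by [].
  by rewrite !P_one//; congr (_ * _)%E; [exact: iid1.2|exact: iid2.2].
- by move=> k; rewrite ltey_eq fin_num_measure.
Qed.

Lemma innovations_pair (f : plane * plane -> R) : measurable_fun setT f ->
  P.-integrable setT (EFin \o (fun w => f (Z1 0%N w, Z2 0%N w) ^+ 2)) ->
  Rintegral P setT (fun w => f (Z1 0%N w, Z2 0%N w)) = 0 ->
  innovations P past (fun i w => f (Z1 i w, Z2 i w)).
Proof.
move=> mf if2 if0; split => //.
- move=> i C /past_rects; exact: rects_measurable.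
- move=> i C [j [ji h]]; exists j; split => //; exact: ltnW.
- move=> i; pose V : measurableType _ := g_sigma_algebraType (past i.+1).
  have mUV : measurable_fun (setT : set V) (U i).
    apply: measurable_fun_pair => _ A mA; rewrite setTI; apply: sub_sigma_algebra.
      by exists i; split => //; exists A => //; left.
    by exists i; split => //; exists A => //; right.
  exact: (measurableT_comp mf mUV).
- move=> i A B pA mB; have mfB : measurable (f @^-1` B).
    by rewrite -[X in measurable X]setTI; exact: mf.
  exact: (U_indep pA mfB).
- move=> i B mB; have mfB : measurable (f @^-1` B).
    by rewrite -[X in measurable X]setTI; exact: mf.
  exact: (U_ident i mfB).
Qed.

End independence.

(** * The error term in mean square *)

Lemma sqrtn_ge (R : realType) (c : R) : \forall n \near \oo, c <= Num.sqrt n%:R.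
Proof.
near=> n; apply: (le_trans (ler_norm c)); rewrite -sqrtr_sqr.
by apply: ler_wsqrtr; near: n; exact: nbhs_infty_ger.
Unshelve. all: by end_near. Qed.

Lemma sqr_sum5 (R : realDomainType) (a b c d k : R) :
  (a + b + c + d + k) ^+ 2 <= 5 * (a ^+ 2 + b ^+ 2 + c ^+ 2 + d ^+ 2 + k ^+ 2).
Proof.
have h1 := sqr_ge0 (a - b); have h2 := sqr_ge0 (a - c); have h3 := sqr_ge0 (a - d).
have h4 := sqr_ge0 (a - k); have h5 := sqr_ge0 (b - c); have h6 := sqr_ge0 (b - d).
have h7 := sqr_ge0 (b - k); have h8 := sqr_ge0 (c - d); have h9 := sqr_ge0 (c - k).
by have h10 := sqr_ge0 (d - k); lra.
Qed.

Lemma excess_shift (R : realFieldType) (c y : R) : 0 <= c -> 0 <= y ->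
  excess (8 * c) (2 * (4 * c + y)) = 2 * y.
Proof.
move=> c0 y0; rewrite /excess ger0_norm; last by lra.
by rewrite /Num.max; case: ifP => h; lra.
Qed.

Lemma four_sum (R : realFieldType) (b y1 y2 y3 y4 : R) : 0 <= b ->
  0 <= y1 -> 0 <= y2 -> 0 <= y3 -> 0 <= y4 ->
  b + y1 + (b + y2) <= 4 * b + (y1 + y2 + y3 + y4) /\
  b + y3 + (b + y4) <= 4 * b + (y1 + y2 + y3 + y4).
Proof. by move=> *; split; lra. Qed.

Lemma eight_sum (R : realFieldType) (s1 s2 s3 s4 e1 e2 e3 e4 : R) :
  0 <= s1 -> 0 <= s2 -> 0 <= s3 -> 0 <= s4 ->
  0 <= e1 -> 0 <= e2 -> 0 <= e3 -> 0 <= e4 ->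
  let r := s1 + s2 + s3 + s4 + 2 * (e1 + e2 + e3 + e4) in
  [/\ s1 + s2 <= r, s3 + s4 <= r, 2 * e1 + 2 * e2 <= r & 2 * e3 + 2 * e4 <= r].
Proof. by move=> ? ? ? ? ? ? ? ? r; rewrite /r; split; lra. Qed.

(* With q = sqrt n, the block length m = n %/ k eventually dominates q. *)
Lemma block_length (R : realFieldType) (q A eta : R) n k :
  q ^+ 2 = n%:R -> 0 < q -> 0 < A -> 0 < eta -> (0 < k)%N ->
  (16 * A + eta) * k%:R / eta <= q -> 1 <= q ->
  2 * (8 * (A * q)) <= eta * (n %/ k)%:R.
Proof.
move=> qn q0 A0 eta0 k0; rewrite ler_pdivrMr// => hq q1.
have kR : 0 < k%:R :> R by rewrite ltr0n.
have : n%:R <= (n %/ k).+1%:R * k%:R :> R.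
  by rewrite -natrM ler_nat ltnW// ltn_ceil.
rewrite -natr1 -qn; move: (n %/ k)%:R => m hm.
rewrite -(ler_pM2r kR).
have h1 : (16 * A + eta) * k%:R * q <= q * eta * q by rewrite ler_wpM2r// ltW.
have h2 : eta * q ^+ 2 <= eta * ((m + 1) * k%:R) by rewrite ler_wpM2l// ltW.
have h3 : eta * k%:R * 1 <= eta * k%:R * q by rewrite ler_wpM2l// mulr_ge0// ltW.
lra.
Qed.

Lemma upper_bound4 (a b c d : nat) :
  exists k, [/\ 2 <= k, a <= k, b <= k, c <= k & d <= k]%N.
Proof. by exists (2 + a + b + c + d)%N; split; lia. Qed.

Lemma mul25 (R : realType) (u v : R) :
  25 * u * v = 5 * (u * v + u * v + u * v + u * v + u * v).
Proof. by ring. Qed.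

Lemma four_osc (R : realType) (s1 s2 s3 s4 e1 e2 e3 e4 x1 x2 x3 x4 K : R) :
  2 * s1 + 4 * e1 + 8 * x1 + (2 * s2 + 4 * e2 + 8 * x2) + (2 * s3 + 4 * e3 + 8 * x3)
    + (2 * s4 + 4 * e4 + 8 * x4) + K
  = 2 * (s1 + s2 + s3 + s4 + 2 * (e1 + e2 + e3 + e4)) + K
    + 4 * (2 * (x1 + x2 + x3 + x4)).
Proof. by ring. Qed.

Lemma sqr_8 (R : realType) (A q : R) :
  4 * (8 * (A * q)) ^+ 2 = 256 * A ^+ 2 * q ^+ 2.
Proof. by ring. Qed.

Lemma norm2_le_sum (R : realType) (u : Plane R) (a b c : R) :
  `|u.1| <= a -> `|u.2| <= b -> a + b <= c -> norm2 u <= c.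
Proof. by move=> ua ub; apply: le_trans (le_trans (norm2_sum u) (lerD ua ub)). Qed.

Section four_walks.
Context d (T : measurableType d) (R : realType) (P : probability T R).
Variables (G : nat -> set (set T)) (V1 V2 V3 V4 : nat -> T -> R).
Hypotheses (GV1 : innovations P G V1) (GV2 : innovations P G V2)
           (GV3 : innovations P G V3) (GV4 : innovations P G V4).

Local Notation Ex := (Rintegral P setT).
Local Notation L1 X := (P.-integrable setT (EFin \o X)).
Local Notation L2 := (sq_integrable P).

Let x1 j w : Plane R := (psum V1 j w, psum V2 j w).
Let x2 j w : Plane R := (psum V3 j w, psum V4 j w).

(** [m] and [a] are the same for all sample points, whereas [O] and [M] depend on [w]. Both are sums
    over the four coordinates, so that they bound the two planar walks simultaneously. *)
Lemma walk_error_small (rho eta e : R) : 0 < rho -> 0 < eta -> 0 < e ->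
  \forall n \near \oo, exists m a err, [/\ (0 < n)%N, (2 * m <= n)%N, 0 <= a,
    2 * a <= eta * m%:R & [/\ L2 err, Ex (fun w => err w ^+ 2) <= e * n%:R &
    forall w, exists O M, err w = walk_error n rho O M a /\
    [/\ (forall j, (j <= n)%N -> norm2 (x1 j w) <= M),
        (forall j, (j <= n)%N -> norm2 (x2 j w) <= M),
        (forall j, (j <= m)%N -> norm2 (x1 j w) <= O),
        (forall j, (j <= m)%N -> norm2 (x2 j w) <= O) &
        (forall j, (n - m <= j <= n)%N -> norm2 (x1 j w - x1 n w) <= O /\
          norm2 (x2 j w - x2 n w) <= O)]]].
Proof.
move=> rho0 eta0 e0.
(* [err] has five terms: the square of the sum costs a factor 5, and five means of at most [e' * n]
   are added. *)
pose e' := e / 25; have e'0 : 0 < e' := divr_gt0 e0 (ltr0n R 25).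
have [A1 [k1 [A10 k10 h1]]] := osc_small GV1 e'0.
have [A2 [k2 [A20 k20 h2]]] := osc_small GV2 e'0.
have [A3 [k3 [A30 k30 h3]]] := osc_small GV3 e'0.
have [A4 [k4 [A40 k40 h4]]] := osc_small GV4 e'0.
have [A [AA1 AA2 AA3 AA4]] : exists A, [/\ A1 <= A, A2 <= A, A3 <= A & A4 <= A].
  by exists (A1 + A2 + A3 + A4); split; lra.
have A0 : 0 < A := lt_le_trans A10 AA1.
have [k [k2le kk1 kk2 kk3 kk4]] := upper_bound4 k1 k2 k3 k4.
have {}h1 := h1 A k AA1 kk1; have {}h2 := h2 A k AA2 kk2.
have {}h3 := h3 A k AA3 kk3; have {}h4 := h4 A k AA4 kk4.
have k0 : (0 < k)%N := ltnW k2le.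
(* The value of 4 a^2 / (n rho) at a = 8 A sqrt n; it does not grow with n. *)
pose K := 256 * A ^+ 2 / rho.
have hK := nbhs_infty_ger (K ^+ 2 / e').
have hq := sqrtn_ge ((16 * A + eta) * k%:R / eta).
have hq1 := sqrtn_ge (1 : R).
apply: filterS2 (filterI h1 h2) (filterI h3 (filterI h4 (filterI hK (filterI hq hq1)))) => n
  [{}h1 {}h2] [{}h3 [{}h4 [{}hK [{}hq {}hq1]]]].
pose q := Num.sqrt (n%:R : R); pose m := (n %/ k)%N; pose b := A * q.
rewrite -/q -/m -/b in h1 h2 h3 h4 hq hq1.
have q0 : 0 < q := lt_le_trans ltr01 hq1.
have qn : q ^+ 2 = n%:R by rewrite sqr_sqrtr.
have n0 : (0 < n)%N by rewrite -(ltr0n R) -qn exprn_gt0.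
have b0 : 0 <= b by rewrite mulr_ge0// ltW.
have mn : (2 * m <= n)%N.
  by rewrite (leq_trans _ (leq_divM n k))// mulnC leq_mul2l k2le orbT.
have mn' : (m <= n)%N := leq_div n k.
pose err w := osc V1 n m b w + osc V2 n m b w + osc V3 n m b w + osc V4 n m b w + K.
have i1 := osc_L2 GV1 n m b0; have i2 := osc_L2 GV2 n m b0.
have i3 := osc_L2 GV3 n m b0; have i4 := osc_L2 GV4 n m b0.
have ierr : L2 err := L2D (L2D (L2D (L2D i1 i2) i3) i4) (L2_cst P K).
(* [M] will be [4 * b] plus the coordinate excesses, a level [b] for each coordinate, so the excess
   of [2 * M] over [8 * b] is exactly twice their sum. *)
exists m, (8 * b), err; split => //.
- exact: mulr_ge0.
- exact: block_length.
split => //.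
  have [[_ j1] [_ j2]] := (i1, i2); have [[_ j3] [_ j4]] := (i3, i4).
  have [_ je] := ierr.
  have jK : L1 (fun=> K ^+ 2) := L1_cst P (K ^+ 2).
  have j12 := L1D j1 j2; have j123 := L1D j12 j3; have j1234 := L1D j123 j4.
  have jall := L1D j1234 jK.
  have := Ex_le je (L1Z 5 jall) (fun w => sqr_sum5 _ _ _ _ _).
  move=> /le_trans; apply; rewrite ExZ// (ExD j1234 jK) (ExD j123 j4) (ExD j12 j3).
  rewrite (ExD j1 j2) Ex_cst.
  have {}hK : K ^+ 2 <= e' * n%:R by rewrite mulrC -ler_pdivrMr.
  have -> : e = 25 * e' by rewrite /e' mulrC divfK// pnatr_eq0.
  rewrite mul25.
  rewrite ler_wpM2l//; exact: (lerD (lerD (lerD (lerD h1 h2) h3) h4) hK).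
move=> w.
pose S V := osc_start (V : nat -> T -> R) m w.
pose E V := osc_end (V : nat -> T -> R) n m w.
pose X V := osc_excess (V : nat -> T -> R) b n w.
have S0 V : 0 <= S V := osc_start_ge0 V m w.
have E0 V : 0 <= E V := osc_end_ge0 V n m w.
have X0 V : 0 <= X V := osc_excess_ge0 V b n w.
have SP V j : (j <= m)%N -> `|psum V j w| <= S V by exact: osc_startP.
have EP V j : (n - m <= j <= n)%N -> `|psum V j w - psum V n w| <= 2 * E V.
  exact: osc_endP.
have XP V j : (j <= n)%N -> `|psum V j w| <= b + X V by exact: osc_excessP.
exists (S V1 + S V2 + S V3 + S V4 + 2 * (E V1 + E V2 + E V3 + E V4)).
exists (4 * b + (X V1 + X V2 + X V3 + X V4)); split.
  rewrite /walk_error /err /osc -/(S V1) -/(S V2) -/(S V3) -/(S V4).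
  rewrite -/(E V1) -/(E V2) -/(E V3) -/(E V4) -/(X V1) -/(X V2) -/(X V3) -/(X V4).
  have -> : 4 * (8 * b) ^+ 2 / (n%:R * rho) = K.
    rewrite -qn /b /K.
    rewrite sqr_8.
    by rewrite invfM mulrA mulfK// gt_eqF// exprn_gt0.
  have -> : excess (8 * b) (2 * (4 * b + (X V1 + X V2 + X V3 + X V4)))
      = 2 * (X V1 + X V2 + X V3 + X V4).
    by apply: excess_shift => //; rewrite !addr_ge0.
  exact: four_osc.
have [M12 M34] := four_sum b0 (X0 V1) (X0 V2) (X0 V3) (X0 V4).
have [S12 S34 E12 E34] := eight_sum (S0 V1) (S0 V2) (S0 V3) (S0 V4)
  (E0 V1) (E0 V2) (E0 V3) (E0 V4).
split => [j jn|j jn|j jm|j jm|j jn].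
- exact: (norm2_le_sum (u := x1 j w) (XP V1 j jn) (XP V2 j jn) M12).
- exact: (norm2_le_sum (u := x2 j w) (XP V3 j jn) (XP V4 j jn) M34).
- exact: (norm2_le_sum (u := x1 j w) (SP V1 j jm) (SP V2 j jm) S12).
- exact: (norm2_le_sum (u := x2 j w) (SP V3 j jm) (SP V4 j jm) S34).
- split.
    exact: (norm2_le_sum (u := x1 j w - x1 n w) (EP V1 j jn) (EP V2 j jn) E12).
  exact: (norm2_le_sum (u := x2 j w - x2 n w) (EP V3 j jn) (EP V4 j jn) E34).
Qed.

End four_walks.

(** * The diameter as a finite maximum, and its moments *)

Section two_walks.
Context {R : realType}.
Implicit Types (s t : nat -> Plane R) (c : R).

Lemma runmax_attained (u : nat -> R) n : exists2 i, (i <= n)%N & runmax u n = u i.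
Proof.
elim: n => [|n [i ni ui]]; first by exists 0%N.
rewrite /= /Num.max; case: ifP => _; first by exists n.+1.
by exists i => //; exact: leqW.
Qed.

Definition maxdist s t n := runmax (fun i => runmax (fun j => norm2 (s i - t j)) n) n.

Lemma maxdist_ge s t n i j : (i <= n)%N -> (j <= n)%N ->
  norm2 (s i - t j) <= maxdist s t n.
Proof.
move=> ni nj; apply: le_trans (runmax_ge _ ni).
exact: (runmax_ge (fun j => norm2 (s i - t j))).
Qed.

Lemma maxdist_attained s t n : exists i j,
  [/\ (i <= n)%N, (j <= n)%N & maxdist s t n = norm2 (s i - t j)].
Proof.
rewrite /maxdist.
have [i ni ->] := runmax_attained (fun i => runmax (fun j => norm2 (s i - t j)) n) n.
have [j nj ->] := runmax_attained (fun j => norm2 (s i - t j)) n.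
by exists i, j.
Qed.

Definition trajectory s n : set (Plane R) := [set s j | j in [set j | (j <= n)%N]].

(** Passing to the hull creates no larger distance. The finite maximum also makes measurability and
    square integrability of the diameter accessible. *)
Lemma diameter_two_walks s t n :
  diameter (convex_hull (trajectory s n `|` trajectory t n)) =
  Num.max (maxdist s s n) (Num.max (maxdist s t n) (maxdist t t n)).
Proof.
apply: diameter_hull => [p q|].
  by move=> [|] [i /= ni <-] [|] [j /= nj <-]; rewrite !le_max;
    [rewrite maxdist_ge|rewrite (maxdist_ge s t) ?orbT|
     rewrite norm2_distC (maxdist_ge s t) ?orbT|rewrite (maxdist_ge t t) ?orbT].
have ss i : (i <= n)%N -> (trajectory s n `|` trajectory t n) (s i).
  by move=> ni; left; exists i.
have tt i : (i <= n)%N -> (trajectory s n `|` trajectory t n) (t i).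
  by move=> ni; right; exists i.
rewrite /Num.max; case: ifP => _; [case: ifP => _|].
- have [i [j [ni nj ->]]] := maxdist_attained t t n.
  by exists (t i), (t j); split => //; exact: tt.
- have [i [j [ni nj ->]]] := maxdist_attained s t n.
  by exists (s i), (t j); split => //; [exact: ss|exact: tt].
- have [i [j [ni nj ->]]] := maxdist_attained s s n.
  by exists (s i), (s j); split => //; exact: ss.
Qed.

Lemma diameter_two_walks_ge s t n i j : (i <= n)%N -> (j <= n)%N ->
  let D := diameter (convex_hull (trajectory s n `|` trajectory t n)) in
  norm2 (s i - s j) <= D /\ norm2 (s i - t j) <= D.
Proof.
move=> ni nj D; rewrite /D diameter_two_walks !le_max.
by rewrite (maxdist_ge s s)// (maxdist_ge s t)// !orbT.
Qed.

Lemma diameter_two_walks_le s t n c : (forall i j, (i <= n)%N -> (j <= n)%N ->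
    [/\ norm2 (s i - s j) <= c, norm2 (s i - t j) <= c & norm2 (t i - t j) <= c]) ->
  diameter (convex_hull (trajectory s n `|` trajectory t n)) <= c.
Proof.
move=> h; rewrite diameter_two_walks !ge_max.
have [i1 [j1 [? ? ->]]] := maxdist_attained s s n.
have [i2 [j2 [? ? ->]]] := maxdist_attained s t n.
have [i3 [j3 [? ? ->]]] := maxdist_attained t t n.
by apply/and3P; split; [case: (h i1 j1)|case: (h i2 j2)|case: (h i3 j3)].
Qed.

End two_walks.

Section moments.
Context d (T : measurableType d) (R : realType) (P : probability T R).

Local Notation Ex := (Rintegral P setT).
Local Notation L1 X := (P.-integrable setT (EFin \o X)).
Local Notation L2 := (sq_integrable P).

Lemma L2_norm2 (X Y : T -> R) : L2 X -> L2 Y -> L2 (fun w => norm2 (X w, Y w)).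
Proof.
move=> iX iY; have [[mX _] [mY _]] := (iX, iY).
apply: (L2_le _ _ (L2D (L2_norm iX) (L2_norm iY))) => [|w].
  have ms := continuous_measurable_fun (@sqrt_continuous R).
  have mq : measurable_fun setT (fun w => X w * X w + Y w * Y w).
    by apply: measurable_funD; exact: measurable_funM.
  exact: (measurableT_comp ms mq).
rewrite (ger0_norm (norm2_ge0 _)) ger0_norm; first exact: norm2_sum.
exact: addr_ge0.
Qed.

Lemma maxdist_L2 (X Y X' Y' : nat -> T -> R) n :
  (forall i, L2 (X i)) -> (forall i, L2 (Y i)) ->
  (forall i, L2 (X' i)) -> (forall i, L2 (Y' i)) ->
  L2 (fun w => maxdist (fun i => (X i w, Y i w)) (fun i => (X' i w, Y' i w)) n).
Proof.
move=> iX iY iX' iY'.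
apply: (runmax_L2 (X := fun i w =>
  runmax (fun j => norm2 ((X i w, Y i w) - (X' j w, Y' j w))) n)) => i _.
apply: (runmax_L2 (X := fun j w => norm2 ((X i w, Y i w) - (X' j w, Y' j w)))) => j _.
exact: L2_norm2 (L2B (iX i) (iX' j)) (L2B (iY i) (iY' j)).
Qed.

Lemma moment_L2 (Z : {RV P >-> (R * R)%type}) :
  ('E_P[fun w => (norm2 (Z w) ^+ 2)%R] < +oo)%E ->
  L2 (fun w => (Z w).1) /\ L2 (fun w => (Z w).2).
Proof.
rewrite unlock => fin.
have mZ : measurable_fun setT Z by [].
have m1 : measurable_fun setT (fun w => (Z w).1) by exact: measurableT_comp.
have m2 : measurable_fun setT (fun w => (Z w).2) by exact: measurableT_comp.
have i : L1 (fun w => norm2 (Z w) ^+ 2).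
  apply/integrableP; split.
    apply/measurable_EFinP; under eq_fun do rewrite norm2_sqr.
    by apply: measurable_funD; exact: measurable_funX.
  under eq_integral do rewrite /= ger0_norm ?sqr_ge0//.
  exact: fin.
by split; split => //; apply: (L1_le _ _ i) => [|w];
  rewrite ?norm2_sqr ?ger0_norm ?sqr_ge0 ?lerDl ?lerDr ?sqr_ge0//; exact: measurable_funX.
Qed.

Lemma mean2E (Z : T -> Plane R) :
  mean2 P Z = (Ex (fun w => (Z w).1), Ex (fun w => (Z w).2)).
Proof. by rewrite /mean2 unlock. Qed.

End moments.

Section diameter.
Context d (T : measurableType d) (R : realType) (P : probability T R).
Variables (Z1 Z2 : nat -> {RV P >-> (R * R)%type}).
Hypotheses (iid1 : iid Z1) (iid2 : iid Z2) (indep12 : independent_families Z1 Z2).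
Hypotheses (moment1 : ('E_P[fun w => (norm2 (Z1 0%N w) ^+ 2)%R] < +oo)%E)
           (moment2 : ('E_P[fun w => (norm2 (Z2 0%N w) ^+ 2)%R] < +oo)%E).

Local Notation Ex := (Rintegral P setT).
Local Notation L1 X := (P.-integrable setT (EFin \o X)).
Local Notation L2 := (sq_integrable P).
Local Notation plane := (R * R)%type.
Local Notation D := (hull_diameter Z1 Z2).

Let mu1 := mean2 P (Z1 0%N).
Let mu2 := mean2 P (Z2 0%N).

Let X1 := (moment_L2 moment1).1.
Let Y1 := (moment_L2 moment1).2.
Let X2 := (moment_L2 moment2).1.
Let Y2 := (moment_L2 moment2).2.

Let mean_sub (X : T -> R) : L2 X -> Ex (fun w => X w - Ex X) = 0.
Proof. by move=> iX; rewrite ExB ?Ex_cst ?subrr//; [exact: L2_L1|exact: L1_cst]. Qed.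

Let sub_L2 (X : T -> R) c : L2 X -> L2 (fun w => X w - c).
Proof. by move=> iX; apply: L2B => //; exact: L2_cst. Qed.

Lemma innovations_coordinate1 : innovations P (past Z1 Z2) (fun i w => (Z1 i w).1 - mu1.1).
Proof.
apply: (innovations_pair iid1 iid2 indep12 (f := fun p => p.1.1 - mu1.1)).
- by apply: measurable_funB => //; exact: measurableT_comp.
- by have [] := sub_L2 mu1.1 X1.
- by rewrite /mu1 mean2E; exact: mean_sub.
Qed.

Lemma innovations_coordinate2 : innovations P (past Z1 Z2) (fun i w => (Z1 i w).2 - mu1.2).
Proof.
apply: (innovations_pair iid1 iid2 indep12 (f := fun p => p.1.2 - mu1.2)).
- by apply: measurable_funB => //; exact: measurableT_comp.
- by have [] := sub_L2 mu1.2 Y1.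
- by rewrite /mu1 mean2E; exact: mean_sub.
Qed.

Lemma innovations_coordinate3 : innovations P (past Z1 Z2) (fun i w => (Z2 i w).1 - mu2.1).
Proof.
apply: (innovations_pair iid1 iid2 indep12 (f := fun p => p.2.1 - mu2.1)).
- by apply: measurable_funB => //; exact: measurableT_comp.
- by have [] := sub_L2 mu2.1 X2.
- by rewrite /mu2 mean2E; exact: mean_sub.
Qed.

Lemma innovations_coordinate4 : innovations P (past Z1 Z2) (fun i w => (Z2 i w).2 - mu2.2).
Proof.
apply: (innovations_pair iid1 iid2 indep12 (f := fun p => p.2.2 - mu2.2)).
- by apply: measurable_funB => //; exact: measurableT_comp.
- by have [] := sub_L2 mu2.2 Y2.
- by rewrite /mu2 mean2E; exact: mean_sub.
Qed.

(** The coefficients (1, 0) give the fluctuation of one walk along [e], and (1, -1) that of the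
    difference. *)
Lemma innovations_dot (a1 a2 : R) (e : plane) : innovations P (past Z1 Z2)
  (fun i w => dot2 (scale2 a1 (Z1 i w - mu1) + scale2 a2 (Z2 i w - mu2)) e).
Proof.
pose f (p : plane * plane) :=
  dot2 (scale2 a1 (p.1 - mu1) + scale2 a2 (p.2 - mu2)) e.
have fE : (fun w => f (Z1 0%N w, Z2 0%N w)) = fun w =>
    a1 * e.1 * ((Z1 0%N w).1 - mu1.1) + a1 * e.2 * ((Z1 0%N w).2 - mu1.2)
  + a2 * e.1 * ((Z2 0%N w).1 - mu2.1) + a2 * e.2 * ((Z2 0%N w).2 - mu2.2).
  by apply/funext => w; rewrite /f /dot2/=; ring.
have i1 := L2Z (a1 * e.1) (sub_L2 mu1.1 X1); have i2 := L2Z (a1 * e.2) (sub_L2 mu1.2 Y1).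
have i3 := L2Z (a2 * e.1) (sub_L2 mu2.1 X2); have i4 := L2Z (a2 * e.2) (sub_L2 mu2.2 Y2).
apply: (innovations_pair iid1 iid2 indep12 (f := f)).
- rewrite /f /dot2/=.
  have m11 (c : R) : measurable_fun setT (fun p : plane * plane => p.1.1 - c).
    by apply: measurable_funB => //; exact: measurableT_comp.
  have m12 (c : R) : measurable_fun setT (fun p : plane * plane => p.1.2 - c).
    by apply: measurable_funB => //; exact: measurableT_comp.
  have m21 (c : R) : measurable_fun setT (fun p : plane * plane => p.2.1 - c).
    by apply: measurable_funB => //; exact: measurableT_comp.
  have m22 (c : R) : measurable_fun setT (fun p : plane * plane => p.2.2 - c).
    by apply: measurable_funB => //; exact: measurableT_comp.
  apply: measurable_funD; apply: measurable_funM => //; apply: measurable_funD;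
    exact: measurable_funM.
- have : L2 (fun w => f (Z1 0%N w, Z2 0%N w)).
    by rewrite fE; exact: L2D (L2D (L2D i1 i2) i3) i4.
  by case.
- have E1 : Ex (fun w => (Z1 0%N w).1 - mu1.1) = 0 by rewrite /mu1 mean2E; exact: mean_sub.
  have E2 : Ex (fun w => (Z1 0%N w).2 - mu1.2) = 0 by rewrite /mu1 mean2E; exact: mean_sub.
  have E3 : Ex (fun w => (Z2 0%N w).1 - mu2.1) = 0 by rewrite /mu2 mean2E; exact: mean_sub.
  have E4 : Ex (fun w => (Z2 0%N w).2 - mu2.2) = 0 by rewrite /mu2 mean2E; exact: mean_sub.
  rewrite fE (ExD (L2_L1 (L2D (L2D i1 i2) i3)) (L2_L1 i4)).
  rewrite (ExD (L2_L1 (L2D i1 i2)) (L2_L1 i3)) (ExD (L2_L1 i1) (L2_L1 i2)).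
  rewrite (ExZ _ (L2_L1 (sub_L2 mu1.1 X1))) (ExZ _ (L2_L1 (sub_L2 mu1.2 Y1))).
  rewrite (ExZ _ (L2_L1 (sub_L2 mu2.1 X2))) (ExZ _ (L2_L1 (sub_L2 mu2.2 Y2))).
  by rewrite E1 E2 E3 E4 !mulr0 !addr0.
Qed.

Definition fluctuation (Z : nat -> {RV P >-> (R * R)%type}) n w : plane :=
  (psum (fun i w => (Z i w).1 - (mean2 P (Z 0%N)).1) n w,
   psum (fun i w => (Z i w).2 - (mean2 P (Z 0%N)).2) n w).

Lemma walkE (Z : nat -> {RV P >-> (R * R)%type}) n w :
  walk Z n w = scale2 n%:R (mean2 P (Z 0%N)) + fluctuation Z n w.
Proof.
elim: n => [|n IH].
  rewrite /fluctuation /psum /walk !big_ord0; apply/pair_equal_spec.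
  by rewrite /= !mul0r !addr0.
rewrite [walk _ _ _]big_ord_recr/= -/(walk Z n w) IH /fluctuation.
rewrite !psumS -natr1.
by apply/pair_equal_spec; split; rewrite /=; ring.
Qed.

Lemma psum_dot (a1 a2 : R) (e : plane) n w :
  psum (fun i w => dot2 (scale2 a1 (Z1 i w - mu1) + scale2 a2 (Z2 i w - mu2)) e) n w
  = dot2 (scale2 a1 (fluctuation Z1 n w) + scale2 a2 (fluctuation Z2 n w)) e.
Proof.
elim: n => [|n IH].
  by rewrite /fluctuation /psum !big_ord0 /dot2/= !mulr0 !addr0 !mul0r addr0.
rewrite psumS IH /fluctuation !psumS /dot2/=.
by rewrite -/mu1 -/mu2; ring.
Qed.

Lemma hull_diameterE n w : D n w =
  diameter (convex_hull (trajectory (walk Z1 ^~ w) n `|` trajectory (walk Z2 ^~ w) n)).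
Proof. by []. Qed.

Lemma L2_hull_diameter n : L2 (D n).
Proof.
have w1 j : L2 (fun w => (walk Z1 j w).1).
  under eq_fun do rewrite walkE.
  exact: L2D (L2_cst P _) (psum_L2 innovations_coordinate1 j).
have w2 j : L2 (fun w => (walk Z1 j w).2).
  under eq_fun do rewrite walkE.
  exact: L2D (L2_cst P _) (psum_L2 innovations_coordinate2 j).
have w3 j : L2 (fun w => (walk Z2 j w).1).
  under eq_fun do rewrite walkE.
  exact: L2D (L2_cst P _) (psum_L2 innovations_coordinate3 j).
have w4 j : L2 (fun w => (walk Z2 j w).2).
  under eq_fun do rewrite walkE.
  exact: L2D (L2_cst P _) (psum_L2 innovations_coordinate4 j).
have m11 := maxdist_L2 n w1 w2 w1 w2; have m12 := maxdist_L2 n w1 w2 w3 w4.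
have m22 := maxdist_L2 n w3 w4 w3 w4.
have := L2_max m11 (L2_max m12 m22).
congr (sq_integrable P _); apply/funext => w.
rewrite hull_diameterE diameter_two_walks.
have E (Z : nat -> {RV P >-> (R * R)%type}) :
    (fun i => ((walk Z i w).1, (walk Z i w).2)) = walk Z ^~ w.
  by apply/funext => i; case: (walk Z i w).
by rewrite !E.
Qed.

(** The geometry enters only through two pathwise bounds. They enclose
    [D n w - n%:R * rho - psum W n w] between 0 and an error small in mean square, so squares can be
    compared and [clt_perturbed] applies with centre [n%:R * rho]. *)
Lemma diameter_clt (W : nat -> T -> R) (rho eta x : R) :
  innovations P (past Z1 Z2) W -> 0 < Ex (fun w => W 0%N w ^+ 2) ->
  0 < rho -> 0 < eta ->
  (forall n w, n%:R * rho + psum W n w <= D n w) ->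
  (forall n m w O M a, (0 < n)%N -> (2 * m <= n)%N -> 0 <= a -> 2 * a <= eta * m%:R ->
    [/\ (forall j, (j <= n)%N -> norm2 (fluctuation Z1 j w) <= M),
        (forall j, (j <= n)%N -> norm2 (fluctuation Z2 j w) <= M),
        (forall j, (j <= m)%N -> norm2 (fluctuation Z1 j w) <= O),
        (forall j, (j <= m)%N -> norm2 (fluctuation Z2 j w) <= O) &
        (forall j, (n - m <= j <= n)%N ->
          norm2 (fluctuation Z1 j w - fluctuation Z1 n w) <= O /\
          norm2 (fluctuation Z2 j w - fluctuation Z2 n w) <= O)] ->
    D n w <= n%:R * rho + psum W n w + walk_error n rho O M a) ->
  (P [set w | (D n w - fine 'E_P[D n]) / Num.sqrt (fine 'V_P[D n]) <= x]
     @[n --> \oo] --> std_normal_cdf x) /\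
  (P [set w | (D n w - fine 'E_P[D n]) / Num.sqrt (Ex (fun w => W 0%N w ^+ 2) * n%:R) <= x]
     @[n --> \oo] --> std_normal_cdf x).
Proof.
move=> GW var0 rho0 eta0 lower upper.
apply: (clt_perturbed GW var0 (c := fun n => n%:R * rho)) => [|e e0].
  exact: L2_hull_diameter.
have := walk_error_small innovations_coordinate1 innovations_coordinate2
  innovations_coordinate3 innovations_coordinate4 rho0 eta0 e0.
apply: filterS => n [m [a [err [n0 mn a0 am [ierr errn errP]]]]].
apply: le_trans errn; apply: Ex_le.
- have iR : L2 (fun w => D n w - n%:R * rho - psum W n w).
    exact: L2B (L2B (L2_hull_diameter n) (L2_cst P _)) (psum_L2 GW n).
  by case: iR.
- by case: ierr.
move=> w; case: (errP w) => O [M [errE h]].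
have lo : 0 <= D n w - n%:R * rho - psum W n w by rewrite -addrA -opprD subr_ge0.
have up : D n w - n%:R * rho - psum W n w <= err w.
  by rewrite -addrA -opprD lerBlDl errE; exact: (upper n m w O M a).
by apply: lerXn2r; rewrite ?nnegrE// (le_trans lo).
Qed.

End diameter.

(** * The three cases of the maximal drift *)

Lemma hull_diameterC d (T : measurableType d) (R : realType) (P : probability T R)
    (Z1 Z2 : nat -> {RV P >-> (R * R)%type}) :
  hull_diameter Z1 Z2 = hull_diameter Z2 Z1.
Proof.
by apply/funext => n; apply/funext => w; rewrite /hull_diameter /walk_points setUC.
Qed.

Section limit_theorem.
Context d (T : measurableType d) (R : realType) (P : probability T R).

Local Notation Ex := (Rintegral P setT).

Definition diameter_normal (Z1 Z2 : nat -> {RV P >-> (R * R)%type}) (v x : R) :=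
  let D := hull_diameter Z1 Z2 in
  (P [set w | (D n w - fine 'E_P[D n]) / Num.sqrt (fine 'V_P[D n]) <= x]
     @[n --> \oo] --> std_normal_cdf x) /\
  (P [set w | (D n w - fine 'E_P[D n]) / Num.sqrt (v * n%:R) <= x]
     @[n --> \oo] --> std_normal_cdf x).

Variables (Z1 Z2 : nat -> {RV P >-> (R * R)%type}).
Hypotheses (iid1 : iid Z1) (iid2 : iid Z2) (indep12 : independent_families Z1 Z2).
Hypotheses (moment1 : ('E_P[fun w => (norm2 (Z1 0%N w) ^+ 2)%R] < +oo)%E)
           (moment2 : ('E_P[fun w => (norm2 (Z2 0%N w) ^+ 2)%R] < +oo)%E).

Local Notation D := (hull_diameter Z1 Z2).
Local Notation mu1 := (mean2 P (Z1 0%N)).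
Local Notation mu2 := (mean2 P (Z2 0%N)).

Lemma diameter_clt_single (x : R) : mu1 <> 0 ->
  norm2 mu2 < norm2 mu1 -> norm2 (mu1 - mu2) < norm2 mu1 ->
  let v := fine 'E_P[fun w => dot2 (Z1 0%N w - mu1) (dir (angle mu1)) ^+ 2] in
  0 < v -> diameter_normal Z1 Z2 v x.
Proof.
move=> mu10 lt2 lt12 v v0; set rho := norm2 mu1; set e := dir (angle mu1) in v v0 *.
have muE : mu1 = scale2 rho e by exact: angleP.
have rho0 : 0 < rho by exact: le_lt_trans (norm2_ge0 _) lt2.
have e1 : norm2 e = 1 by exact: dir_norm2.
have ee : e.1 ^+ 2 + e.2 ^+ 2 = 1 by rewrite -norm2_sqr e1 expr1n.
have [rho' [rho'0 rho'rho r2 r12]] : exists rho' : R,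
    [/\ 0 <= rho', rho' < rho, norm2 mu2 <= rho' & norm2 (mu1 - mu2) <= rho'].
  exists (Num.max (norm2 mu2) (norm2 (mu1 - mu2))).
  by rewrite gt_max !le_max norm2_ge0 lt2 lt12 !lexx orbT.
have dotE (u : Plane R) (u' : Plane R) : dot2 (scale2 1 u + scale2 0 u') e = dot2 u e.
  by rewrite /dot2/= !mul1r !mul0r !addr0.
have GW := innovations_dot iid1 iid2 indep12 moment1 moment2 1 0 e.
have psE := psum_dot Z1 Z2 1 0 e.
set W := (fun i w => _) in GW.
have vE : v = Ex (fun w => W 0%N w ^+ 2).
  rewrite /v unlock; congr fine; apply: eq_integral => w _.
  by rewrite /W dotE.
rewrite vE in v0 *.
apply: (diameter_clt iid1 iid2 indep12 moment1 moment2 x GW v0 rho0 (eta := rho - rho')).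
- by rewrite subr_gt0.
- move=> n w; rewrite psE dotE.
  have [h _] := diameter_two_walks_ge (walk Z1 ^~ w) (walk Z2 ^~ w) (leqnn n) (leq0n n).
  apply: le_trans h; have := dot2_le (walk Z1 n w - walk Z1 0 w) e.
  rewrite e1 mulr1; apply: le_trans.
  rewrite walkE muE [walk Z1 0 w]big_ord0 subr0.
  rewrite (_ : dot2 (_ + _) e = n%:R * rho * (e.1 ^+ 2 + e.2 ^+ 2)
    + dot2 (fluctuation Z1 n w) e); last by rewrite /dot2/=; ring.
  by rewrite ee mulr1.
move=> n m w O M a n0 mn a0 am [M1 M2 O1 O2 E12].
rewrite psE dotE hull_diameterE; apply: diameter_two_walks_le => i j ni nj.
apply: (walk_bound_single (x2 := fluctuation Z2 ^~ w) (mu1 := mu1) (mu2 := mu2)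
  (rho' := rho') (m := m) (fun j => walkE Z1 j w) (fun j => walkE Z2 j w)) => //.
all: by move=> k /E12[].
Qed.

Lemma diameter_clt_difference (x : R) : mu1 - mu2 <> 0 ->
  norm2 mu1 < norm2 (mu1 - mu2) -> norm2 mu2 < norm2 (mu1 - mu2) ->
  let v := fine 'E_P[fun w => dot2 ((Z1 0%N w - mu1) - (Z2 0%N w - mu2))
                                   (dir (angle (mu1 - mu2))) ^+ 2] in
  0 < v -> diameter_normal Z1 Z2 v x.
Proof.
move=> mu0 lt1 lt2 v v0.
set rho := norm2 (mu1 - mu2); set e := dir (angle (mu1 - mu2)) in v v0 *.
have muE : mu1 - mu2 = scale2 rho e by exact: angleP.
have rho0 : 0 < rho by exact: le_lt_trans (norm2_ge0 _) lt2.
have e1 : norm2 e = 1 by exact: dir_norm2.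
have ee : e.1 ^+ 2 + e.2 ^+ 2 = 1 by rewrite -norm2_sqr e1 expr1n.
have [rho' [rho'0 rho'rho r1 r2]] : exists rho' : R,
    [/\ 0 <= rho', rho' < rho, norm2 mu1 <= rho' & norm2 mu2 <= rho'].
  exists (Num.max (norm2 mu1) (norm2 mu2)).
  by rewrite gt_max !le_max norm2_ge0 lt1 lt2 !lexx orbT.
have dotE (u : Plane R) (u' : Plane R) :
    dot2 (scale2 1 u + scale2 (-1) u') e = dot2 (u - u') e.
  by rewrite /dot2/= !mul1r !mulN1r.
have GW := innovations_dot iid1 iid2 indep12 moment1 moment2 1 (-1) e.
have psE := psum_dot Z1 Z2 1 (-1) e.
set W := (fun i w => _) in GW.
have vE : v = Ex (fun w => W 0%N w ^+ 2).
  rewrite /v unlock; congr fine; apply: eq_integral => w _.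
  by rewrite /W dotE.
rewrite vE in v0 *.
apply: (diameter_clt iid1 iid2 indep12 moment1 moment2 x GW v0 rho0 (eta := rho - rho')).
- by rewrite subr_gt0.
- move=> n w; rewrite psE dotE.
  have [_ h] := diameter_two_walks_ge (walk Z1 ^~ w) (walk Z2 ^~ w) (leqnn n) (leqnn n).
  apply: le_trans h; have := dot2_le (walk Z1 n w - walk Z2 n w) e.
  rewrite e1 mulr1; apply: le_trans.
  rewrite !walkE (_ : mu1 = mu2 + scale2 rho e); last by rewrite -muE addrC subrK.
  rewrite (_ : dot2 (_ + _ - _) e = n%:R * rho * (e.1 ^+ 2 + e.2 ^+ 2)
    + dot2 (fluctuation Z1 n w - fluctuation Z2 n w) e); last by rewrite /dot2/=; ring.
  by rewrite ee mulr1.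
move=> n m w O M a n0 mn a0 am [M1 M2 O1 O2 E12].
rewrite psE dotE hull_diameterE; apply: diameter_two_walks_le => i j ni nj.
apply: (walk_bound_difference (mu1 := mu1) (mu2 := mu2)
  (rho' := rho') (m := m) (fun j => walkE Z1 j w) (fun j => walkE Z2 j w)) => //.
all: by move=> k /E12[].
Qed.

End limit_theorem.

(** Each alternative gives the outcomes of the tests in [sigmaD2] in a form fit for rewriting,
    together with the strict inequalities that its case needs. *)
Lemma unique_max3 (R : realType) (a b c : R) :
  count_mem (Num.max a (Num.max b c)) [:: a; b; c] = 1%N ->
  let m := Num.max a (Num.max b c) in
  [\/ [/\ a == m, b < a & c < a],
      [/\ (a == m) = false, b == m, a < b & c < b] |
      [/\ (a == m) = false, (b == m) = false, a < c & b < c]].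
Proof.
move=> h m; move: h; rewrite /= -/m addn0 => h.
have am : a <= m by rewrite /m le_max lexx.
have bm : b <= m by rewrite /m !le_max lexx orbT.
have cm : c <= m by rewrite /m !le_max lexx !orbT.
have lt x : x <= m -> (x == m) = false -> x < m by rewrite lt_neqAle => -> ->.
have [aE|aN] := boolP (a == m).
  constructor 1; move: h; rewrite aE => h; split => //; rewrite (eqP aE);
    apply: lt => //; apply/negbTE/negP => hE; move: h; rewrite hE.
  - by [].
  - by case: (b == m).
have [bE|bN] := boolP (b == m).
  constructor 2; move: h; rewrite bE (negbTE aN) => h; split => //; rewrite (eqP bE);
    apply: lt => //; first exact: negbTE.
  by apply/negbTE/negP => hE; move: h; rewrite hE.
move: h; rewrite (negbTE aN) (negbTE bN) !add0n; case: eqP => // -> _.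
by constructor 3; split => //; apply: lt => //; exact: negbTE.
Qed.

Theorem theorem2p7 (R : realType) (d : measure_display) (T : measurableType d)
    (P : probability T R) (Z1 Z2 : nat -> {RV P >-> (R * R)%type})
    (iid1 : iid Z1) (iid2 : iid Z2) (indep12 : independent_families Z1 Z2)
    (moment1 : ('E_P[fun w => (norm2 (Z1 0%N w) ^+ 2)%R] < +oo)%E)
    (moment2 : ('E_P[fun w => (norm2 (Z2 0%N w) ^+ 2)%R] < +oo)%E)
    (drift1 : mean2 P (Z1 0%N) <> 0) (drift2 : mean2 P (Z2 0%N) <> 0)
    (drift12 : mean2 P (Z1 0%N) - mean2 P (Z2 0%N) <> 0)
    (unique_max : unique_max_drift Z1 Z2)
    (sigma_gt0 : 0 < sigmaD2 Z1 Z2) (x : R) :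
  let D := hull_diameter Z1 Z2 in
  let ED n := fine 'E_P[D n] in
  let VD n := fine 'V_P[D n] in
  (P [set w | (D n w - ED n) / Num.sqrt (VD n) <= x] @[n --> \oo]
     --> std_normal_cdf x) /\
  (P [set w | (D n w - ED n) / Num.sqrt (sigmaD2 Z1 Z2 * n%:R) <= x] @[n --> \oo]
     --> std_normal_cdf x).
Proof.
suff : diameter_normal Z1 Z2 (sigmaD2 Z1 Z2) x by [].
move: sigma_gt0; rewrite /sigmaD2.
have := unique_max3 unique_max; rewrite -/(max_drift Z1 Z2).
case=> [[-> lt2 lt12]|[-> -> lt1 lt12]|[-> -> lt1 lt2]].
- exact: diameter_clt_single.
(* This case is the first one with the walks exchanged; the hull diameter and the independence
   assumption are symmetric in them. *)
- have indep21 : independent_families Z2 Z1.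
    by move=> A B hA hB; rewrite setIC muleC indep12.
  rewrite norm2_distC in lt12.
  rewrite /diameter_normal hull_diameterC; exact: diameter_clt_single.
- exact: diameter_clt_difference.
Qed.
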